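(* Let $W=\mathbb{C}^3$ and let $P\in\mathbb{C}[W]_3$ be any form (homogeneous polynomial of degree $3$) that defines a nonsingular curve in $\mathbb{P}^2$. The group $\operatorname{GL}(W)$ acts on $\mathbb{C}[W]_3$ from the right by precomposition, $(Q,g)\mapsto Q\circ g$. Let $\Omega=P\circ\operatorname{GL}(W)\subseteq\mathbb{C}[W]_3$ be the orbit of $P$ under this action, $\overline{\Omega}$ its Zariski closure in $\mathbb{C}[W]_3$, and $\nu\colon \operatorname{N}(\overline{\Omega})\to\overline{\Omega}$ the normalization of $\overline{\Omega}$. Then the stabilizer of $P$ in $\operatorname{GL}(W)$ is reductive, the boundary $\partial\Omega:=\overline{\Omega}\setminus\Omega$ is irreducible, and the coordinate ring $\mathbb{C}[\operatorname{N}(\overline{\Omega})]$ is not isomorphic, as a $\operatorname{GL}(W)$-module, to the polynomial part $\mathbb{C}[\Omega]_{\sqsupseteq 0}$ of $\mathbb{C}[\Omega]$.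
   Context: All varieties and algebraic groups are over $\mathbb{C}$. $\mathbb{C}[W]_3$ denotes the space of homogeneous polynomials of degree $3$ on $W$, and $\mathbb{C}[X]$ denotes the coordinate ring (ring of regular functions) of a variety $X$. A ''reductive'' group is a linear algebraic group, not necessarily connected, all of whose rational representations are completely reducible (so finite groups are reductive). Polynomial part: for an $n$-dimensional complex vector space $W$, the irreducible rational $\operatorname{GL}(W)$-modules are the modules $\mathbb{V}(\lambda)$ indexed by dominant weights $\lambda\in\Lambda:=\{\lambda\in\mathbb{Z}^n : \lambda_1\ge\cdots\ge\lambda_n\}$. Write $\mu\sqsubseteq\lambda$ if $\mu_i\le\lambda_i$ for all $i$. The action of $\operatorname{GL}(W)$ on $\mathbb{V}(\lambda)$ extends to a morphism of varieties defined with $\operatorname{End}(W)$ in place of $\operatorname{GL}(W)$ if and only if $0\sqsubseteq\lambda$. If a rational $\operatorname{GL}(W)$-module $\mathbb{V}$ decomposes as $\mathbb{V}\cong\bigoplus_{\lambda\in\Lambda}\mathbb{V}(\lambda)^{\oplus n_\lambda}$, its polynomial part is the submodule $\mathbb{V}_{\sqsupseteq0}:=\bigoplus_{\lambda\in\Lambda,\ \lambda\sqsupseteq0}\mathbb{V}(\lambda)^{\oplus n_\lambda}\subseteq\mathbb{V}$. Module structures: $\operatorname{GL}(W)$ acts on $\mathbb{C}[\Omega]$ and on $\mathbb{C}[\overline\Omega]$ by $(g\cdot f)(x)=f(x\circ g)$; the action on $\overline\Omega$ lifts uniquely to its normalization $\operatorname{N}(\overline\Omega)$, and $\operatorname{GL}(W)$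 acts on $\mathbb{C}[\operatorname{N}(\overline{\Omega})]$ in the same way. (With these actions, ''polynomial'' means that the action extends to $\operatorname{End}(W)$.) *)

(* Defs.v *)
From HB Require Import structures.
From mathcomp Require Import all_boot all_order all_algebra.
From mathcomp Require Import boolp classical_sets functions reals.
From mathcomp Require Import complex mpoly.

Set Implicit Arguments.
Unset Strict Implicit.
Unset Printing Implicit Defensive.

Import GRing.Theory.
Local Open Scope ring_scope.
Local Open Scope classical_set_scope.
Local Open Scope quotient_scope.

Section ZariskiTopology.
Variables (K : closedFieldType) (V : vectType K).
Implicit Types (S Z U : set V) (p q : {mpoly K[\dim {:V}]}).

Definition evalp p (v : V) : K := p.@[fun i => coord (vbasis {:V}) i v].

Definition zclosed Z :=
  exists F : set {mpoly K[\dim {:V}]},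
    Z = [set v | forall p, F p -> evalp p v = 0].

Definition zopen U := zclosed (~` U).

Definition zclosure S : set V := smallest zclosed S.

(* Irreducibility of S for the topology induced by V; not assumed closed. *)
Definition irreducible S :=
  S !=set0 /\
  forall Z1 Z2, zclosed Z1 -> zclosed Z2 ->
    S `<=` Z1 `|` Z2 -> S `<=` Z1 \/ S `<=` Z2.

(* Regular functions on S (which is meant to be locally closed): locally
   quotients of polynomials.  The codomain is K^o for its lmodType structure. *)
Definition regular_fun S (f : S -> K^o) :=
  forall x : S, exists U p q,
    [/\ zopen U, U (val x) &
        forall y : S, U (val y) ->
          evalp q (val y) != 0 /\ f y = evalp p (val y) / evalp q (val y)].

Lemma zopenI U1 U2 : zopen U1 -> zopen U2 -> zopen (U1 `&` U2).
Proof.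
move=> [F1 E1] [F2 E2].
exists [set p | exists p1 p2, [/\ F1 p1, F2 p2 & p = p1 * p2]].
rewrite setCI E1 E2; apply/seteqP; split=> v /=.
- move=> H p [p1 [p2 [h1 h2 ->]]]; rewrite /evalp mevalM.
  by case: H => H; [rewrite [X in X * _]H // mul0r|rewrite [X in _ * X]H // mulr0].
- move=> H; case: (pselect (forall p, F1 p -> evalp p v = 0)) => [|/existsNP]; first by left.
  move=> [p1 /not_implyP [h1 /eqP n1]]; right => p2 h2.
  have := H (p1 * p2); rewrite /evalp mevalM => /(_ _)/eqP.
  rewrite mulf_eq0 (negbTE n1) /= => h; apply/eqP/h.
  by exists p1, p2.
Qed.

Lemma zopenT : zopen setT.
Proof.
exists setT; rewrite setCT; apply/seteqP; split=> v //= /(_ 1 I) /eqP.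
by rewrite /evalp meval1 oner_eq0.
Qed.

Lemma zopen_neq0 p : zopen [set v | evalp p v != 0].
Proof.
exists [set p]; apply/seteqP; split=> v /=.
  by move=> /negP; rewrite negbK => /eqP h _ ->.
by move=> /(_ p erefl) ->; rewrite eqxx.
Qed.

Lemma evalp_comp (phi : {linear V -> V}) p :
  exists p', forall v, evalp p' v = evalp p (phi v).
Proof.
exists (p \mPo [tuple \sum_(j < \dim {:V}) coord (vbasis {:V}) i (phi (vbasis {:V})`_j) *: 'X_j
                | i < \dim {:V}]) => v.
rewrite /evalp comp_mpoly_meval; apply: meval_eq => i.
rewrite tnth_map tnth_ord_tuple raddf_sum /=.
rewrite {2}(coord_vbasis (memvf v)) linear_sum linear_sum /=.
by apply: eq_bigr => j _; rewrite mevalZ mevalXU !linearZ /= mulrC.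
Qed.

Lemma zopen_preim (phi : {linear V -> V}) U :
  zopen U -> zopen [set v | U (phi v)].
Proof.
move=> [F E]; exists [set p' | exists2 p, F p & forall v, evalp p' v = evalp p (phi v)].
apply/seteqP; split=> v /=.
- move=> h p' [p Fp ->]; have : (~` U) (phi v) by [].
  by rewrite E; exact.
- move=> h; suff : (~` U) (phi v) by [].
  rewrite E => p Fp; have [p' hp'] := evalp_comp phi p.
  by rewrite -hp'; apply: h; exists p.
Qed.

Lemma zclosure_sub S : S `<=` zclosure S.
Proof. exact: sub_gen_smallest. Qed.

Lemma irreducible_zclosure S : irreducible S -> irreducible (zclosure S).
Proof.
move=> [[x Sx] H]; split; first by exists x; apply: zclosure_sub.
move=> Z1 Z2 c1 c2 s12; have := H Z1 Z2 c1 c2 (subset_trans (@zclosure_sub S) s12).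
by case=> h; [left|right]; apply: smallest_sub.
Qed.

Lemma zclosure_stable (phi : {linear V -> V}) S :
  (forall x, S x -> S (phi x)) ->
  forall x, zclosure S x -> zclosure S (phi x).
Proof.
move=> hS x clx Z [cZ SZ].
have : zclosed [set v | Z (phi v)].
  have := @zopen_preim phi (~` Z); rewrite /zopen setCK => /(_ cZ).
  by congr zclosed; apply/seteqP; split=> v /= => [/contrapT|? /(_ _)] //; apply.
move=> cZ'; apply: (clx [set v | Z (phi v)]); split => // v /hS; exact: SZ.
Qed.

End ZariskiTopology.

Section RegularFunctions.
Variables (K : closedFieldType) (V : vectType K).

Definition regular_pred (S : set V) : {pred (S -> K^o)} :=
  [pred f | `[< regular_fun f >]].

(* K[S] *)
Record regfun (S : set V) := Regfun {
  regfun_val :> S -> K^o;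
  _ : regfun_val \in @regular_pred S }.

HB.instance Definition _ (S : set V) := [isSub for @regfun_val S].
HB.instance Definition _ (S : set V) := [Choice of regfun S by <:].

Section Closed.
Variable S : set V.

Lemma regular_cst c : @regular_fun K V S (fun=> c).
Proof.
move=> x; exists setT, c%:MP, 1; split=> // [|y _]; first exact: zopenT.
by rewrite /evalp !mevalC oner_neq0 divr1.
Qed.

Lemma regular_op (f g : S -> K^o) (h : K -> K -> K) :
  (forall p q p' q', exists p'' q'', forall v : V,
     evalp q v != 0 -> evalp q' v != 0 ->
     evalp q'' v != 0 /\
     h (evalp p v / evalp q v) (evalp p' v / evalp q' v) =
       evalp p'' v / evalp q'' v) ->
  regular_fun f -> regular_fun g -> @regular_fun K V S (fun x => h (f x) (g x)).
Proof.
move=> hh rf rg x.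
have [U [p [q [oU Ux H]]]] := rf x; have [U' [p' [q' [oU' U'x H']]]] := rg x.
have [p'' [q'' E]] := hh p q p' q'.
exists (U `&` U'), p'', q''; split=> // [|y [Uy U'y]]; first exact: zopenI.
by have [n ->] := H y Uy; have [n' ->] := H' y U'y; exact: E.
Qed.

Lemma regular_subring : subring_closed (@regular_pred S).
Proof.
split=> [|f g|f g]; rewrite !inE.
- exact: regular_cst.
- apply: (@regular_op _ _ (fun a b => a - b)) => p q p' q'.
  exists (p * q' - p' * q), (q * q') => v n n'.
  rewrite /evalp mevalB !mevalM -/(evalp _ _) mulf_neq0 //; split=> //.
  by rewrite -mulNr addf_div // mulNr.
- apply: (@regular_op _ _ (fun a b => a * b)) => p q p' q'.
  exists (p * p'), (q * q') => v n n'.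
  by rewrite /evalp !mevalM -/(evalp _ _) mulf_neq0 // mulf_div.
Qed.

Lemma regular_subsemimod : subsemimod_closed (@regular_pred S).
Proof.
split.
  exact: GRing.zmod_closedD (GRing.subring_closedB regular_subring).
move=> c f /= hf; have hc : (fun=> c) \in @regular_pred S by rewrite inE; exact: regular_cst.
have [_ _ hM] := regular_subring; exact: hM hc hf.
Qed.
End Closed.

HB.instance Definition _ (S : set V) :=
  GRing.SubChoice_isSubComPzRing.Build _ _ (regfun S) (@regular_subring S).
HB.instance Definition _ (S : set V) :=
  GRing.SubZmodule_isSubLmodule.Build K _ _ (regfun S) (@regular_subsemimod S).

Section Pullback.
Variables (S : set V) (phi : {linear V -> V}).
Hypothesis phiS : forall x, S x -> S (phi x).

Definition restrict_map (x : S) : S :=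
  exist _ (phi (val x)) (mem_set (phiS (set_valP x))).

Lemma regular_pullback (f : S -> K^o) :
  regular_fun f -> regular_fun (f \o restrict_map).
Proof.
move=> rf x; have [U [p [q [oU Ux H]]]] := rf (restrict_map x).
have [p' hp'] := evalp_comp phi p; have [q' hq'] := evalp_comp phi q.
exists [set v | U (phi v)], p', q'; split=> //; first exact: zopen_preim.
by move=> y Uy; rewrite hp' hq'; exact: (H (restrict_map y)).
Qed.

Lemma regular_pullback_subproof (f : regfun S) :
  (f \o restrict_map : S -> K^o) \in @regular_pred S.
Proof. by apply/asboolP; apply: regular_pullback; apply/asboolP; exact: (valP f). Qed.

Definition pullback (f : regfun S) : regfun S :=
  Regfun (regular_pullback_subproof f).

Lemma pullback_is_zmod_morphism : zmod_morphism pullback.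
Proof. by move=> f g; exact/val_inj. Qed.
Lemma pullback_is_monoid_morphism : monoid_morphism pullback.
Proof. by split=> [|f g]; exact/val_inj. Qed.
HB.instance Definition _ := GRing.isZmodMorphism.Build _ _ pullback
  pullback_is_zmod_morphism.
HB.instance Definition _ := GRing.isMonoidMorphism.Build _ _ pullback
  pullback_is_monoid_morphism.
End Pullback.
End RegularFunctions.

Lemma tofrac_repr (R : idomainType) (z : {fraction R}) :
  z * tofrac (frac (repr z)).2 = tofrac (frac (repr z)).1.
Proof.
have key (x : {ratio R}) : \pi_{fraction R} x * tofrac (frac x).2 = tofrac (frac x).1.
  unlock tofrac; rewrite -[LHS]FracField.pi_mul; apply/eqmodP.
  rewrite /= FracField.equivfE /FracField.mulf !numden_Ratio ?oner_eq0 //.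
  by rewrite !mulr1 mulrC.
  1,2: by rewrite mulr1 denom_ratioP.
by have := key (repr z); rewrite reprK.
Qed.

Section FunctionField.
Variables (K : closedFieldType) (V : vectType K).

Record irred_set := IrredSet {
  irred_carrier :> set V;
  irred_setP : irreducible irred_carrier }.

Variable X : irred_set.

Lemma regfun_oner_neq0 : 1 != 0 :> regfun X.
Proof.
have [[x Xx] _] := irred_setP X; apply/eqP => /(congr1 val)/(congr1 (@^~ (SigSub (mem_set Xx)))).
by move/eqP; rewrite /= oner_eq0.
Qed.
HB.instance Definition _ :=
  GRing.PzSemiRing_isNonZero.Build (regfun X) regfun_oner_neq0.

Lemma regfun_scaleAl (a : K) (f g : regfun X) : a *: (f * g) = (a *: f) * g.
Proof. by apply/val_inj/funext => x /=; exact: mulrA. Qed.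
HB.instance Definition _ :=
  GRing.Lmodule_isLalgebra.Build K (regfun X) regfun_scaleAl.

Definition regfun_unit : {pred regfun X} := [pred f | `[< exists g, g * f = 1 >]].
Definition regfun_inv (f : regfun X) : regfun X :=
  if pselect (exists g, g * f = 1) is left h then projT1 (cid h) else f.

Lemma regfun_mulVx : {in regfun_unit, left_inverse 1 regfun_inv *%R}.
Proof.
move=> f /asboolP h; rewrite /regfun_inv.
by case: pselect => // h'; case: (cid h').
Qed.
Lemma regfun_unitPl f g : g * f = 1 -> regfun_unit f.
Proof. by move=> h; apply/asboolP; exists g. Qed.
Lemma regfun_invx_out : {in [predC regfun_unit], regfun_inv =1 id}.
Proof.
by move=> f /asboolPn h; rewrite /regfun_inv; case: pselect.
Qed.
HB.instance Definition _ := GRing.ComNzRing_hasMulInverse.Build (regfun X)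
  regfun_mulVx regfun_unitPl regfun_invx_out.

Lemma regfun_idomain : GRing.integral_domain_axiom (regfun X).
Proof.
have open_neq0 (f : regfun X) : f != 0 -> exists U, [/\ zopen U,
    exists x : X, U (val x) & forall x : X, U (val x) -> f x != 0].
  move=> f0; have [x fx] : exists x, f x != 0.
    apply: contrapT => /forallNP h; case/eqP: f0; apply/val_inj/funext => x.
    by apply/eqP/negPn/negP/h.
  have /asboolP/(_ x) [U [p [q [oU Ux H]]]] := valP f.
  exists (U `&` [set v | evalp p v != 0]); split.
  - exact: zopenI (zopen_neq0 p).
  - exists x; split=> //=; have [_ E] := H x Ux.
    by apply: contraNneq fx => p0; rewrite E p0 mul0r.
  - by move=> y [Uy /= py]; have [n ->] := H y Uy; rewrite mulf_neq0 ?invr_eq0.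
move=> f g fg0; apply/negPn/negP; rewrite negb_or => /andP [/open_neq0 [U [oU [x Ux] HU]]].
move=> /open_neq0 [U' [oU' [x' U'x'] HU']].
have [_ /(_ _ _ oU oU')] := irred_setP X.
case.
- move=> v Xv; apply: contrapT => /not_orP [/contrapT Uv /contrapT U'v].
  pose w : X := SigSub (mem_set Xv).
  have := congr1 (fun h : regfun X => h w) fg0.
  by move/eqP; rewrite mulf_eq0 (negbTE (HU w Uv)) (negbTE (HU' w U'v)).
- by move=> /(_ (val x) (set_valP x)).
- by move=> /(_ (val x') (set_valP x')).
Qed.
HB.instance Definition _ :=
  GRing.ComUnitRing_isIntegral.Build (regfun X) regfun_idomain.

(* K(X) *)
Definition function_field := {fraction (regfun X)}.
HB.instance Definition _ := GRing.Field.on function_field.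

Local Notation inF := (@tofrac (regfun X)).

Definition ff_scale (a : K) (z : function_field) : function_field :=
  inF a%:A * z.

Lemma ff_scaleA a b z : ff_scale a (ff_scale b z) = ff_scale (a * b) z.
Proof. by rewrite /ff_scale mulrA -rmorphM -scalerAl mul1r scalerA. Qed.
Lemma ff_scale1 : left_id 1 ff_scale.
Proof. by move=> z; rewrite /ff_scale scale1r rmorph1 mul1r. Qed.
Lemma ff_scaleDr : right_distributive ff_scale +%R.
Proof. by move=> a z w; rewrite /ff_scale mulrDr. Qed.
Lemma ff_scaleDl z : {morph ff_scale^~ z : a b / a + b}.
Proof. by move=> a b; rewrite /ff_scale scalerDl rmorphD mulrDl. Qed.
HB.instance Definition _ := GRing.Zmodule_isLmodule.Build K function_field
  ff_scaleA ff_scale1 ff_scaleDr ff_scaleDl.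

(* The extension of an injective ring endomorphism of K[X] to K(X), defined on
   representatives; frac_extE shows the choice is irrelevant. *)
Definition frac_ext (f : regfun X -> regfun X) (z : function_field) :
    function_field :=
  inF (f (frac (repr z)).1) / inF (f (frac (repr z)).2).

Lemma frac_extE (f : {rmorphism regfun X -> regfun X}) (a b : regfun X) :
  injective f -> b != 0 -> frac_ext f (inF a / inF b) = inF (f a) / inF (f b).
Proof.
move=> f_inj b0; rewrite /frac_ext; set z := inF a / inF b.
set n := (frac (repr z)).1; set d := (frac (repr z)).2.
have d0 : d != 0 := denom_ratioP (repr z).
have fneq0 x : x != 0 -> inF (f x) != 0.
  by rewrite tofrac_eq0; apply: contra_neq => h; apply: f_inj; rewrite h rmorph0.
have zd : z * inF d = inF n by exact: tofrac_repr.
have : inF (n * b) = inF (a * d).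
  by rewrite !tofracM -zd /z mulrAC divfK // tofrac_eq0.
move/eqP; rewrite tofrac_eq => /eqP /(congr1 f); rewrite !rmorphM => E.
by apply/eqP; rewrite eqr_div ?fneq0 // -!tofracM E.
Qed.

(* K[N(X)]: when X is closed in V, hence an affine variety, its normalization
   N(X) is the affine variety whose coordinate ring is the integral closure of
   K[X] in K(X). *)
Definition normalization_ring : set function_field :=
  [set z | integralOver inF z].

End FunctionField.

Arguments normalization_ring {K V} X.

Section GLModules.
Variables (K : closedFieldType) (n : nat).
Implicit Types (H : set 'M[K]_n) (d : nat).

Definition GL : set 'M[K]_n := [set g | g \in unitmx].

Definition linear_algebraic_group H :=
  [/\ H `<=` GL, H 1%:M,
      (forall g h, H g -> H h -> H (g *m h)),
      (forall g, H g -> H (invmx g)) &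
      exists2 Z, zclosed Z & H = Z `&` GL].

(* Representations of H on K^d, seen as column vectors; the values of rho
   outside of H are irrelevant. *)
Definition rational_rep H d (rho : 'M[K]_n -> 'M[K]_d) :=
  [/\ rho 1%:M = 1%:M,
      (forall g h, H g -> H h -> rho (g *m h) = rho g *m rho h) &
      forall i j, regular_fun (fun g : H => rho (val g) i j)].

Definition rep_stable H d (rho : 'M[K]_n -> 'M[K]_d)
    (U : {vspace 'cV[K]_d}) :=
  forall g v, H g -> v \in U -> rho g *m v \in U.

Definition completely_reducible H d (rho : 'M[K]_n -> 'M[K]_d) :=
  forall U, rep_stable H rho U ->
    exists U', [/\ rep_stable H rho U', (U + U' = fullv)%VS & (U :&: U' = 0)%VS].

Definition reductive H :=
  linear_algebraic_group H /\
  forall d (rho : 'M[K]_n -> 'M[K]_d),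
    rational_rep H rho -> completely_reducible H rho.

Definition irreducible_rep H d (rho : 'M[K]_n -> 'M[K]_d) :=
  (0 < d)%N /\ forall U, rep_stable H rho U -> U = 0%VS \/ U = fullv.

Definition dominant (lambda : 'I_n -> int) :=
  forall i j : 'I_n, (i <= j)%N -> (lambda j <= lambda i)%R.

(* rho is a model of V(lambda), the irreducible rational representation of GL_n
   with highest weight lambda for the Borel subgroup of upper triangular
   matrices. *)
Definition is_Vlambda (lambda : 'I_n -> int) d (rho : 'M[K]_n -> 'M[K]_d) :=
  [/\ rational_rep GL rho, irreducible_rep GL rho &
      exists2 v : 'cV[K]_d, v != 0 &
        forall b, GL b -> is_trig_mx b^T ->
          rho b *m v = (\prod_i b i i ^ lambda i) *: v].

(* The sum of all the GL_n-submodules of M that are isomorphic to some V(lambda)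
   with lambda dominant and nonnegative. *)
Definition polynomial_part (M : lmodType K) (act : GL -> M -> M) : set M :=
  [set x | exists2 s : seq M, x = \sum_(y <- s) y &
    forall y, y \in s ->
      exists lambda d (rho : 'M[K]_n -> 'M[K]_d) (phi : {linear 'cV[K]_d -> M}),
        [/\ dominant lambda /\ (forall i, 0 <= lambda i), is_Vlambda lambda rho,
            injective phi,
            (forall (g : GL) v, phi (rho (val g) *m v) = act g (phi v)) &
            range phi y]].

(* Isomorphism of the GL_n-modules carried by stable subspaces A and B. *)
Definition GL_isomorphic (M N : lmodType K)
    (actM : GL -> M -> M) (A : set M) (actN : GL -> N -> N) (B : set N) :=
  exists phi : M -> N,
    [/\ set_bij A B phi,
        (forall a x y, A x -> A y -> phi (a *: x + y) = a *: phi x + phi y) &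
        (forall g x, A x -> phi (actM g x) = actN g (phi x))].

End GLModules.

Section Forms.
Variables (K : closedFieldType) (n d : nat).
(* K[W]_d for W = K^(n+1) *)
Local Notation V := (dhomog n.+1 K d).
Local Notation GL := (@GL K n.+1).

(* The curve Q = 0 in the projective space of W is nonsingular by the Jacobian
   criterion. *)
Definition nonsingular (Q : V) :=
  forall x : 'I_n.+1 -> K, (exists i, x i != 0) ->
    (mpoly_of_dhomog Q).@[x] = 0 ->
    exists i, (mpoly_of_dhomog Q)^`M(i).@[x] != 0.

Definition linear_subst (g : 'M[K]_n.+1) : n.+1.-tuple {mpoly K[n.+1]} :=
  [tuple \sum_j g i j *: 'X_j | i < n.+1].

Lemma linear_subst_homog g (Q : V) :
  (mpoly_of_dhomog Q) \mPo linear_subst g \is d.-homog.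
Proof.
case: Q => Q /= hQ; rewrite comp_mpolyEX big_seq rpred_sum // => m mQ.
apply: rpredZ; rewrite comp_mpolyX.
have <- : mdeg m = d := dhomog_mf hQ mQ.
rewrite mdegE.
elim/big_rec2: _ => [|i k p _ hp]; first exact: dhomog1.
apply: dhomogM => //; have := @dhomogMn _ _ _ 1%N (tnth (linear_subst g) i) (m i).
rewrite mul1n; apply.
rewrite tnth_map tnth_ord_tuple rpred_sum // => j _.
by apply: rpredZ; rewrite dhomogX; apply/eqP; exact: mdeg1.
Qed.

(* Q o g, where g acts on the column vectors W *)
Definition precomp (g : 'M[K]_n.+1) (Q : V) : V :=
  DHomog (linear_subst_homog g Q).

Lemma precomp_is_linear g : linear (precomp g).
Proof. by move=> a p q; apply: val_inj; rewrite /= comp_mpolyD comp_mpolyZ. Qed.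
HB.instance Definition _ g :=
  GRing.isLinear.Build K V V _ (precomp g) (precomp_is_linear g).

Lemma precomp_eval g Q (x : 'cV[K]_n.+1) :
  (mpoly_of_dhomog (precomp g Q)).@[fun i => x i 0] =
  (mpoly_of_dhomog Q).@[fun i => (g *m x) i 0].
Proof.
rewrite comp_mpoly_meval; apply: meval_eq => i.
rewrite tnth_map tnth_ord_tuple raddf_sum mxE; apply: eq_bigr => j _.
by rewrite /= mevalZ mevalXU.
Qed.

Lemma precompM g h Q : precomp (g *m h) Q = precomp h (precomp g Q).
Proof.
apply: val_inj; rewrite /= [in LHS]comp_mpolyEX.
rewrite [mpoly_of_dhomog Q \mPo linear_subst g]comp_mpolyEX.
rewrite raddf_sum /=; apply: eq_bigr => m _; rewrite comp_mpolyZ; congr (_ *: _).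
rewrite !comp_mpolyX rmorph_prod; apply: eq_bigr => i _.
rewrite rmorphXn; congr (_ ^+ _); rewrite !tnth_map !tnth_ord_tuple raddf_sum /=.
under eq_bigr => j _ do rewrite mxE scaler_suml.
rewrite exchange_big; apply: eq_bigr => k _.
rewrite comp_mpolyZ comp_mpolyXU -tnth_nth tnth_map tnth_ord_tuple scaler_sumr.
by apply: eq_bigr => j _; rewrite scalerA.
Qed.

Lemma precomp1 Q : precomp 1%:M Q = Q.
Proof.
apply: val_inj; rewrite /= -[RHS]comp_mpoly_id; congr (_ \mPo _).
apply: eq_from_tnth => i; rewrite !tnth_map !tnth_ord_tuple (bigD1 i) //= mxE eqxx.
rewrite scale1r big1 ?addr0 // => j ji.
by rewrite mxE eq_sym (negbTE ji) scale0r.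
Qed.

Variable P : V.

Definition stabilizer : set 'M[K]_n.+1 := [set g | GL g /\ precomp g P = P].
Definition orbit : set V := [set precomp g P | g in GL].
Definition orbit_closure : set V := zclosure orbit.
Definition boundary : set V := orbit_closure `\` orbit.

Lemma closed_field_nonroot (p : {poly K}) : p != 0 -> exists t, p.[t] != 0.
Proof.
move=> p0; case: (eqVneq (size p) 1%N) => [/eqP/size_poly1P [c c0 ->]|sp].
  by exists 0; rewrite hornerC.
have /closed_rootP [t] : size (p - 1) != 1%N.
  have sp1 : (1 < size p)%N by rewrite ltn_neqAle eq_sym sp lt0n size_poly_eq0.
  by rewrite size_polyDl ?size_polyN ?size_poly1.
rewrite /root hornerD hornerN hornerC subr_eq0 => /eqP h.
by exists t; rewrite h oner_neq0.
Qed.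

(* On a line of matrices, a polynomial function of P o g is polynomial. *)
Lemma evalp_precomp_line (A B : 'M[K]_n.+1) (p : {mpoly K[\dim {:V}]}) :
  exists r : {poly K}, forall t, evalp p (precomp (A + t *: B) P) = r.[t].
Proof.
pose mpoly_pol (F : K -> {mpoly K[n.+1]}) :=
  exists q : {poly {mpoly K[n.+1]}}, forall t, F t = q.[t%:MP].
have pC c : mpoly_pol (fun=> c) by exists c%:P => t; rewrite hornerC.
have pD F G : mpoly_pol F -> mpoly_pol G -> mpoly_pol (fun t => F t + G t).
  by move=> [f hf] [g hg]; exists (f + g) => t; rewrite hornerD hf hg.
have pM F G : mpoly_pol F -> mpoly_pol G -> mpoly_pol (fun t => F t * G t).
  by move=> [f hf] [g hg]; exists (f * g) => t; rewrite hornerM hf hg.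
have pS I (s : seq I) (F : I -> K -> {mpoly K[n.+1]}) : (forall i, mpoly_pol (F i)) ->
    mpoly_pol (fun t => \sum_(i <- s) F i t).
  move=> hF; elim: s => [|i s IH].
    by have [q hq] := pC 0; exists q => t; rewrite big_nil -hq.
  by have [q hq] := pD _ _ (hF i) IH; exists q => t; rewrite big_cons -hq.
have pP I (s : seq I) (F : I -> K -> {mpoly K[n.+1]}) : (forall i, mpoly_pol (F i)) ->
    mpoly_pol (fun t => \prod_(i <- s) F i t).
  move=> hF; elim: s => [|i s IH].
    by have [q hq] := pC 1; exists q => t; rewrite big_nil -hq.
  by have [q hq] := pM _ _ (hF i) IH; exists q => t; rewrite big_cons -hq.
have pX F k : mpoly_pol F -> mpoly_pol (fun t => F t ^+ k).
  by move=> [q hq]; exists (q ^+ k) => t; rewrite hq horner_exp.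
have [q hq] : mpoly_pol (fun t => mpoly_of_dhomog (precomp (A + t *: B) P)).
  suff [q hq] : mpoly_pol (fun t => \sum_(m <- msupp (mpoly_of_dhomog P))
      ((mpoly_of_dhomog P)@_m)%:MP *
      \prod_(i < n.+1) (\sum_(j < n.+1) (A i j + t * B i j) *: 'X_j) ^+ m i).
    exists q => t; rewrite -hq /= comp_mpolyEX; apply: eq_bigr => m _.
    rewrite mul_mpolyC comp_mpolyX; congr (_ *: _); apply: eq_bigr => i _.
    rewrite tnth_map tnth_ord_tuple; congr (_ ^+ _); apply: eq_bigr => j _.
    by rewrite !mxE.
  apply: (pS) => m; apply: (pM) => //; apply: pP => i; apply: pX; apply: pS => j.
  exists ((A i j *: 'X_j)%:P + (B i j *: 'X_j)%:P * 'X) => t.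
  rewrite hornerD hornerMX !hornerC scalerDl; congr (_ + _).
  by rewrite [RHS]mulrC mul_mpolyC scalerA.
have coord_pol i : exists r : {poly K}, forall t,
    coord (vbasis {:V}) i (precomp (A + t *: B) P) = r.[t].
  pose h (Q : {mpoly K[n.+1]}) : V := DHomog (pihomogP mdeg d Q).
  have hD Q1 Q2 : h (Q1 + Q2) = h Q1 + h Q2 by apply: val_inj; exact: raddfD.
  have hZ a Q : h (a *: Q) = a *: h Q by apply: val_inj; exact: linearZ.
  have h0 : h 0 = 0 by apply: val_inj; exact: raddf0.
  exists (\poly_(k < size q) coord (vbasis {:V}) i (h q`_k)) => t.
  have -> : precomp (A + t *: B) P = h q.[t%:MP].
    by apply: val_inj; rewrite -hq /= pihomog_dE //; exact: linear_subst_homog.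
  rewrite horner_poly horner_coef.
  rewrite (big_morph h hD h0) linear_sum; apply: eq_bigr => k _ /=.
  by rewrite mulrC -rmorphXn mul_mpolyC hZ linearZ /= mulrC.
have [r hr] := choice coord_pol.
exists (\sum_(m <- msupp p) p@_m *: \prod_i r i ^+ m i) => t.
rewrite /evalp mevalE horner_sum; apply: eq_bigr => m _.
rewrite hornerZ horner_prod; congr (_ * _); apply: eq_bigr => i _.
by rewrite horner_exp hr.
Qed.

Lemma det_line (A B : 'M[K]_n.+1) :
  exists r : {poly K}, forall t, \det (A + t *: B) = r.[t].
Proof.
exists (\det (map_mx polyC A + 'X *: map_mx polyC B)) => t.
rewrite -horner_evalE -det_map_mx; congr (\det _); apply/matrixP => i j.
by rewrite !mxE /= /horner_eval hornerD hornerM hornerX !hornerC.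
Qed.

Lemma orbit_irreducible : irreducible orbit.
Proof.
split; first by exists (precomp 1%:M P), 1%:M => //; exact: unitmx1.
move=> Z1 Z2 [F1 E1] [F2 E2] s12; apply: contrapT => /not_orP [].
move=> /existsNP [_ /not_implyP [[A gA <-]]]; rewrite E1 => /existsNP [p1 /not_implyP [Fp1 /eqP n1]].
move=> /existsNP [_ /not_implyP [[B gB <-]]]; rewrite E2 => /existsNP [p2 /not_implyP [Fp2 /eqP n2]].
have [r1 h1] := evalp_precomp_line A (B - A) p1.
have [r2 h2] := evalp_precomp_line A (B - A) p2.
have [r3 h3] := det_line A (B - A).
have neq0 (r : {poly K}) t : r.[t] != 0 -> r != 0.
  by apply: contraNneq => ->; rewrite horner0.
have e0 : A + 0 *: (B - A) = A by rewrite scale0r addr0.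
have e1 : A + 1 *: (B - A) = B by rewrite scale1r addrC subrK.
have : r1 * r2 * r3 != 0.
  rewrite !mulf_neq0 //.
  - by apply: (neq0 _ 0); rewrite -h1 e0.
  - by apply: (neq0 _ 1); rewrite -h2 e1.
  - by apply: (neq0 _ 0); rewrite -h3 e0 -unitfE.
move=> /closed_field_nonroot [t]; rewrite !hornerM !mulf_eq0 !negb_or -andbA -h1 -h2 -h3.
move=> /and3P [/eqP m1 /eqP m2 m3].
have [] := s12 (precomp (A + t *: (B - A)) P).
- by exists (A + t *: (B - A)) => //; rewrite /GL /= unitmxE unitfE.
- by rewrite E1 => /(_ _ Fp1).
- by rewrite E2 => /(_ _ Fp2).
Qed.

Definition orbit_closure_irred : irred_set V :=
  IrredSet (irreducible_zclosure orbit_irreducible).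

Lemma orbit_precomp (g : GL) Q : orbit Q -> orbit (precomp (val g) Q).
Proof.
move=> [h hh <-]; exists (h *m val g); last exact: precompM.
have hg : val g \in unitmx := set_valP g.
by change (h *m val g \in unitmx); rewrite unitmx_mul hg andbT.
Qed.

Lemma orbit_closure_precomp (g : GL) Q :
  orbit_closure Q -> orbit_closure (precomp (val g) Q).
Proof.
exact: (@zclosure_stable _ _ (precomp (val g)) _ (@orbit_precomp g)).
Qed.

(* The actions (g . f)(x) = f (x o g) *)
Definition orbit_act (g : GL) : regfun orbit -> regfun orbit :=
  pullback (@orbit_precomp g).

Definition orbit_closure_act (g : GL) :
    regfun orbit_closure_irred -> regfun orbit_closure_irred :=
  @pullback _ _ orbit_closure_irred _ (@orbit_closure_precomp g).

Lemma orbit_closure_act_inj g : injective (orbit_closure_act g).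
Proof.
move=> f1 f2 E; apply/val_inj/funext => x.
have hg : val g \in unitmx := set_valP g.
have hgV : GL (invmx (val g)) by change (invmx (val g) \in unitmx); rewrite unitmx_inv.
pose y : orbit_closure_irred :=
  SigSub (mem_set (orbit_closure_precomp (SigSub (mem_set hgV)) (set_valP x))).
have := congr1 (fun f : regfun orbit_closure_irred => f y) E.
rewrite /= /restrict_map /=; set x' := exist _ _ _.
suff -> : x' = x by [].
by apply: val_inj; rewrite /= -precompM mulVmx // precomp1.
Qed.

(* The action on K(X), hence on K[N(X)], for X the closure of the orbit *)
Definition normalization_act (g : GL) :
    function_field orbit_closure_irred -> function_field orbit_closure_irred :=
  frac_ext (orbit_closure_act g).

Lemma normalization_actE g (a b : regfun orbit_closure_irred) : b != 0 ->
  normalization_act g (tofrac a / tofrac b) =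
  tofrac (orbit_closure_act g a) / tofrac (orbit_closure_act g b).
Proof. by move=> b0; apply: frac_extE => //; exact: orbit_closure_act_inj. Qed.

End Forms.

Arguments orbit_act {K n d} P g.
Arguments normalization_act {K n d} P g.

(* Main.v *)
From HB Require Import structures.
From mathcomp Require Import fingroup perm.
Require Import Defs.
From mathcomp Require Import all_boot all_order all_algebra.
From mathcomp Require Import boolp classical_sets functions reals.
From mathcomp Require Import complex mpoly ring.

Set Implicit Arguments.
Unset Strict Implicit.
Unset Printing Implicit Defensive.

Import Order.TTheory GRing.Theory Num.Theory.
Local Open Scope ring_scope.
Local Open Scope classical_set_scope.

(** A nonsingular cubic form is equivalent to a Weierstrass form
    [y^2 z - x^3 - a x z^2 - b z^3] with [4 a^3 + 27 b^2 != 0]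
    ([weierstrass_form]).  A common zero of the cubic and of its Hessian, which
    exists by the theory of resultants ([common_zero]), is a flex; it is moved
    to [(0 : 1 : 0)], and the square in [y] and the cube in [x] are completed.

    The stabilizer.  An element of the stabilizer permutes the flexes of the
    curve, which are finitely many, and an element of the stabilizer that fixes
    [(0 : 1 : 0)] is a diagonal matrix whose entries are roots of unity of
    order dividing 12.  The stabilizer is therefore finite
    ([listed_stabilizer]), and Maschke's averaging argument applies
    ([completely_reducible_finite]).

    The boundary.  The Aronhold invariant [S] has weight [det^4], and its value
    [U] at the Hessian has weight [det^12], so the ratio of [S^3] to [U] is
    constant on the orbit and on its closure ([orbit_closure_invariants]).
    Nonsingular forms in the closure thus have the j-invariant of the orbit and
    belong to it.  For a form with a singular point whose tangent cone has
    discriminant [d], the invariants are [S = - d^2] and [U = - 16 d^6], and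
    the constancy of the ratio forces [d = 0].  Hence a form of the boundary is
    a translate of an element of the linear space [cuspidal_space] of the forms
    with a cusp, or worse, at [(0 : 0 : 1)] with tangent [y = 0].  Conversely
    the general element of this space is equivalent to the cusp [y^2 z - x^3],
    which is the limit at [t = 0] of the curve
    [weierstrass (t^4 a) (t^6 b)] in the orbit.  The boundary is therefore the
    sweep of a linear space by [GL_3] ([boundary_weierstrass]), and such a
    sweep is irreducible ([irreducible_sweep]).

    The coordinate rings.  Let [V] be the dual of the space of forms of degree
    18, the irreducible polynomial representation of highest weight (18, 0, 0)
    ([dual_rep_Vlambda]).  Let [D] be one of [S^3] and [U] that does not
    vanish on the orbit, which exists because the two have no common zero among
    nonsingular forms.  The functions
    [Q |-> <hess(Q)^6, v> / D(Q)], for [v] in [V], are regular on the orbit and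
    depend equivariantly on [v], since [hess(Q)^6] and [D(Q)] have the same
    weight [det^12].  Along the curve above, one of them is a nonzero multiple
    of [t^-12], whereas the curve extends to [t = 0] inside the closure: it is
    not integral over the coordinate ring of the closure ([integral_no_pole]).
    An isomorphism of the two modules would imply the contrary.  Its inverse
    turns an equivariant map from [V] to the functions on the orbit into an
    equivariant map from [V] to rational functions on the closure that are
    integral, and by homogeneity these rational functions are regular on the
    orbit ([equivariant_extension]).  This defines an injective endomorphism of
    the space of equivariant maps from [V] to the functions on the orbit.  Such
    a map is determined by its values at the given form, so the space has
    finite dimension and the endomorphism is onto: every equivariant map would
    have integral values ([isomorphic_integral]). *)

Local Notation o0 := (ord0 : 'I_3).
Local Notation o1 := (lift ord0 ord0 : 'I_3).
Local Notation o2 := (lift ord0 (lift ord0 ord0) : 'I_3).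

(** * Polynomial functions and polynomial curves *)

Section PolynomialFunctions.
Variables (K : closedFieldType) (V : vectType K).
Implicit Types (f g : V -> K) (Z : set V).

Definition polyfun f := exists p, forall v : V, f v = evalp p v.

Lemma polyfun_cst c : polyfun (fun=> c).
Proof. by exists c%:MP => v; rewrite /evalp mevalC. Qed.

Lemma polyfunD f g : polyfun f -> polyfun g -> polyfun (fun v => f v + g v).
Proof. by move=> [p hp] [q hq]; exists (p + q) => v; rewrite /evalp mevalD hp hq. Qed.

Lemma polyfunM f g : polyfun f -> polyfun g -> polyfun (fun v => f v * g v).
Proof. by move=> [p hp] [q hq]; exists (p * q) => v; rewrite /evalp mevalM hp hq. Qed.

Lemma polyfunN f : polyfun f -> polyfun (fun v => - f v).
Proof. by move=> [p hp]; exists (- p) => v; rewrite /evalp mevalN hp. Qed.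

Lemma polyfunB f g : polyfun f -> polyfun g -> polyfun (fun v => f v - g v).
Proof. by move=> hf hg; apply: polyfunD => //; apply: polyfunN. Qed.

Lemma polyfunX f k : polyfun f -> polyfun (fun v => f v ^+ k).
Proof. by move=> [p hp]; exists (p ^+ k) => v; rewrite /evalp rmorphXn /= hp. Qed.

Lemma polyfun_sum I (r : seq I) (F : I -> V -> K) :
  (forall i, polyfun (F i)) -> polyfun (fun v => \sum_(i <- r) F i v).
Proof.
move=> hF; elim: r => [|i r [q hq]].
  by have [q hq] := polyfun_cst 0; exists q => v; rewrite big_nil; exact: hq.
by have [p hp] := hF i; exists (p + q) => v; rewrite big_cons /evalp mevalD hp hq.
Qed.

Lemma polyfun_prod I (r : seq I) (F : I -> V -> K) :
  (forall i, polyfun (F i)) -> polyfun (fun v => \prod_(i <- r) F i v).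
Proof.
move=> hF; elim: r => [|i r [q hq]].
  by have [q hq] := polyfun_cst 1; exists q => v; rewrite big_nil; exact: hq.
by have [p hp] := hF i; exists (p * q) => v; rewrite big_cons /evalp mevalM hp hq.
Qed.

Lemma polyfun_ext f g : f =1 g -> polyfun f -> polyfun g.
Proof. by move=> fg [p hp]; exists p => v; rewrite -fg hp. Qed.

Lemma polyfun_meval (n : nat) (p : {mpoly K[n]}) (F : 'I_n -> V -> K) :
  (forall i, polyfun (F i)) -> polyfun (fun v => p.@[fun i => F i v]).
Proof.
move=> hF; apply: (@polyfun_ext (fun v => \sum_(m <- msupp p)
   p@_m * \prod_(i <- index_enum 'I_n) F i v ^+ m i)).
  by move=> v; rewrite mevalE.
apply: polyfun_sum => m; apply: polyfunM; first exact: polyfun_cst.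
by apply: polyfun_prod => i; apply: polyfunX.
Qed.

Lemma zclosed_eq f g : polyfun f -> polyfun g -> zclosed [set v | f v = g v].
Proof.
move=> hf hg; have [p hp] := polyfunB hf hg.
exists [set p]; apply/seteqP; split=> v /=.
  by move=> fg q ->; rewrite -hp fg subrr.
by move=> /(_ p erefl); rewrite -hp => /eqP; rewrite subr_eq0 => /eqP.
Qed.

Lemma zclosedU Z1 Z2 : zclosed Z1 -> zclosed Z2 -> zclosed (Z1 `|` Z2).
Proof.
move=> c1 c2; have := @zopenI K V (~` Z1) (~` Z2).
by rewrite /zopen !setCK setCI !setCK; apply.
Qed.

Lemma zclosed1 x : zclosed [set x : V].
Proof.
exists [set p | evalp p x = 0]; apply/seteqP; split=> v /=; first by move=> ->.
move=> h; rewrite (coord_vbasis (memvf v)) (coord_vbasis (memvf x)).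
apply: eq_bigr => i _; congr (_ *: _).
have := h ('X_i - (coord (vbasis {:V}) i x)%:MP).
rewrite /evalp !mevalB !mevalXU !mevalC subrr => /(_ erefl) /eqP.
by rewrite subr_eq0 => /eqP.
Qed.

Lemma zclosed_seq (s : seq V) : zclosed [set x | x \in s].
Proof.
elim: s => [|x s IH].
  have := @zopenT K V; rewrite /zopen setCT; congr zclosed.
  by apply/seteqP; split.
rewrite (_ : [set _ | _] = [set x] `|` [set y | y \in s]).
  by apply: zclosedU => //; apply: zclosed1.
apply/seteqP; split=> y /=; rewrite in_cons.
  by case/orP => [/eqP|]; [left|right].
by case=> [->|->]; rewrite ?eqxx ?orbT.
Qed.

Lemma zclosure_min (S Z : set V) : zclosed Z -> S `<=` Z -> zclosure S `<=` Z.
Proof. by move=> cZ SZ; apply: smallest_sub. Qed.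

(** The closure is cut out by the polynomials that vanish on [S]. *)
Lemma zclosed_zclosure (S : set V) : zclosed (zclosure S).
Proof.
exists [set p | forall v, S v -> evalp p v = 0]; apply/seteqP; split=> v /=.
  move=> clv p hp.
  by apply: (@zclosure_min _ [set v | evalp p v = 0] _ _ v clv) => //;
     apply: zclosed_eq; [exists p|apply: polyfun_cst].
move=> h Z [[F ->] SZ] p Fp; apply: h => w /SZ; exact.
Qed.

Lemma regular_polyfun (S : set V) f : polyfun f ->
  @regular_fun K V S (fun x => f (val x)).
Proof.
move=> [p hp] x; exists setT, p, 1; split => // [|y _]; first exact: zopenT.
by rewrite /evalp meval1 oner_neq0 divr1 hp.
Qed.

End PolynomialFunctions.

Section Curves.
Variables (K : closedFieldType) (V : vectType K).

(** A curve is polynomial when every polynomial function is polynomial along it,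
    a condition that does not mention coordinates. *)
Definition polycurve (c : K -> V) :=
  forall f, polyfun f -> exists r : {poly K}, forall t, f (c t) = r.[t].

Lemma polycurve_coord (c : K -> V) :
  (forall i, exists r : {poly K}, forall t, coord (vbasis {:V}) i (c t) = r.[t]) ->
  polycurve c.
Proof.
move=> /choice [r hr] f [p hp].
exists (\sum_(m <- msupp p) p@_m *: \prod_i r i ^+ m i) => t.
rewrite hp /evalp mevalE horner_sum; apply: eq_bigr => m _.
rewrite hornerZ horner_prod; congr (_ * _); apply: eq_bigr => i _.
by rewrite horner_exp hr.
Qed.

Lemma polycurve_linear (phi : {linear V -> V}) c :
  polycurve c -> polycurve (fun t => phi (c t)).
Proof.
move=> hc f [p hp]; have [q hq] := evalp_comp phi p.
have [r hr] := hc _ (ex_intro _ q (fun=> erefl)).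
by exists r => t; rewrite hp -hq hr.
Qed.

Lemma polyfun_coord i : polyfun (coord (vbasis {:V}) i : V -> K).
Proof. by exists 'X_i => v; rewrite /evalp mevalXU. Qed.

Lemma polycurve_cst v : polycurve (fun=> v).
Proof. by move=> f _; exists (f v)%:P => t; rewrite hornerC. Qed.

Lemma polycurveD c d : polycurve c -> polycurve d -> polycurve (fun t => c t + d t).
Proof.
move=> hc hd; apply: polycurve_coord => i.
have [r hr] := hc _ (polyfun_coord i); have [s hs] := hd _ (polyfun_coord i).
by exists (r + s) => t; rewrite linearD /= hornerD hr hs.
Qed.

Lemma polycurveZ (a : {poly K}) c : polycurve c -> polycurve (fun t => a.[t] *: c t).
Proof.
move=> hc; apply: polycurve_coord => i; have [r hr] := hc _ (polyfun_coord i).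
by exists (a * r) => t; rewrite linearZ /= hornerM hr.
Qed.

Lemma polycurve_line (u v : V) : polycurve (fun t => u + t *: v).
Proof.
apply: polycurveD; first exact: polycurve_cst.
by have := polycurveZ 'X (@polycurve_cst v); congr polycurve; apply/funext => t; rewrite hornerX.
Qed.

(** Along the curve, each equation of [Z] is a polynomial in one variable which
    vanishes wherever [q] does not, hence identically. *)
Lemma zclosed_curve (c : K -> V) (Z : set V) (q : {poly K}) : polycurve c ->
  zclosed Z -> q != 0 -> (forall t, q.[t] != 0 -> Z (c t)) -> forall t, Z (c t).
Proof.
move=> hc [F ->] q0 hq t p Fp /=.
have [r hr] : exists r : {poly K}, forall t, evalp p (c t) = r.[t].
  by apply: hc; exists p.
rewrite hr; suff -> : r = 0 by rewrite horner0.
apply/eqP; apply: contraT => r0.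
have := mulf_neq0 r0 q0 => /closed_field_nonroot [s].
by rewrite hornerM mulf_eq0 negb_or => /andP [/eqP + /hq /(_ p Fp)]; rewrite hr.
Qed.
End Curves.

(** * Ternary cubics and their coefficients *)

Section Cubics.
Variable K : numClosedFieldType.
Local Notation form := (dhomog 3 K).

Definition eval_xyz d (Q : form d) (x y z : K) : K :=
  (mpoly_of_dhomog Q).@[fun i => nth 0 [:: x; y; z] i].

Definition mono (i j k : nat) : 'X_{1..3} := [multinom [tuple i; j; k]].

Definition coef (Q : form 3) i j k : K := (mpoly_of_dhomog Q)@_(mono i j k).

Lemma mdeg_mono i j k : mdeg (mono i j k) = (i + j + k)%N.
Proof. by rewrite mdegE !big_ord_recl big_ord0 !multinomE /= addn0 addnA. Qed.

Section CubicOfCoefficients.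
Variables c300 c210 c201 c120 c111 c102 c030 c021 c012 c003 : K.
Definition cubic_poly : {mpoly K[3]} :=
  c300 *: 'X_[mono 3 0 0] + c210 *: 'X_[mono 2 1 0] + c201 *: 'X_[mono 2 0 1]
  + c120 *: 'X_[mono 1 2 0] + c111 *: 'X_[mono 1 1 1] + c102 *: 'X_[mono 1 0 2]
  + c030 *: 'X_[mono 0 3 0] + c021 *: 'X_[mono 0 2 1] + c012 *: 'X_[mono 0 1 2]
  + c003 *: 'X_[mono 0 0 3].

Lemma cubic_poly_homog : cubic_poly \is 3.-homog.
Proof. by rewrite !rpredD // dhomogZ // dhomogX /= mdeg_mono. Qed.

Definition cubic : form 3 := DHomog cubic_poly_homog.

Lemma coef_cubic : (coef cubic 3 0 0 = c300) * (coef cubic 2 1 0 = c210)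
  * (coef cubic 2 0 1 = c201) * (coef cubic 1 2 0 = c120) * (coef cubic 1 1 1 = c111)
  * (coef cubic 1 0 2 = c102) * (coef cubic 0 3 0 = c030) * (coef cubic 0 2 1 = c021)
  * (coef cubic 0 1 2 = c012) * (coef cubic 0 0 3 = c003).
Proof.
by do !split; rewrite /coef /cubic /cubic_poly !mcoeffD !mcoeffZ !mcoeffX /=
   ?(mulr1, mulr0, add0r, addr0).
Qed.

Lemma eval_cubic x y z : eval_xyz cubic x y z =
  c300 * x ^+ 3 + c210 * x ^+ 2 * y + c201 * x ^+ 2 * z + c120 * x * y ^+ 2
  + c111 * x * y * z + c102 * x * z ^+ 2 + c030 * y ^+ 3 + c021 * y ^+ 2 * z
  + c012 * y * z ^+ 2 + c003 * z ^+ 3.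
Proof.
rewrite /eval_xyz /= !mevalD !mevalZ !mevalX !big_ord_recl !big_ord0 !multinomE /=.
by ring.
Qed.
End CubicOfCoefficients.

Lemma mono_deg3 (m : 'X_{1..3}) : mdeg m = 3 ->
  m \in [:: mono 3 0 0; mono 2 1 0; mono 2 0 1; mono 1 2 0; mono 1 1 1;
            mono 1 0 2; mono 0 3 0; mono 0 2 1; mono 0 1 2; mono 0 0 3].
Proof.
have -> : m = mono (m ord0) (m (lift ord0 ord0)) (m (lift ord0 (lift ord0 ord0))).
  apply/mnmP => i; rewrite multinomE (tnth_nth 0%N) /=.
  by case: i => [[|[|[|//]]] h] /=; congr (m _); apply: val_inj.
rewrite mdeg_mono.
move: (m _) (m _) (m _) => i j k.
by move: i j k => [|[|[|[|i]]]] [|[|[|[|j]]]] [|[|[|[|k]]]].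
Qed.

Lemma coef_ext (Q R : form 3) :
  (forall i j k, (i + j + k = 3)%N -> coef Q i j k = coef R i j k) -> Q = R.
Proof.
move=> QR; apply: val_inj; apply/mpolyP => m /=.
have [m3|m3] := eqVneq (mdeg m) 3; last first.
  by rewrite !(@dhomog_nemf_coeff _ _ mdeg 3) ?dhomog_is_dhomog.
have := mono_deg3 m3; rewrite !inE => /or4P [|||/or4P [|||/or4P [|||]]] /eqP ->;
exact: QR.
Qed.

Lemma cubicE (Q : form 3) : Q = cubic (coef Q 3 0 0) (coef Q 2 1 0) (coef Q 2 0 1)
  (coef Q 1 2 0) (coef Q 1 1 1) (coef Q 1 0 2) (coef Q 0 3 0) (coef Q 0 2 1)
  (coef Q 0 1 2) (coef Q 0 0 3).
Proof.
apply: coef_ext => i j k.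
by move: i j k => [|[|[|[|i]]]] [|[|[|[|j]]]] [|[|[|[|k]]]] // _; rewrite coef_cubic.
Qed.

Lemma eval_xyzE (Q : form 3) x y z : eval_xyz Q x y z =
  coef Q 3 0 0 * x ^+ 3 + coef Q 2 1 0 * x ^+ 2 * y + coef Q 2 0 1 * x ^+ 2 * z
  + coef Q 1 2 0 * x * y ^+ 2 + coef Q 1 1 1 * x * y * z
  + coef Q 1 0 2 * x * z ^+ 2 + coef Q 0 3 0 * y ^+ 3
  + coef Q 0 2 1 * y ^+ 2 * z + coef Q 0 1 2 * y * z ^+ 2
  + coef Q 0 0 3 * z ^+ 3.
Proof. by rewrite {1}(cubicE Q) eval_cubic. Qed.

End Cubics.

(** With variables in place of the coefficients, [ring] compares atoms at once. *)
Ltac gen_coef Q :=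
  move: (coef Q 3 0 0) (coef Q 2 1 0) (coef Q 2 0 1) (coef Q 1 2 0)
    (coef Q 1 1 1) (coef Q 1 0 2) (coef Q 0 3 0) (coef Q 0 2 1) (coef Q 0 1 2)
    (coef Q 0 0 3).

Section CubicValues.
Variable K : numClosedFieldType.
Local Notation form := (dhomog 3 K).

(** Interpolation: a cubic is determined by its values, so that identities
    between cubics can be checked pointwise. *)
Lemma coef_values (Q : form 3) :
  (coef Q 3 0 0 = eval_xyz Q 1 0 0) * (coef Q 0 3 0 = eval_xyz Q 0 1 0)
  * (coef Q 0 0 3 = eval_xyz Q 0 0 1)
  * (coef Q 2 1 0 = (eval_xyz Q 1 1 0 - eval_xyz Q 1 (- 1) 0) / 2 - eval_xyz Q 0 1 0)
  * (coef Q 2 0 1 = (eval_xyz Q 1 0 1 - eval_xyz Q 1 0 (- 1)) / 2 - eval_xyz Q 0 0 1)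
  * (coef Q 0 2 1 = (eval_xyz Q 0 1 1 - eval_xyz Q 0 1 (- 1)) / 2 - eval_xyz Q 0 0 1)
  * (coef Q 1 2 0 = (eval_xyz Q 1 1 0 + eval_xyz Q 1 (- 1) 0) / 2 - eval_xyz Q 1 0 0)
  * (coef Q 1 0 2 = (eval_xyz Q 1 0 1 + eval_xyz Q 1 0 (- 1)) / 2 - eval_xyz Q 1 0 0)
  * (coef Q 0 1 2 = (eval_xyz Q 0 1 1 + eval_xyz Q 0 1 (- 1)) / 2 - eval_xyz Q 0 1 0)
  * (coef Q 1 1 1 = eval_xyz Q 1 1 1 - eval_xyz Q 1 1 0 - eval_xyz Q 1 0 1 - eval_xyz Q 0 1 1
                   + eval_xyz Q 1 0 0 + eval_xyz Q 0 1 0 + eval_xyz Q 0 0 1).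
Proof.
by do !split; rewrite !eval_xyzE; gen_coef Q => a b c d e f g h i j; field.
Qed.

Lemma cubic_ext (Q R : form 3) :
  (forall x y z, eval_xyz Q x y z = eval_xyz R x y z) -> Q = R.
Proof. by move=> QR; rewrite (cubicE Q) (cubicE R) !coef_values !QR. Qed.

Lemma eval_xyz_precomp d g (Q : form d) x y z : eval_xyz (precomp g Q) x y z =
  eval_xyz Q (g o0 o0 * x + g o0 o1 * y + g o0 o2 * z)
       (g o1 o0 * x + g o1 o1 * y + g o1 o2 * z)
       (g o2 o0 * x + g o2 o1 * y + g o2 o2 * z).
Proof.
pose v : 'cV[K]_3 := \col_i nth 0 [:: x; y; z] i.
transitivity (mpoly_of_dhomog (precomp g Q)).@[fun i => v i 0].
  by apply: meval_eq => i; rewrite mxE.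
rewrite precomp_eval; apply: meval_eq => i.
rewrite mxE !big_ord_recl big_ord0 !mxE /= addr0 addrA.
by case: i => [[|[|[|//]]] h] /=; congr (g _ _ * _ + g _ _ * _ + g _ _ * _); apply: val_inj.
Qed.
End CubicValues.

(** * The Hessian covariant *)

Section Hessian.
Variable K : numClosedFieldType.
Local Notation form := (dhomog 3 K).

Lemma mderivXU n (i j : 'I_n) : ('X_j : {mpoly K[n]})^`M(i) = (j == i)%:R%:MP.
Proof.
rewrite mderivX mnm1E; case: eqP => [->|_]; last by rewrite scale0r mpolyC0.
have -> : (U_(i) - U_(i))%MM = 0%MM :> 'X_{1..n} by apply/mnmP => k; rewrite mnmBE subnn mnm0E.
by rewrite mpolyX0 scale1r mpolyC1.
Qed.

(** The chain rule.  Both sides satisfy the Leibniz rule relative to the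
    substitution, so they agree as soon as they agree on the variables. *)
Lemma mderiv_linear_subst (g : 'M[K]_3) (p : {mpoly K[3]}) i :
  (p \mPo linear_subst g)^`M(i) =
  \sum_k g k i *: (p^`M(k) \mPo linear_subst g).
Proof.
pose D (q : {mpoly K[3]}) := (q \mPo linear_subst g)^`M(i) =
  \sum_k g k i *: (q^`M(k) \mPo linear_subst g).
have D1 : D 1.
  rewrite /D rmorph1 -mpolyC1 mderivC big1 // => k _.
  by rewrite mderivC raddf0 scaler0.
have DD q r : D q -> D r -> D (q + r).
  rewrite /D => hq hr; rewrite raddfD /= mderivD hq hr -big_split.
  by apply: eq_bigr => k _; rewrite mderivD raddfD scalerDr.
have DZ a q : D q -> D (a *: q).
  rewrite /D => hq; rewrite comp_mpolyZ mderivZ hq scaler_sumr.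
  by apply: eq_bigr => k _; rewrite mderivZ comp_mpolyZ !scalerA mulrC.
have DM q r : D q -> D r -> D (q * r).
  rewrite /D => hq hr; rewrite rmorphM mderivM hq hr mulr_suml mulr_sumr -big_split.
  apply: eq_bigr => k _; rewrite mderivM raddfD /= !rmorphM /= scalerDr.
  by rewrite -scalerAl -scalerAr.
have DX j : D 'X_j.
  rewrite /D comp_mpolyXU -tnth_nth tnth_map tnth_ord_tuple raddf_sum /=.
  rewrite (bigD1 i) // mderivZ mderivXU eqxx big1 => [|k /negbTE ki].
    rewrite (bigD1 j) //= mderivXU eqxx comp_mpolyC big1 => [|k /negbTE kj].
      by rewrite !addr0.
    by rewrite mderivXU eq_sym kj comp_mpolyC mpolyC0 scaler0.
  by rewrite mderivZ mderivXU ki mpolyC0 scaler0.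
rewrite -/(D p); clearbody D; rewrite [p]mpolyE; elim/big_rec: _ => [|m q _ hq].
  by have := DZ 0 _ D1; rewrite scale0r.
apply: (DD) => //; apply: (DZ); rewrite mpolyXE_id.
elim/big_rec: _ => // k r _ hr; apply: (DM) => //.
by elim: (m k) => // e IH; rewrite exprS; apply: (DM).
Qed.

Lemma mderiv_homog n d (p : {mpoly K[n]}) i :
  p \is d.+1.-homog -> p^`M(i) \is d.-homog.
Proof.
move=> /dhomogP hp; apply/dhomogP => m.
rewrite mcoeff_msupp mcoeff_mderiv => h.
have /hp : (m + U_(i))%MM \in msupp p.
  by rewrite mcoeff_msupp; apply: contraNneq h => ->; rewrite mul0rn.
by rewrite /= mdegD mdeg1 addn1 => -[].
Qed.

Definition hess_mx (p : {mpoly K[3]}) : 'M[{mpoly K[3]}]_3 :=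
  \matrix_(i, j) p^`M(i)^`M(j).

Lemma hess_homog (p : form 3) : \det (hess_mx p) \is 3.-homog.
Proof.
rewrite rpred_sum // => s _; rewrite mulr_sign !big_ord_recl big_ord0 mulr1.
have h i j : hess_mx p i j \is 1.-homog.
  by rewrite mxE; apply: mderiv_homog; apply: mderiv_homog; apply: dhomog_is_dhomog.
rewrite -[3%N]/(1 + (1 + 1))%N.
by case: ifP => _; rewrite ?rpredN; do !apply: dhomogM; apply: h.
Qed.

Definition hess (Q : form 3) : form 3 := DHomog (hess_homog Q).

Lemma hess_mx_subst g (p : {mpoly K[3]}) :
  hess_mx (p \mPo linear_subst g) =
  (map_mx (@mpolyC 3 K) g)^T *m map_mx (comp_mpoly (linear_subst g)) (hess_mx p)
    *m map_mx (@mpolyC 3 K) g.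
Proof.
apply/matrixP => i j; rewrite !mxE mderiv_linear_subst raddf_sum /=.
transitivity (\sum_k \sum_l (g k i * g l j) *:
    (p^`M(k)^`M(l) \mPo linear_subst g)).
  apply: eq_bigr => k _; rewrite mderivZ mderiv_linear_subst scaler_sumr.
  by apply: eq_bigr => l _; rewrite scalerA.
rewrite exchange_big; apply: eq_bigr => l _; rewrite !mxE mulr_suml.
apply: eq_bigr => k _; rewrite !mxE -!mul_mpolyC mpolyCM.
by rewrite -!mulrA; congr (_ * _); rewrite mulrC.
Qed.

(** By the chain rule, substituting [g] replaces the matrix [H] of second
    derivatives by [g^T H g]. *)
Lemma hess_precomp g (Q : form 3) :
  hess (precomp g Q) = \det g ^+ 2 *: precomp g (hess Q).
Proof.
apply: val_inj; rewrite /= hess_mx_subst !det_mulmx det_tr !det_map_mx /=.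
by rewrite -mul_mpolyC expr2 mpolyCM mulrAC.
Qed.

End Hessian.

Section HessianFormula.
Variable K : numClosedFieldType.
Local Notation form := (dhomog 3 K).

Lemma ord3_cases (i : 'I_3) : [\/ i = o0, i = o1 | i = o2].
Proof. by case: i => [[|[|[|//]]] h]; [apply: Or31|apply: Or32|apply: Or33]; apply: val_inj. Qed.

Lemma det3 (F : comNzRingType) (A : 'M[F]_3) : \det A =
  A o0 o0 * (A o1 o1 * A o2 o2 - A o1 o2 * A o2 o1)
  - A o0 o1 * (A o1 o0 * A o2 o2 - A o1 o2 * A o2 o0)
  + A o0 o2 * (A o1 o0 * A o2 o1 - A o1 o1 * A o2 o0).
Proof.
pose a (i j : nat) := A (inord i) (inord j).
have aE i j : A i j = a i j by rewrite /a !inord_val.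
rewrite (expand_det_row _ o0) !big_ord_recl big_ord0 /cofactor.
rewrite !(expand_det_row _ ord0) !big_ord_recl !big_ord0 /cofactor !det_mx11 !mxE !aE /=.
by rewrite /bump /= ?add0n ?addn0 ?add1n /=; move: a {aE} => a; ring.
Qed.

Lemma mderiv_mono i j k :
  (('X_[mono i j k] : {mpoly K[3]})^`M(o0) = i%:R *: 'X_[mono i.-1 j k])
  * (('X_[mono i j k] : {mpoly K[3]})^`M(o1) = j%:R *: 'X_[mono i j.-1 k])
  * (('X_[mono i j k] : {mpoly K[3]})^`M(o2) = k%:R *: 'X_[mono i j k.-1]).
Proof.
do !split; rewrite mderivX multinomE (tnth_nth 0%N) /=; congr (_ *: 'X_[_]);
  apply/mnmP => l; rewrite mnmBE mnm1E !multinomE !(tnth_nth 0%N);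
  by case: l => [[|[|[|//]]] h] /=; rewrite ?subn0 ?subn1.
Qed.

Lemma meval_mono i j k x y z :
  ('X_[mono i j k] : {mpoly K[3]}).@[fun i => nth 0 [:: x; y; z] i] =
  x ^+ i * y ^+ j * z ^+ k.
Proof.
rewrite mevalX !big_ord_recl !big_ord0 !multinomE !(tnth_nth 0%N) /=.
by rewrite mulr1 mulrA.
Qed.

Lemma eval_deriv (Q : form 3) x y z :
  let D i := ((mpoly_of_dhomog Q)^`M(i)).@[fun i => nth 0 [:: x; y; z] i] in
  [/\ D o0 = 3 * coef Q 3 0 0 * x ^+ 2 + 2 * coef Q 2 1 0 * x * y
        + 2 * coef Q 2 0 1 * x * z + coef Q 1 2 0 * y ^+ 2
        + coef Q 1 1 1 * y * z + coef Q 1 0 2 * z ^+ 2,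
      D o1 = coef Q 2 1 0 * x ^+ 2 + 2 * coef Q 1 2 0 * x * y
        + coef Q 1 1 1 * x * z + 3 * coef Q 0 3 0 * y ^+ 2
        + 2 * coef Q 0 2 1 * y * z + coef Q 0 1 2 * z ^+ 2
    & D o2 = coef Q 2 0 1 * x ^+ 2 + coef Q 1 1 1 * x * y
        + 2 * coef Q 1 0 2 * x * z + coef Q 0 2 1 * y ^+ 2
        + 2 * coef Q 0 1 2 * y * z + 3 * coef Q 0 0 3 * z ^+ 2].
Proof.
move: (cubicE Q) => /=; gen_coef Q => a b c d e f g h i j ->.
by split; rewrite /cubic_poly !mderivD !mderivZ !mderiv_mono !mevalD !mevalZ
   !meval_mono /=; ring.
Qed.

Lemma eval_hess (Q : form 3) x y z :
  let xx := 6 * coef Q 3 0 0 * x + 2 * coef Q 2 1 0 * y + 2 * coef Q 2 0 1 * z in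
  let xy := 2 * coef Q 2 1 0 * x + 2 * coef Q 1 2 0 * y + coef Q 1 1 1 * z in
  let xz := 2 * coef Q 2 0 1 * x + coef Q 1 1 1 * y + 2 * coef Q 1 0 2 * z in
  let yy := 2 * coef Q 1 2 0 * x + 6 * coef Q 0 3 0 * y + 2 * coef Q 0 2 1 * z in
  let yz := coef Q 1 1 1 * x + 2 * coef Q 0 2 1 * y + 2 * coef Q 0 1 2 * z in
  let zz := 2 * coef Q 1 0 2 * x + 2 * coef Q 0 1 2 * y + 6 * coef Q 0 0 3 * z in
  eval_xyz (hess Q) x y z =
    xx * (yy * zz - yz ^+ 2) - xy * (xy * zz - yz * xz) + xz * (xy * yz - yy * xz).
Proof.
move: (cubicE Q) => /=; gen_coef Q => a b c d e f g h i j ->.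
rewrite /eval_xyz /= det3 !mxE !(mevalM, mevalD, mevalN).
have [D00 D01 D02] : [/\
  ((cubic_poly a b c d e f g h i j)^`M(o0)^`M(o0)).@[fun i => nth 0 [:: x; y; z] i]
    = 6 * a * x + 2 * b * y + 2 * c * z,
  ((cubic_poly a b c d e f g h i j)^`M(o0)^`M(o1)).@[fun i => nth 0 [:: x; y; z] i]
    = 2 * b * x + 2 * d * y + e * z &
  ((cubic_poly a b c d e f g h i j)^`M(o0)^`M(o2)).@[fun i => nth 0 [:: x; y; z] i]
    = 2 * c * x + e * y + 2 * f * z].
  by split; rewrite /cubic_poly !mderivD !mderivZ !mderiv_mono !mderivZ
    !mderiv_mono !mevalD !mevalZ !meval_mono /=; ring.
have [D11 D12 D22] : [/\
  ((cubic_poly a b c d e f g h i j)^`M(o1)^`M(o1)).@[fun i => nth 0 [:: x; y; z] i]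
    = 2 * d * x + 6 * g * y + 2 * h * z,
  ((cubic_poly a b c d e f g h i j)^`M(o1)^`M(o2)).@[fun i => nth 0 [:: x; y; z] i]
    = e * x + 2 * h * y + 2 * i * z &
  ((cubic_poly a b c d e f g h i j)^`M(o2)^`M(o2)).@[fun i => nth 0 [:: x; y; z] i]
    = 2 * f * x + 2 * i * y + 6 * j * z].
  by split; rewrite /cubic_poly !mderivD !mderivZ !mderiv_mono !mderivZ
    !mderiv_mono !mevalD !mevalZ !meval_mono /=; ring.
rewrite [_^`M(o1)^`M(o0)]mderiv_comm [_^`M(o2)^`M(o0)]mderiv_comm.
rewrite [_^`M(o2)^`M(o1)]mderiv_comm D00 D01 D02 D11 D12 D22.
ring.
Qed.
End HessianFormula.

(** * Generators of the general linear group *)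

Section Generation.
Variable K : fieldType.

Definition transvection (i j : 'I_3) (s : K) : 'M[K]_3 := 1%:M + s *: delta_mx i j.

Variable G : 'M[K]_3 -> Prop.
Hypothesis GM : forall g h, G g -> G h -> G (g *m h).
Hypothesis GT : forall i j s, i != j -> G (transvection i j s).
Hypothesis GD : forall d : 'rV[K]_3, (forall i, d 0 i != 0) -> G (diag_mx d).

Lemma generated1 : G 1%:M.
Proof. by have := GT 0 (isT : o0 != o1); rewrite /transvection scale0r addr0. Qed.

Lemma generated_tperm (i j : 'I_3) : G (tperm_mx i j).
Proof.
have [<-|ij] := eqVneq i j; first by rewrite /tperm_mx tperm1 perm_mx1; apply: generated1.
(* The three transvections compose to a quarter turn; [d] corrects a sign. *)
pose d : 'rV[K]_3 := \row_k (if k == i then -1 else 1).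
have -> : tperm_mx i j = transvection i j 1 *m transvection j i (-1)
    *m transvection i j 1 *m diag_mx d.
  apply/matrixP => a b; rewrite mul_mx_diag /d /transvection.
  rewrite !mxE !big_ord_recl !big_ord0 !mxE !big_ord_recl !big_ord0 !mxE permE /=.
  case: (ord3_cases i) ij => ->; case: (ord3_cases j) => -> //= _;
  case: (ord3_cases a) => ->; case: (ord3_cases b) => -> /=; ring.
apply: (GM); last by apply: GD => k; rewrite /d mxE; case: (k == i); rewrite ?oppr_eq0 oner_neq0.
by apply: (GM); [apply: (GM)|]; apply: GT => //; rewrite eq_sym.
Qed.

Lemma generated_perm (s : 'S_3) : G (perm_mx s).
Proof.
have [ts -> _] := prod_tpermP s.
elim: ts => [|t ts IH]; first by rewrite big_nil perm_mx1; apply: generated1.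
by rewrite big_cons perm_mxM; apply: GM => //; apply: generated_tperm.
Qed.

Lemma generated_lower (L : 'M[K]_3) :
  (forall i j : 'I_3, (i <= j)%N -> L i j = (i == j)%:R) -> G L.
Proof.
move=> hL.
have -> : L = transvection o1 o0 (L o1 o0) *m transvection o2 o0 (L o2 o0)
   *m transvection o2 o1 (L o2 o1).
  apply/matrixP => a b; rewrite /transvection.
  rewrite !mxE !big_ord_recl !big_ord0 !mxE !big_ord_recl !big_ord0 !mxE /=.
  case: (ord3_cases a) => ->; case: (ord3_cases b) => -> /=;
  rewrite ?[L o0 _]hL ?[L _ o2]hL ?[L o1 o1]hL //=; ring.
by apply: (GM); [apply: (GM)|]; apply: GT.
Qed.

Lemma generated_upper (U : 'M[K]_3) : U \in unitmx ->
  (forall i j : 'I_3, (j < i)%N -> U i j = 0) -> G U.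
Proof.
move=> uU hU.
have : \det U != 0 by rewrite -unitfE -unitmxE.
rewrite det3 (hU o1 o0) // (hU o2 o0) // (hU o2 o1) // !(mulr0, mul0r, subr0, addr0).
rewrite !mulf_eq0 !negb_or => /and3P [u0 u1 u2].
pose d : 'rV[K]_3 := \row_i U i i.
have d0 i : d 0 i != 0 by rewrite mxE; case: (ord3_cases i) => ->.
have -> : U = diag_mx d *m transvection o1 o2 (U o1 o2 / U o1 o1)
    *m transvection o0 o2 (U o0 o2 / U o0 o0)
    *m transvection o0 o1 (U o0 o1 / U o0 o0).
  rewrite -!mulmxA; apply/matrixP => a b; rewrite mul_diag_mx /d /transvection.
  rewrite !mxE !big_ord_recl !big_ord0 !mxE !big_ord_recl !big_ord0 !mxE /=.
  case: (ord3_cases a) => ->; case: (ord3_cases b) => -> /=;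
  rewrite ?(hU o1 o0) ?(hU o2 o0) ?(hU o2 o1) //=;
  move: u0 u1 u2; move: (U o0 o0) (U o1 o1) (U o2 o2) (U o0 o1) (U o0 o2) (U o1 o2);
  by move=> ? ? ? ? ? ? ? ? ?; field; do ?(apply/andP; split).
apply: (GM); first (apply: (GM); first apply: (GM)); try exact: GT.
exact: GD.
Qed.

(** The LUP decomposition factors [g] into a permutation matrix and two
    triangular matrices, all of which are products of transvections and of
    diagonal matrices.  A semi-invariance property, being stable under products, can
    thus be checked on these two kinds of matrices. *)
Lemma generated_unitmx g : g \in unitmx -> G g.
Proof.
move=> ug; move: (cormen_lup_perm g) (cormen_lup_correct g) (cormen_lup_detL g).
move: (@cormen_lup_lower _ _ g) (@cormen_lup_upper _ _ g).
move: (cormen_lup g) => [[P L] U] /= hL hU /is_perm_mxP [s Ps] PgLU dL.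
have uL : L \in unitmx by rewrite unitmxE dL unitr1.
have uP : P \in unitmx by rewrite Ps unitmx_perm.
have uU : U \in unitmx.
  have : P *m g \in unitmx by rewrite unitmx_mul uP.
  by rewrite mulmxE PgLU -mulmxE unitmx_mul => /andP [].
have -> : g = perm_mx s^-1 *m (L *m U).
  by rewrite mulmxE -PgLU -mulmxE mulmxA Ps -perm_mxM mulVg perm_mx1 mul1mx.
apply: (GM); first exact: generated_perm.
by apply: (GM); [apply: generated_lower|apply: generated_upper].
Qed.

End Generation.

(** * The Aronhold invariant *)

Section Aronhold.
Variable K : numClosedFieldType.
Local Notation form := (dhomog 3 K).

(** Aronhold's invariant of degree 4, multiplied by 1296 in order to have
    integral coefficients in the plain coefficients of the cubic, that is,
    without multinomial factors. *)
Definition aronhold_poly (R : comNzRingType) (a a2 a3 b1 m c1 b b3 c2 c : R) : R :=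
  216 * a * b * c * m
  - 144 * (b * c * a2 * a3 + c * a * b1 * b3 + a * b * c1 * c2)
  - 24 * m * (a * b3 * c2 + b * c1 * a3 + c * a2 * b1)
  + 48 * (a * b1 * c2 ^+ 2 + a * c1 * b3 ^+ 2 + b * a2 * c1 ^+ 2
          + b * c2 * a3 ^+ 2 + c * b3 * a2 ^+ 2 + c * a3 * b1 ^+ 2)
  - m ^+ 4 + 8 * m ^+ 2 * (b1 * c1 + c2 * a2 + a3 * b3)
  - 24 * m * (a2 * b3 * c1 + a3 * b1 * c2)
  - 16 * (b1 ^+ 2 * c1 ^+ 2 + c2 ^+ 2 * a2 ^+ 2 + a3 ^+ 2 * b3 ^+ 2)
  + 16 * (c2 * a2 * a3 * b3 + a3 * b3 * b1 * c1 + b1 * c1 * c2 * a2).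

Definition aronhold (Q : form 3) : K :=
  aronhold_poly (coef Q 3 0 0) (coef Q 2 1 0) (coef Q 2 0 1) (coef Q 1 2 0)
    (coef Q 1 1 1) (coef Q 1 0 2) (coef Q 0 3 0) (coef Q 0 2 1) (coef Q 0 1 2)
    (coef Q 0 0 3).

Lemma aronhold_cubic a b c d e f g h i j :
  aronhold (cubic a b c d e f g h i j) = aronhold_poly a b c d e f g h i j.
Proof. by rewrite /aronhold !coef_cubic. Qed.

Lemma aronhold_transvection (Q : form 3) (i j : 'I_3) s (ij : i != j) :
  aronhold (precomp (transvection i j s) Q) = aronhold Q.
Proof.
move: (cubicE Q); gen_coef Q => c0 c1 c2 c3 c4 c5 c6 c7 c8 c9 ->.
move: (cubic _ _ _ _ _ _ _ _ _ _) (aronhold_cubic c0 c1 c2 c3 c4 c5 c6 c7 c8 c9)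
  (eval_cubic c0 c1 c2 c3 c4 c5 c6 c7 c8 c9) => {}Q -> evQ.
have tr (R : form 3) : aronhold R = aronhold_poly c0 c1 c2 c3 c4 c5 c6 c7 c8 c9 ->
    (forall x y z, eval_xyz (precomp (transvection i j s) Q) x y z = eval_xyz R x y z) ->
    aronhold (precomp (transvection i j s) Q)
      = aronhold_poly c0 c1 c2 c3 c4 c5 c6 c7 c8 c9.
  by move=> <- /cubic_ext ->.
have evT x y z : eval_xyz (precomp (transvection i j s) Q) x y z =
  eval_xyz Q (x + (if i == o0 then s * nth 0 [:: x; y; z] j else 0))
       (y + (if i == o1 then s * nth 0 [:: x; y; z] j else 0))
       (z + (if i == o2 then s * nth 0 [:: x; y; z] j else 0)).
  rewrite eval_xyz_precomp /transvection !mxE.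
  by case: (ord3_cases i) => ->; case: (ord3_cases j) => -> /=; congr eval_xyz; ring.
(* In each of the six cases, the witness lists the coefficients of the
   transformed cubic. *)
case: (ord3_cases i) ij tr evT => ->; case: (ord3_cases j) => -> //= _ tr evT.
- apply: (tr (cubic c0 (c1 + 3 * s * c0) c2 (c3 + 2 * s * c1 + 3 * s ^+ 2 * c0)
    (c4 + 2 * s * c2) c5 (c6 + s * c3 + s ^+ 2 * c1 + s ^+ 3 * c0) (c7 + s *
    c4 + s ^+ 2 * c2) (c8 + s * c5) c9)).
  + by rewrite aronhold_cubic /aronhold_poly; ring.
  + by move=> x y z; rewrite evT evQ eval_cubic; ring.
- apply: (tr (cubic c0 c1 (c2 + 3 * s * c0) c3 (c4 + 2 * s * c1) (c5 + 2 * s *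
    c2 + 3 * s ^+ 2 * c0) c6 (c7 + s * c3) (c8 + s * c4 + s ^+ 2 * c1) (c9 +
    s * c5 + s ^+ 2 * c2 + s ^+ 3 * c0))).
  + by rewrite aronhold_cubic /aronhold_poly; ring.
  + by move=> x y z; rewrite evT evQ eval_cubic; ring.
- apply: (tr (cubic (c0 + s * c1 + s ^+ 2 * c3 + s ^+ 3 * c6) (c1 + 2 * s * c3
    + 3 * s ^+ 2 * c6) (c2 + s * c4 + s ^+ 2 * c7) (c3 + 3 * s * c6) (c4 + 2
    * s * c7) (c5 + s * c8) c6 c7 c8 c9)).
  + by rewrite aronhold_cubic /aronhold_poly; ring.
  + by move=> x y z; rewrite evT evQ eval_cubic; ring.
- apply: (tr (cubic c0 c1 (c2 + s * c1) c3 (c4 + 2 * s * c3) (c5 + s * c4 + s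
    ^+ 2 * c3) c6 (c7 + 3 * s * c6) (c8 + 2 * s * c7 + 3 * s ^+ 2 * c6) (c9
    + s * c8 + s ^+ 2 * c7 + s ^+ 3 * c6))).
  + by rewrite aronhold_cubic /aronhold_poly; ring.
  + by move=> x y z; rewrite evT evQ eval_cubic; ring.
- apply: (tr (cubic (c0 + s * c2 + s ^+ 2 * c5 + s ^+ 3 * c9) (c1 + s * c4 + s
    ^+ 2 * c8) (c2 + 2 * s * c5 + 3 * s ^+ 2 * c9) (c3 + s * c7) (c4 + 2 * s
    * c8) (c5 + 3 * s * c9) c6 c7 c8 c9)).
  + by rewrite aronhold_cubic /aronhold_poly; ring.
  + by move=> x y z; rewrite evT evQ eval_cubic; ring.
- apply: (tr (cubic c0 (c1 + s * c2) c2 (c3 + s * c4 + s ^+ 2 * c5) (c4 + 2 * s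
    * c5) c5 (c6 + s * c7 + s ^+ 2 * c8 + s ^+ 3 * c9) (c7 + 2 * s * c8 + 3
    * s ^+ 2 * c9) (c8 + 3 * s * c9) c9)).
  + by rewrite aronhold_cubic /aronhold_poly; ring.
  + by move=> x y z; rewrite evT evQ eval_cubic; ring.
Qed.

Lemma det_transvection (i j : 'I_3) (s : K) : i != j -> \det (transvection i j s) = 1.
Proof.
rewrite det3 /transvection !mxE.
by case: (ord3_cases i) => ->; case: (ord3_cases j) => -> //= _; ring.
Qed.

(** Both sides are multiplicative in [g], so it suffices to treat generators. *)
Lemma aronhold_precomp (Q : form 3) (g : 'M[K]_3) : g \in unitmx ->
  aronhold (precomp g Q) = \det g ^+ 4 * aronhold Q.
Proof.
move=> ug; move: Q.
apply: (@generated_unitmx _ (fun g => forall Q,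
  aronhold (precomp g Q) = \det g ^+ 4 * aronhold Q)) ug.
- by move=> {}g h hg hh Q; rewrite precompM hh hg det_mulmx exprMn mulrA [_ ^+ 4 * _ ^+ 4]mulrC.
- by move=> i j s ij Q; rewrite aronhold_transvection // det_transvection // expr1n mul1r.
move=> d _ Q; rewrite det3 !mxE /= !mulr1n !mulr0n.
have := cubicE Q; gen_coef Q => c0 c1 c2 c3 c4 c5 c6 c7 c8 c9 ->.
set u := d 0 o0; set v := d 0 o1; set w := d 0 o2.
have -> : precomp (diag_mx d) (cubic c0 c1 c2 c3 c4 c5 c6 c7 c8 c9) =
  cubic (c0 * u ^+ 3) (c1 * u ^+ 2 * v) (c2 * u ^+ 2 * w) (c3 * u * v ^+ 2)
     (c4 * u * v * w) (c5 * u * w ^+ 2) (c6 * v ^+ 3) (c7 * v ^+ 2 * w)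
     (c8 * v * w ^+ 2) (c9 * w ^+ 3).
  apply: cubic_ext => x y z; rewrite eval_xyz_precomp !eval_cubic !mxE /= !mulr1n !mulr0n.
  by rewrite -/u -/v -/w; ring.
by rewrite !aronhold_cubic /aronhold_poly; ring.
Qed.

(** An invariant of degree 12, which takes the place of the classical invariant
    [T] of degree 6: it is a linear combination of the cube of [aronhold] and
    of the square of [T]. *)
Definition aronhold_hess (Q : form 3) : K := aronhold (hess Q).

Lemma aronholdZ a (Q : form 3) : aronhold (a *: Q) = a ^+ 4 * aronhold Q.
Proof.
have := cubicE Q; gen_coef Q => c0 c1 c2 c3 c4 c5 c6 c7 c8 c9 ->.
have -> : a *: cubic c0 c1 c2 c3 c4 c5 c6 c7 c8 c9 =
  cubic (a * c0) (a * c1) (a * c2) (a * c3) (a * c4) (a * c5) (a * c6) (a * c7)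
     (a * c8) (a * c9).
  by apply: cubic_ext => x y z; rewrite {1}/eval_xyz /= mevalZ
    -/(eval_xyz (cubic _ _ _ _ _ _ _ _ _ _) _ _ _) !eval_cubic; ring.
by rewrite !aronhold_cubic /aronhold_poly; ring.
Qed.

Lemma aronhold_hess_precomp (Q : form 3) (g : 'M[K]_3) : g \in unitmx ->
  aronhold_hess (precomp g Q) = \det g ^+ 12 * aronhold_hess Q.
Proof.
move=> ug; rewrite /aronhold_hess hess_precomp aronholdZ aronhold_precomp //.
by rewrite mulrA -exprM -exprD.
Qed.

Definition weierstrass (a b : K) : form 3 := cubic (-1) 0 0 0 0 (- a) 0 1 0 (- b).

Lemma hess_weierstrass a b : hess (weierstrass a b) =
  cubic 0 0 (24 * a) 24 0 (72 * b) 0 0 0 (- 8 * a ^+ 2).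
Proof.
apply: cubic_ext => x y z; rewrite eval_hess /= /weierstrass !coef_cubic eval_cubic; ring.
Qed.

Lemma aronhold_weierstrass a b : aronhold (weierstrass a b) = 48 * a.
Proof. by rewrite aronhold_cubic /aronhold_poly; ring. Qed.

Lemma aronhold_hess_weierstrass a b : aronhold_hess (weierstrass a b) =
  - (3 ^+ 4 * 2 ^+ 16) * (a ^+ 3 + 9 * b ^+ 2).
Proof.
by rewrite /aronhold_hess hess_weierstrass aronhold_cubic /aronhold_poly; ring.
Qed.

(** The general cubic with a singular point at [(0 : 0 : 1)]; its tangent cone
    there is [c x^2 + e x y + g y^2 = 0]. *)
Definition nodal a b c d e f g : form 3 := cubic a b c d e 0 f g 0 0.

Lemma aronhold_nodal a b c d e f g :
  aronhold (nodal a b c d e f g) = - (e ^+ 2 - 4 * c * g) ^+ 2.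
Proof. by rewrite aronhold_cubic /aronhold_poly; ring. Qed.

(** The Hessian is singular at the same point, and the equation of its tangent
    cone there is the original one multiplied by twice the discriminant. *)
Lemma hess_nodal a b c d e f g : exists a' b' d' f',
  let k := 2 * (e ^+ 2 - 4 * c * g) in
  hess (nodal a b c d e f g) = nodal a' b' (k * c) d' (k * e) f' (k * g).
Proof.
exists (- 6 * a * e ^+ 2 + 8 * b * c * e - 8 * c ^+ 2 * d),
  (2 * b * e ^+ 2 + 16 * b * c * g - 24 * a * e * g - 24 * c ^+ 2 * f),
  (2 * d * e ^+ 2 + 16 * c * d * g - 24 * c * e * f - 24 * a * g ^+ 2),
  (- 6 * f * e ^+ 2 + 8 * d * g * e - 8 * g ^+ 2 * b).
apply: cubic_ext => x y z; rewrite eval_hess /= /nodal !coef_cubic !eval_cubic; ring.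
Qed.

Lemma aronhold_hess_nodal a b c d e f g :
  aronhold_hess (nodal a b c d e f g) = - 16 * (e ^+ 2 - 4 * c * g) ^+ 6.
Proof.
have [a' [b' [d' [f' /= E]]]] := hess_nodal a b c d e f g.
by rewrite /aronhold_hess E aronhold_nodal; ring.
Qed.
End Aronhold.

(** * Common zeros of two plane cubics *)

Section CommonZeros.
Variable K : numClosedFieldType.
Local Notation form := (dhomog 3 K).

Definition eval_at d (Q : form d) (v : 'cV[K]_3) : K := eval_xyz Q (v o0 0) (v o1 0) (v o2 0).

Definition vec3 (x y z : K) : 'cV[K]_3 := \col_i nth 0 [:: x; y; z] i.

Lemma eval_at_vec3 d (Q : form d) x y z : eval_at Q (vec3 x y z) = eval_xyz Q x y z.
Proof. by rewrite /eval_at /vec3 !mxE. Qed.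

Lemma vec3E (v : 'cV[K]_3) : v = vec3 (v o0 0) (v o1 0) (v o2 0).
Proof. by apply/colP => i; rewrite mxE; case: (ord3_cases i) => ->. Qed.

Lemma eval_at_meval d (Q : form d) (v : 'cV[K]_3) :
  eval_at Q v = (mpoly_of_dhomog Q).@[fun i => v i 0].
Proof. by apply: meval_eq => i; case: (ord3_cases i) => ->. Qed.

Lemma eval_at_precomp d (Q : form d) g v : eval_at (precomp g Q) v = eval_at Q (g *m v).
Proof. by rewrite !eval_at_meval precomp_eval. Qed.

Lemma vec3_neq0 (x y z : K) : (vec3 x y z != 0) = [|| x != 0, y != 0 | z != 0].
Proof.
apply/idP/idP; apply: contraLR; last first.
  move/negPn/eqP => h; rewrite -!negb_and negbK.
  have e i : vec3 x y z i 0 = 0 by rewrite h mxE.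
  by have := (e o0, e o1, e o2); rewrite !mxE /= => -[[-> ->] ->]; rewrite !eqxx.
rewrite -!negb_and !negbK => /and3P [/eqP -> /eqP -> /eqP ->].
by apply/eqP/colP => i; rewrite !mxE; case: (ord3_cases i) => ->.
Qed.

Lemma unitmx_mul_neq0 (g : 'M[K]_3) (v : 'cV[K]_3) :
  g \in unitmx -> v != 0 -> g *m v != 0.
Proof. by move=> ug; apply: contra_neq => h; rewrite -(mulKmx ug v) h mulmx0. Qed.

(** If the origin were the only zero, [D] would be constant on every line that
    misses the origin, because a polynomial in one variable without roots is
    constant.  Such lines connect [(s, 0)], for [s != 0], to [(0, 1)], so [D]
    would take its value at [(0, 1)] at every [(s, 0)] with [s != 0], hence
    also at the origin. *)
Lemma no_isolated_zero (D : K -> K -> K) :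
  (forall a b c d, exists r : {poly K}, forall t, D (a + t * b) (c + t * d) = r.[t]) ->
  D 0 0 = 0 -> exists x y, (x != 0) || (y != 0) /\ D x y = 0.
Proof.
move=> hD D0; apply: contrapT => nz.
have {}nz x y : (x != 0) || (y != 0) -> D x y != 0.
  by move=> xy; apply/eqP => h; apply: nz; exists x, y.
have cst (r : {poly K}) : (forall t, r.[t] != 0) -> forall s t, r.[s] = r.[t].
  move=> hr s t; have [|sr] := eqVneq (size r) 1.
    by move/eqP/size_poly1P => [c _ ->]; rewrite !hornerC.
  by have /closed_rootP [u] := sr; rewrite rootE (negbTE (hr u)).
have vert s : s != 0 -> D s 0 = D s 1.
  move=> s0; have [r hr] := hD s 0 0 1.
  have hr' t : D s t = r.[t] by rewrite -hr mulr0 addr0 mulr1 add0r.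
  by rewrite !hr'; apply: cst => t; rewrite -hr' nz // s0.
have hor s : D s 1 = D 0 1.
  have [r hr] := hD 0 1 1 0.
  have hr' t : D t 1 = r.[t] by rewrite -hr mulr0 addr0 mulr1 add0r.
  by rewrite !hr'; apply: cst => t; rewrite -hr' nz // oner_neq0 orbT.
have [r hr] := hD 0 1 0 0.
have r0 : r.[0] = 0 by rewrite -hr !mul0r !addr0 D0.
have r1 t : t != 0 -> r.[t] = D 0 1.
  by move=> t0; rewrite -hr mulr0 mulr1 addr0 add0r vert // hor.
have : (r - (D 0 1)%:P) * 'X = 0.
  apply/eqP; apply: contraT => /closed_field_nonroot [t].
  rewrite !hornerE /=; have [->|/r1 ->] := eqVneq t 0; first by rewrite mulr0 eqxx.
  by rewrite subrr mul0r eqxx.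
move/eqP; rewrite mulf_eq0 polyX_eq0 orbF subr_eq0 => /eqP h.
have := nz 0 1; rewrite oner_neq0 orbT => /(_ isT) /eqP; apply.
by rewrite -[LHS](hornerC _ 0) -h.
Qed.

Section FiberPolynomial.
Variables (R : comNzRingType) (c0 c1 c2 c3 c4 c5 c6 c7 c8 c9 : R) (x y : R).

(** The cubic on the line through [(0 : 0 : 1)] and [(x : y : 0)], as a
    polynomial in the last coordinate.  The coefficient ring is arbitrary so
    that the point [(x, y)] may itself depend on a parameter. *)
Definition fiber_poly : {poly R} :=
  c9%:P * 'X^3 + (c5 * x + c8 * y)%:P * 'X^2
  + (c2 * x ^+ 2 + c4 * x * y + c7 * y ^+ 2)%:P * 'X
  + (c0 * x ^+ 3 + c1 * x ^+ 2 * y + c3 * x * y ^+ 2 + c6 * y ^+ 3)%:P.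

Lemma lead_coef_fiber_poly : c9 != 0 -> lead_coef fiber_poly = c9.
Proof.
move=> c90; suff sz : size fiber_poly = 4.
  by rewrite lead_coefE sz /= /fiber_poly !coefE /= !mulr0 mulr1 !addr0.
apply/eqP; rewrite eqn_leq; apply/andP; split.
  apply/leq_sizeP => j hj; rewrite /fiber_poly !coefE.
  by move: j hj => [|[|[|[|j]]]] // _ /=; rewrite !mulr0 !addr0.
rewrite leqNgt; apply: contra c90; rewrite ltnS => /leq_sizeP/(_ 3%N (leqnn _)).
by rewrite /fiber_poly !coefE /= !mulr0 mulr1 !addr0 => ->.
Qed.

Lemma horner_fiber_poly z : fiber_poly.[z] =
  c0 * x ^+ 3 + c1 * x ^+ 2 * y + c2 * x ^+ 2 * z + c3 * x * y ^+ 2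
  + c4 * x * y * z + c5 * x * z ^+ 2 + c6 * y ^+ 3 + c7 * y ^+ 2 * z
  + c8 * y * z ^+ 2 + c9 * z ^+ 3.
Proof. by rewrite /fiber_poly !hornerE /=; ring. Qed.
End FiberPolynomial.

Lemma map_fiber_poly (R S : comNzRingType) (f : {rmorphism R -> S})
  c0 c1 c2 c3 c4 c5 c6 c7 c8 c9 x y :
  map_poly f (fiber_poly c0 c1 c2 c3 c4 c5 c6 c7 c8 c9 x y) =
  fiber_poly (f c0) (f c1) (f c2) (f c3) (f c4) (f c5) (f c6) (f c7) (f c8) (f c9)
    (f x) (f y).
Proof.
rewrite /fiber_poly !rmorphD !rmorphM /= !rmorphD !rmorphM /=.
by rewrite !map_polyC !map_polyX.
Qed.

Definition fiber (Q : form 3) (x y : K) : {poly K} :=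
  fiber_poly (coef Q 3 0 0) (coef Q 2 1 0) (coef Q 2 0 1) (coef Q 1 2 0)
    (coef Q 1 1 1) (coef Q 1 0 2) (coef Q 0 3 0) (coef Q 0 2 1) (coef Q 0 1 2)
    (coef Q 0 0 3) x y.

Lemma horner_fiber (Q : form 3) x y z : (fiber Q x y).[z] = eval_xyz Q x y z.
Proof. by rewrite horner_fiber_poly eval_xyzE. Qed.

Lemma lead_coef_fiber (Q : form 3) x y :
  coef Q 0 0 3 != 0 -> lead_coef (fiber Q x y) = coef Q 0 0 3.
Proof. exact: lead_coef_fiber_poly. Qed.

Definition fiber_line (Q : form 3) (a b c d : K) : {poly {poly K}} :=
  fiber_poly (coef Q 3 0 0)%:P (coef Q 2 1 0)%:P (coef Q 2 0 1)%:P
    (coef Q 1 2 0)%:P (coef Q 1 1 1)%:P (coef Q 1 0 2)%:P (coef Q 0 3 0)%:P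
    (coef Q 0 2 1)%:P (coef Q 0 1 2)%:P (coef Q 0 0 3)%:P
    (a%:P + b *: 'X) (c%:P + d *: 'X).

Lemma map_fiber_line (Q : form 3) a b c d t :
  map_poly (horner_eval t) (fiber_line Q a b c d) =
  fiber Q (a + t * b) (c + t * d).
Proof.
rewrite /fiber_line /fiber; gen_coef Q => c0 c1 c2 c3 c4 c5 c6 c7 c8 c9.
by rewrite map_fiber_poly /= /horner_eval !(hornerC, hornerD, hornerZ, hornerX) ![_ * t]mulrC.
Qed.

(** The resultant of the two fibers over [(x, y)] is polynomial in [(x, y)] and
    vanishes at the origin, where both fibers are multiples of ['X].  Another
    zero of it gives two fibers with a common root.  The leading coefficients
    of the fibers are constant, so resultants commute with specialization. *)
Lemma common_zero_monic (Q R : form 3) : coef Q 0 0 3 != 0 -> coef R 0 0 3 != 0 ->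
  exists2 v : 'cV[K]_3, v != 0 & eval_at Q v = 0 /\ eval_at R v = 0.
Proof.
move=> Q0 R0; have fQ0 a b c d t :
    horner_eval t (lead_coef (fiber_line Q a b c d)) != 0.
  by rewrite lead_coef_fiber_poly ?polyC_eq0 //= /horner_eval hornerC.
have fR0 a b c d t : horner_eval t (lead_coef (fiber_line R a b c d)) != 0.
  by rewrite lead_coef_fiber_poly ?polyC_eq0 //= /horner_eval hornerC.
have root_of x y : resultant (fiber Q x y) (fiber R x y) == 0 ->
    exists z, eval_xyz Q x y z = 0 /\ eval_xyz R x y z = 0.
  rewrite resultant_eq0 => sz.
  have /closed_rootP [z] : size (gcdp (fiber Q x y) (fiber R x y)) != 1%N.
    by rewrite neq_ltn sz orbT.
  rewrite root_gcd => /andP [/rootP + /rootP]; rewrite !horner_fiber.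
  by exists z.
have [||x [y [xy /eqP /root_of [z [Qz Rz]]]]] :=
    @no_isolated_zero (fun x y => resultant (fiber Q x y) (fiber R x y)).
- move=> a b c d; exists (resultant (fiber_line Q a b c d) (fiber_line R a b c d)) => t.
  by rewrite -[RHS]/(horner_eval t _) (map_resultant (fQ0 _ _ _ _ t) (fR0 _ _ _ _ t))
    !map_fiber_line.
- apply/eqP; rewrite /= resultant_eq0.
  have X_dvd (S : form 3) : 'X %| fiber S 0 0.
    by rewrite -['X]subr0 -polyC0 dvdp_XsubCl rootE horner_fiber eval_xyzE; apply/eqP; ring.
  have : 'X %| gcdp (fiber Q 0 0) (fiber R 0 0) by rewrite dvdp_gcd !X_dvd.
  move/dvdp_leq; rewrite size_polyX; apply.
  rewrite gcdp_eq0 negb_and -!lead_coef_eq0 lead_coef_fiber // Q0 //.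
exists (vec3 x y z); last by rewrite !eval_at_vec3.
by rewrite vec3_neq0 orbA xy.
Qed.
End CommonZeros.

Section ChangesOfCoordinates.
Variable K : numClosedFieldType.
Local Notation form := (dhomog 3 K).

Definition mx3 (s : seq (seq K)) : 'M[K]_3 := \matrix_(i, j) (nth [::] s i)`_j.

Lemma mx3_mul_vec3 a b c d e f g h i (x y z : K) :
  mx3 [:: [:: a; b; c]; [:: d; e; f]; [:: g; h; i]] *m vec3 x y z =
  vec3 (a * x + b * y + c * z) (d * x + e * y + f * z) (g * x + h * y + i * z).
Proof.
apply/colP => k; rewrite !mxE !big_ord_recl big_ord0 !mxE /=.
by case: (ord3_cases k) => -> /=; rewrite addr0 addrA.
Qed.

Lemma unitmx_mx3 a b c d e f g h i :
  (mx3 [:: [:: a; b; c]; [:: d; e; f]; [:: g; h; i]] \in unitmx) =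
  (a * (e * i - f * h) - b * (d * i - f * g) + c * (d * h - e * g) != 0).
Proof. by rewrite unitmxE unitfE det3 !mxE. Qed.

Lemma exists_frame (v : 'cV[K]_3) : v != 0 ->
  exists2 g, g \in unitmx & g *m vec3 0 0 1 = v.
Proof.
rewrite (vec3E v) vec3_neq0.
move: (v o0 0) (v o1 0) (v o2 0) => x y z.
have [z0|z0 _] := eqVneq z 0; last first.
  exists (mx3 [:: [:: 1; 0; x]; [:: 0; 1; y]; [:: 0; 0; z]]).
    by rewrite unitmx_mx3; apply: contra_neq z0 => <-; ring.
  by rewrite mx3_mul_vec3; congr vec3; ring.
have [y0|y0 _] := eqVneq y 0; last first.
  exists (mx3 [:: [:: 1; 0; x]; [:: 0; 0; y]; [:: 0; 1; z]]).
    by rewrite unitmx_mx3; apply: contra_neq y0 => h; rewrite -[RHS]oppr0 -h; ring.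
  by rewrite mx3_mul_vec3; congr vec3; ring.
rewrite !orbF => x0; exists (mx3 [:: [:: 0; 0; x]; [:: 1; 0; y]; [:: 0; 1; z]]).
  by rewrite unitmx_mx3; apply: contra_neq x0 => <-; ring.
by rewrite mx3_mul_vec3; congr vec3; ring.
Qed.

Lemma eval_at_eq0 (Q : form 3) : (forall v, eval_at Q v = 0) -> Q = 0.
Proof.
move=> h; apply: cubic_ext => x y z; rewrite -eval_at_vec3 h.
by rewrite /eval_xyz /= meval0.
Qed.

Lemma eval_at_neq0 (Q : form 3) : Q != 0 -> exists v, eval_at Q v != 0.
Proof.
move=> Q0; apply: contrapT => h; case/eqP: Q0; apply: eval_at_eq0 => v.
by apply/eqP/negPn/negP => Qv; apply: h; exists v.
Qed.

Lemma eval_at_line (Q : form 3) (u v : 'cV[K]_3) :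
  exists r : {poly K}, forall t, eval_at Q (u + t *: v) = r.[t].
Proof.
apply: (polycurve_line u v).
apply: (@polyfun_ext _ _ (fun v : 'cV[K]_3 => (mpoly_of_dhomog Q).@[fun i => v i 0])).
  by move=> w; rewrite eval_at_meval.
apply: polyfun_meval => i.
exists (\sum_(j < \dim {:'cV[K]_3}) (vbasis {:'cV[K]_3})`_j i 0 *: 'X_j) => w.
rewrite {1}(coord_vbasis (memvf w)) summxE /evalp raddf_sum /=.
by apply: eq_bigr => j _; rewrite !mxE mevalZ mevalXU mulrC.
Qed.

(** Two forms that do not vanish identically do not vanish at a common point,
    and [common_zero_monic] applies in coordinates where it is
    [(0 : 0 : 1)]. *)
Lemma common_zero (Q R : form 3) :
  exists2 v : 'cV[K]_3, v != 0 & eval_at Q v = 0 /\ eval_at R v = 0.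
Proof.
have e0 v : eval_at (0 : form 3) v = 0 by rewrite /eval_at /eval_xyz /= meval0.
have main (Q' R' : form 3) : Q' != 0 -> R' != 0 ->
    exists2 v : 'cV[K]_3, v != 0 & eval_at Q' v = 0 /\ eval_at R' v = 0.
  move=> /eval_at_neq0 [u Qu] /eval_at_neq0 [w Rw].
  have [r hr] := eval_at_line Q' u (w - u); have [s hs] := eval_at_line R' u (w - u).
  have : r * s * 'X != 0.
    rewrite !mulf_neq0 ?polyX_eq0 //.
      by apply: contraNneq Qu => r0; have := hr 0; rewrite scale0r addr0 r0 horner0 => ->.
    by apply: contraNneq Rw => s0; have := hs 1; rewrite scale1r addrC subrK s0 horner0 => ->.
  move=> /closed_field_nonroot [t]; rewrite !hornerM !mulf_eq0 !negb_or -hr -hs.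
  set p := u + _ => /andP [/andP [Qp Rp] _].
  have p0 : p != 0.
    apply: contraNneq Qp => ->.
    rewrite /eval_at !mxE eval_xyzE; gen_coef Q' => c0 c1 c2 c3 c4 c5 c6 c7 c8 c9.
    by apply/eqP; ring.
  have [g ug gp] := exists_frame p0.
  have c0 S : eval_at S p != 0 -> coef (precomp g S) 0 0 3 != 0.
    by rewrite coef_values -eval_at_vec3 eval_at_precomp gp.
  have [v v0] := common_zero_monic (c0 _ Qp) (c0 _ Rp).
  by rewrite !eval_at_precomp; exists (g *m v) => //; apply: unitmx_mul_neq0.
have self (S : form 3) : exists2 v : 'cV[K]_3, v != 0 & eval_at S v = 0.
  have [->|S0] := eqVneq S 0; last by have [v v0 []] := main S S S0 S0; exists v.
  by exists (vec3 1 0 0) => //; rewrite vec3_neq0 oner_neq0.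
have [->|Q0] := eqVneq Q 0; first by have [v v0 Rv] := self R; exists v.
have [->|R0] := eqVneq R 0; first by have [v v0 Qv] := self Q; exists v.
exact: main.
Qed.

Definition gradient (Q : form 3) (v : 'cV[K]_3) : 'cV[K]_3 :=
  \col_i ((mpoly_of_dhomog Q)^`M(i)).@[fun j => v j 0].

Lemma nonsingularP (Q : form 3) :
  nonsingular Q <-> forall v, v != 0 -> eval_at Q v = 0 -> gradient Q v != 0.
Proof.
split=> [nQ v v0 Qv|nQ x [i xi] Qx].
  have [||i] := nQ (fun i => v i 0).
  - apply: contrapT => h; case/eqP: v0; apply/colP => i; rewrite mxE.
    by apply/eqP/negPn/negP => vi; apply: h; exists i.
  - by rewrite -eval_at_meval.
  apply: contraNneq => h.
  by have := congr1 (fun w : 'cV_3 => w i 0) h; rewrite !mxE => ->.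
pose v : 'cV[K]_3 := \col_i x i.
have vx : (fun i => v i 0) = x by apply/funext => j; rewrite mxE.
have v0 : v != 0 by apply: contraNneq xi => h; rewrite -vx h mxE.
apply: contrapT => h; have := nQ v v0; rewrite eval_at_meval vx => /(_ Qx) /eqP; apply.
apply/colP => j; rewrite !mxE vx; apply/eqP/negPn/negP => Dj; apply: h.
by exists j.
Qed.

Lemma gradient_precomp (Q : form 3) g v :
  gradient (precomp g Q) v = g^T *m gradient Q (g *m v).
Proof.
apply/colP => i; rewrite !mxE /= mderiv_linear_subst raddf_sum /=.
apply: eq_bigr => k _; rewrite mevalZ !mxE; congr (_ * _).
rewrite comp_mpoly_meval; apply: meval_eq => j.
rewrite tnth_map tnth_ord_tuple raddf_sum mxE; apply: eq_bigr => l _.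
by rewrite /= mevalZ mevalXU.
Qed.

Lemma nonsingular_precomp (Q : form 3) g : g \in unitmx ->
  nonsingular Q -> nonsingular (precomp g Q).
Proof.
move=> ug /nonsingularP nQ; apply/nonsingularP => v v0.
rewrite eval_at_precomp gradient_precomp => /(nQ _ (unitmx_mul_neq0 ug v0)).
by apply: unitmx_mul_neq0; rewrite unitmx_tr.
Qed.

Lemma gradientE (Q : form 3) x y z : gradient Q (vec3 x y z) =
  vec3 (3 * coef Q 3 0 0 * x ^+ 2 + 2 * coef Q 2 1 0 * x * y
        + 2 * coef Q 2 0 1 * x * z + coef Q 1 2 0 * y ^+ 2
        + coef Q 1 1 1 * y * z + coef Q 1 0 2 * z ^+ 2)
       (coef Q 2 1 0 * x ^+ 2 + 2 * coef Q 1 2 0 * x * y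
        + coef Q 1 1 1 * x * z + 3 * coef Q 0 3 0 * y ^+ 2
        + 2 * coef Q 0 2 1 * y * z + coef Q 0 1 2 * z ^+ 2)
       (coef Q 2 0 1 * x ^+ 2 + coef Q 1 1 1 * x * y
        + 2 * coef Q 1 0 2 * x * z + coef Q 0 2 1 * y ^+ 2
        + 2 * coef Q 0 1 2 * y * z + 3 * coef Q 0 0 3 * z ^+ 2).
Proof.
have [D0 D1 D2] := eval_deriv Q x y z.
rewrite -D0 -D1 -D2; apply/colP => i; rewrite [LHS]mxE [RHS]mxE.
have -> : (fun j => vec3 x y z j 0) = (fun j : 'I_3 => nth 0 [:: x; y; z] j).
  by apply/funext => j; rewrite mxE.
by case: (ord3_cases i) => ->.
Qed.

Definition equivalent (Q R : form 3) := exists2 g, g \in unitmx & precomp g Q = R.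

Lemma equivalent_refl Q : equivalent Q Q.
Proof. by exists 1%:M; [exact: unitmx1|exact: precomp1]. Qed.

Lemma equivalent_trans Q R S : equivalent Q R -> equivalent R S -> equivalent Q S.
Proof.
move=> [g ug <-] [h uh <-]; exists (g *m h); last exact: precompM.
by rewrite unitmx_mul ug.
Qed.

Lemma equivalent_sym Q R : equivalent Q R -> equivalent R Q.
Proof.
move=> [g ug <-]; exists (invmx g); first by rewrite unitmx_inv.
by rewrite -precompM mulmxV // precomp1.
Qed.

Lemma equivalent_nonsingular Q R : equivalent Q R -> nonsingular Q -> nonsingular R.
Proof. by move=> [g ug <-]; apply: nonsingular_precomp. Qed.

Lemma equivalent_mx3 (Q R : form 3) a b c d e f g h i :
  a * (e * i - f * h) - b * (d * i - f * g) + c * (d * h - e * g) != 0 ->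
  (forall x y z, eval_xyz Q (a * x + b * y + c * z) (d * x + e * y + f * z)
     (g * x + h * y + i * z) = eval_xyz R x y z) -> equivalent Q R.
Proof.
move=> D0 QR; exists (mx3 [:: [:: a; b; c]; [:: d; e; f]; [:: g; h; i]]).
  by rewrite unitmx_mx3.
by apply: cubic_ext => x y z; rewrite -eval_at_vec3 eval_at_precomp mx3_mul_vec3 eval_at_vec3.
Qed.

End ChangesOfCoordinates.

(** * The Weierstrass normal form *)

Section WeierstrassForm.
Variable K : numClosedFieldType.
Local Notation form := (dhomog 3 K).

Lemma not_nonsingular (Q : form 3) x y z : [|| x != 0, y != 0 | z != 0] ->
  eval_xyz Q x y z = 0 -> gradient Q (vec3 x y z) = vec3 0 0 0 -> ~ nonsingular Q.
Proof.
move=> v0 Qv dQ /nonsingularP/(_ (vec3 x y z)).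
by rewrite vec3_neq0 eval_at_vec3 dQ vec3_neq0 eqxx v0 => /(_ isT Qv).
Qed.

(** A common zero of [Q] and of its Hessian is a flex.  It is moved to
    [(0 : 1 : 0)] and its tangent to [z = 0], on which the cubic then restricts
    to a multiple of [x^3]. *)
Lemma flex_form (Q : form 3) : nonsingular Q ->
  exists c0 c2 c4 c5 c7 c8 c9, c7 != 0 /\ equivalent Q (cubic c0 0 c2 0 c4 c5 0 c7 c8 c9).
Proof.
move=> nQ; have [v v0 [Qv Hv]] := common_zero Q (hess Q).
have [g ug gv] := exists_frame v0.
pose sw : 'M[K]_3 := mx3 [:: [:: 1; 0; 0]; [:: 0; 0; 1]; [:: 0; 1; 0]].
have usw : sw \in unitmx.
  by rewrite unitmx_mx3 (_ : _ - _ + _ = - 1) ?oppr_eq0 ?oner_neq0 //; ring.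
have swv : g *m sw *m vec3 0 1 0 = v.
  by rewrite -mulmxA mx3_mul_vec3 -gv; congr (_ *m vec3 _ _ _); ring.
have ugs : g *m sw \in unitmx by rewrite unitmx_mul ug.
have : equivalent Q (precomp (g *m sw) Q) by exists (g *m sw).
have := nonsingular_precomp ugs nQ.
have : eval_xyz (precomp (g *m sw) Q) 0 1 0 = 0 by rewrite -eval_at_vec3 eval_at_precomp swv.
have : eval_xyz (hess (precomp (g *m sw) Q)) 0 1 0 = 0.
  rewrite -eval_at_vec3 hess_precomp eval_at_meval /= mevalZ.
  by have := eval_at_precomp (hess Q) (g *m sw) (vec3 0 1 0);
     rewrite swv Hv eval_at_meval /= => ->; rewrite mulr0.
move: (precomp _ _) => R.
have := cubicE R; gen_coef R => c0 c1 c2 c3 c4 c5 c6 c7 c8 c9 -> {v v0 Qv Hv g ug gv usw swv ugs}.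
rewrite eval_hess /= !coef_cubic eval_cubic !(mulr0, mulr1, expr0n, expr1n, add0r, addr0, mul0r) /=.
move=> hc c60 nR simQR; rewrite {}c60 {c6} in nR simQR hc *.
have {}hc : c1 * c7 ^+ 2 + c3 ^+ 2 * c8 - c3 * c4 * c7 = 0.
  apply: (mulfI (_ : - 8 != 0)); first by rewrite oppr_eq0 pnatr_eq0.
  by rewrite mulr0 -[RHS]hc; ring.
(* The tangent at [(0 : 1 : 0)] is [c3 x + c7 z = 0].  A shear moves it to
   [z = 0] if [c7 != 0]; otherwise [x] and [z] are exchanged. *)
have [c70|c70] := eqVneq c7 0; last first.
  pose k := c3 / c7; have kc7 : c3 = k * c7 by rewrite divfK.
  exists (c0 - c2 * k + c5 * k ^+ 2 - c9 * k ^+ 3),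
    (c2 - 2 * c5 * k + 3 * c9 * k ^+ 2), (c4 - 2 * c8 * k), (c5 - 3 * c9 * k),
    c7, c8, c9; split=> //; apply: equivalent_trans simQR _.
  have c1E : c1 = c4 * k - c8 * k ^+ 2.
    apply: (mulIf (expf_neq0 2 c70)); apply/eqP; rewrite -subr_eq0 -[X in _ == X]hc.
    by apply/eqP; rewrite kc7; ring.
  apply: (@equivalent_mx3 _ _ _ 1 0 0 0 1 0 (- k) 0 1).
    by rewrite (_ : _ - _ + _ = 1) ?oner_neq0 //; ring.
  by move=> x y z; rewrite !eval_cubic c1E kc7; ring.
rewrite {}c70 {c7} in hc nR simQR.
have c30 : c3 != 0.
  apply/eqP => c30; apply: (@not_nonsingular _ 0 1 0) nR.
  - by rewrite oner_neq0 orbT.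
  - by rewrite eval_cubic c30; ring.
  - by rewrite gradientE !coef_cubic c30; congr vec3; ring.
have c80 : c8 = 0.
  apply: (mulfI (expf_neq0 2 c30)); rewrite mulr0 -[RHS]hc; ring.
exists c9, c5, c4, c2, c3, c1, c0; split=> //; apply: equivalent_trans simQR _.
apply: (@equivalent_mx3 _ _ _ 0 0 1 0 1 0 1 0 0).
  by rewrite (_ : _ - _ + _ = - 1) ?oppr_eq0 ?oner_neq0 //; ring.
by move=> x y z; rewrite !eval_cubic c80; ring.
Qed.

(** The square in [y] and the cube in [x] are completed, and the variables are
    rescaled.  If the discriminant vanished, a double root of [x^3 + a x + b]
    would be the abscissa of a singular point. *)
Lemma weierstrass_form (Q : form 3) : nonsingular Q ->
  exists2 ab : K * K, 4 * ab.1 ^+ 3 + 27 * ab.2 ^+ 2 != 0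
    & equivalent Q (weierstrass ab.1 ab.2).
Proof.
move=> nQ; have [A [B [c4 [C [e [c8 [D [e0 simQ]]]]]]]] := flex_form nQ.
have nR := equivalent_nonsingular simQ nQ.
(* Otherwise [z] divides the cubic, which is singular where the line [z = 0]
   meets the residual conic. *)
have A0 : A != 0.
  apply/eqP => A0.
  have [y hy] : exists y, B + c4 * y + e * y ^+ 2 = 0.
    pose p : {poly K} := B%:P + c4%:P * 'X + e%:P * 'X^2.
    have /closed_rootP [y] : size p != 1%N.
      apply: contraNneq e0 => sp; have : p`_2 = 0 by rewrite nth_default ?sp.
      by rewrite /p !coefE /= mulr0 mulr1 addr0 add0r => ->.
    by move/rootP; rewrite /p !hornerE /= => h; exists y; rewrite -[RHS]h; ring.
  apply: (@not_nonsingular _ 1 y 0) nR.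
  - by rewrite oner_neq0.
  - by rewrite eval_cubic A0; ring.
  - rewrite gradientE !coef_cubic A0.
    have -> : vec3 0 0 0 = vec3 0 0 (B + c4 * y + e * y ^+ 2) by rewrite hy.
    by congr vec3; ring.
pose B' := B - c4 ^+ 2 / (4 * e); pose C' := C - c4 * c8 / (2 * e).
pose D' := D - c8 ^+ 2 / (4 * e).
have two0 : 2 != 0 :> K by rewrite pnatr_eq0.
have sim1 : equivalent (cubic A 0 B 0 c4 C 0 e c8 D) (cubic A 0 B' 0 0 C' 0 e 0 D').
  apply: (@equivalent_mx3 _ _ _ 1 0 0 (- c4 / (2 * e)) 1 (- c8 / (2 * e)) 0 0 1).
    by rewrite (_ : _ - _ + _ = 1) ?oner_neq0 //; ring.
  by move=> x y z; rewrite !eval_cubic /B' /C' /D'; field.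
pose C'' := C' - B' ^+ 2 / (3 * A).
pose D'' := D' - B' * C' / (3 * A) + 2 * B' ^+ 3 / (27 * A ^+ 2).
have sim2 : equivalent (cubic A 0 B' 0 0 C' 0 e 0 D') (cubic A 0 0 0 0 C'' 0 e 0 D'').
  apply: (@equivalent_mx3 _ _ _ 1 0 (- B' / (3 * A)) 0 1 0 0 0 1).
    by rewrite (_ : _ - _ + _ = 1) ?oner_neq0 //; ring.
  move=> x y z; rewrite !eval_cubic /C'' /D''; move: B' C' D' {sim1 C'' D''} => B' C' D'.
  by field.
pose u := 3.-root (- A^-1); have u3 : u ^+ 3 = - A^-1 by rewrite rootCK.
have u0 : u != 0.
  apply: contraNneq A0 => h; move/eqP: u3; rewrite h expr0n eq_sym oppr_eq0.
  by rewrite invr_eq0.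
pose a := - C'' * u / e ^+ 2; pose b := - D'' / e ^+ 3.
have sim3 : equivalent (cubic A 0 0 0 0 C'' 0 e 0 D'') (weierstrass a b).
  apply: (@equivalent_mx3 _ _ _ u 0 0 0 1 0 0 0 e^-1).
    by rewrite (_ : _ - _ + _ = u / e) ?mulf_neq0 ?invr_eq0 //; ring.
  move=> x y z; rewrite !eval_cubic.
  have -> : A * (u * x + 0 * y + 0 * z) ^+ 3 = A * u ^+ 3 * x ^+ 3 by ring.
  by rewrite u3 /a /b; field; apply/andP; split.
exists (a, b); last
  exact: equivalent_trans simQ (equivalent_trans sim1 (equivalent_trans sim2 sim3)).
apply/eqP => /= disc0.
have {}nR := equivalent_nonsingular (equivalent_trans sim1 (equivalent_trans sim2 sim3)) nR.
(* The double root of the polynomial [x^3 + a x + b]. *)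
have [x [hx hx' hx'']] : exists x, [/\ x ^+ 3 + a * x + b = 0, 3 * x ^+ 2 + a = 0
    & 2 * a * x + 3 * b = 0].
  have [a0|a0] := eqVneq a 0.
    have b0 : b = 0.
      apply/eqP; move/eqP: disc0; rewrite a0 expr0n mulr0 add0r mulf_eq0.
      by rewrite pnatr_eq0 expf_eq0.
    by exists 0; rewrite a0 b0; split; ring.
  exists (- 3 * b / (2 * a)); split.
  - rewrite [LHS](_ : _ = - b / (8 * a ^+ 3) * (4 * a ^+ 3 + 27 * b ^+ 2)).
      by rewrite disc0 mulr0.
    by field; rewrite a0.
  - rewrite [LHS](_ : _ = (4 * a ^+ 3 + 27 * b ^+ 2) / (4 * a ^+ 2)).
      by rewrite disc0 mul0r.
    by field; rewrite a0.
  - by field; rewrite a0.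
apply: (@not_nonsingular _ x 0 1) nR.
- by rewrite oner_neq0 !orbT.
- suff -> : eval_xyz (weierstrass a b) x 0 1 = - (x ^+ 3 + a * x + b) by rewrite hx oppr0.
  by rewrite eval_cubic; ring.
- rewrite gradientE !coef_cubic.
  have -> : vec3 0 0 0 = vec3 (- (3 * x ^+ 2 + a)) 0 (- (2 * a * x + 3 * b)).
    by rewrite hx' hx'' oppr0.
  by congr vec3; ring.
Qed.
End WeierstrassForm.

(** * The stabilizer is finite, hence reductive *)

Section FiniteStabilizer.
Variable K : numClosedFieldType.
Local Notation form := (dhomog 3 K).

(** Finiteness is expressed by a list because averages over a finite group are
    sums over a list. *)
Definition listed (T : eqType) (A : set T) := exists s : seq T, forall x, A x -> x \in s.

Lemma listed_roots (p : {poly K}) : p != 0 -> listed [set x | p.[x] = 0].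
Proof.
move=> p0; have [r pr] := closed_field_poly_normal p.
exists r => x /= /eqP; rewrite pr hornerZ mulf_eq0 lead_coef_eq0 (negbTE p0) /=.
by rewrite -[_ == 0]/(root _ x) root_prod_XsubC.
Qed.

Lemma listed_matrices n (A : set K) : listed A ->
  listed [set M : 'M[K]_n | forall i j, A (M i j)].
Proof.
move=> [L hL].
exists [seq \matrix_(i, j) L`_(f (i, j)) | f : {ffun 'I_n * 'I_n -> 'I_(size L)}].
move=> M hM; apply/mapP; have iL i j : (index (M i j) L < size L)%N.
  by rewrite index_mem hL.
exists [ffun ij => Ordinal (iL ij.1 ij.2)]; first by rewrite mem_enum.
by apply/matrixP => i j; rewrite !mxE ffunE /= nth_index // hL.
Qed.

(** Comparing coefficients shows that [h] is diagonal, that its first entry is a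
    cube root of unity, that its last entry is a sixth root of unity, since [a]
    and [b] are not both zero, and that the square of its middle entry is the
    inverse of the last one. *)
Lemma stabilizer_flex_entries (a b : K) (h : 'M[K]_3) :
  4 * a ^+ 3 + 27 * b ^+ 2 != 0 ->
  precomp h (weierstrass a b) = weierstrass a b -> h o0 o1 = 0 -> h o2 o1 = 0 ->
  forall i j, h i j * (h i j ^+ 12 - 1) = 0.
Proof.
move=> disc hW h01 h21.
set p := h o0 o0; set q := h o0 o2; set r := h o1 o0; set c := h o1 o1.
set s := h o1 o2; set t := h o2 o0; set w := h o2 o2.
have : cubic (r ^+ 2 * t - p ^+ 3 - a * p * t ^+ 2 - b * t ^+ 3) (2 * r * c * t)
   (r ^+ 2 * w + 2 * r * s * t - 3 * p ^+ 2 * q - a * (2 * p * t * w + q * t ^+ 2)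
    - 3 * b * t ^+ 2 * w) (c ^+ 2 * t) (2 * c * s * t + 2 * r * c * w)
   (s ^+ 2 * t + 2 * r * s * w - 3 * p * q ^+ 2 - a * (p * w ^+ 2 + 2 * q * t * w)
    - 3 * b * t * w ^+ 2) 0 (c ^+ 2 * w) (2 * c * s * w)
   (s ^+ 2 * w - q ^+ 3 - a * q * w ^+ 2 - b * w ^+ 3) = weierstrass a b.
  rewrite -[RHS]hW; apply: cubic_ext => x y z; rewrite eval_xyz_precomp !eval_cubic h01 h21.
  by rewrite -/p -/q -/r -/c -/s -/t -/w; ring.
move=> E; have coefE i j k := congr1 (fun Q => coef Q i j k) E.
have := coefE 0 2 1; rewrite !coef_cubic => c2w.
have c0 : c != 0.
  by apply: contraPneq c2w => ->; rewrite expr0n mul0r => /eqP; rewrite eq_sym oner_eq0.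
have w0 : w != 0.
  by apply: contraPneq c2w => ->; rewrite mulr0 => /eqP; rewrite eq_sym oner_eq0.
have [n2 n3] : 2 != 0 :> K /\ 3 != 0 :> K by rewrite !pnatr_eq0.
have := coefE 1 2 0; rewrite !coef_cubic => /eqP; rewrite mulf_eq0 expf_eq0 (negbTE c0) /=.
move=> /eqP t0.
have := coefE 1 1 1; rewrite !coef_cubic t0 mulr0 add0r => /eqP.
rewrite !mulf_eq0 (negbTE n2) (negbTE c0) (negbTE w0) /= !orbF => /eqP r0.
have := coefE 0 1 2; rewrite !coef_cubic => /eqP.
rewrite !mulf_eq0 (negbTE n2) (negbTE c0) (negbTE w0) /= !orbF => /eqP s0.
have := coefE 3 0 0; rewrite !coef_cubic t0 r0 => p3.
have {}p3 : p ^+ 3 = 1 by apply: oppr_inj; rewrite -p3; ring.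
have p0 : p != 0.
  by apply: contraPneq p3 => ->; rewrite expr0n => /eqP; rewrite eq_sym oner_eq0.
have := coefE 2 0 1; rewrite !coef_cubic t0 r0 => q0.
have {}q0 : q = 0.
  apply: (mulfI (mulf_neq0 n3 (expf_neq0 2 p0))).
  by rewrite mulr0; apply: oppr_inj; rewrite oppr0 -q0; ring.
have := coefE 1 0 2; rewrite !coef_cubic t0 r0 q0 => aw.
have {}aw : a * (p * w ^+ 2 - 1) = 0.
  apply/eqP; rewrite mulrBr mulr1 subr_eq0; apply/eqP; apply: oppr_inj.
  by rewrite -aw; ring.
have := coefE 0 0 3; rewrite !coef_cubic s0 q0 => bw.
have {}bw : b * (w ^+ 3 - 1) = 0.
  apply/eqP; rewrite mulrBr mulr1 subr_eq0; apply/eqP; apply: oppr_inj.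
  by rewrite -bw; ring.
have w6 : w ^+ 6 = 1.
  have [a0|a0] := eqVneq a 0.
    have b0 : b != 0.
      by apply: contraNneq disc => ->; rewrite a0 !expr0n !mulr0 addr0.
    move/eqP: bw; rewrite mulf_eq0 (negbTE b0) subr_eq0 /= => /eqP w3.
    by rewrite (exprM w 3 2) w3 expr1n.
  move/eqP: aw; rewrite mulf_eq0 (negbTE a0) subr_eq0 /= => /eqP pw2.
  by rewrite -[RHS](expr1n _ 3) -pw2 exprMn p3 mul1r -exprM.
have c12 : c ^+ 12 = 1.
  by rewrite -[RHS](expr1n _ 6) -c2w exprMn w6 mulr1 -exprM.
have w12 : w ^+ 12 = 1 by rewrite (exprM w 6 2) w6 expr1n.
have p12 : p ^+ 12 = 1 by rewrite (exprM p 3 4) p3 expr1n.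
move=> i j; case: (ord3_cases i) => ->; case: (ord3_cases j) => ->;
rewrite -/p -/q -/r -/c -/s -/t -/w ?h01 ?h21 ?p12 ?c12 ?w12 ?q0 ?r0 ?s0 ?t0;
by rewrite ?subrr ?mulr0 ?mul0r.
Qed.

Lemma precompV_eq n d g (Q R : dhomog n.+1 K d) : g \in unitmx ->
  precomp g Q = R -> precomp (invmx g) R = Q.
Proof. by move=> ug <-; rewrite -precompM mulmxV // precomp1. Qed.

Lemma eval_at_hess_precomp (Q : form 3) g v :
  eval_at (hess (precomp g Q)) v = \det g ^+ 2 * eval_at (hess Q) (g *m v).
Proof. by rewrite hess_precomp eval_at_meval /= mevalZ -eval_at_precomp eval_at_meval. Qed.

(** Up to scaling, the flexes are [(0 : 1 : 0)] and points of the curve whose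
    abscissa is a root of the 3-division polynomial [p]. *)
Lemma listed_flexes (a b : K) : exists F : seq 'cV[K]_3, forall v, v != 0 ->
  eval_at (weierstrass a b) v = 0 -> eval_at (hess (weierstrass a b)) v = 0 ->
  exists2 f, f \in F & exists2 c, c != 0 & v = c *: f.
Proof.
have [n2 n3] : 2 != 0 :> K /\ 3 != 0 :> K by rewrite !pnatr_eq0.
pose p : {poly K} := 3%:P * 'X^4 + (6 * a)%:P * 'X^2 + (12 * b)%:P * 'X - (a ^+ 2)%:P.
have p0 : p != 0.
  apply: contraNneq n3 => h; have : p`_4 = 0 by rewrite h coef0.
  by rewrite /p !coefE /= !mulr0 mulr1 !addr0 subr0 => ->.
have [L hL] := listed_roots p0.
pose q x : {poly K} := 'X^2 - (x ^+ 3 + a * x + b)%:P.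
have q0 x : q x != 0.
  apply: contraNneq (oner_neq0 K) => h; have : (q x)`_2 = 0 by rewrite h coef0.
  by rewrite /q !coefE /= subr0 => /eqP.
have /choice [M hM] x : exists s : seq K, forall y, (q x).[y] = 0 -> y \in s.
  exact: listed_roots (q0 x).
exists (vec3 0 1 0 :: [seq vec3 x y 1 | x <- L, y <- M x]) => v.
rewrite (vec3E v) !eval_at_vec3 hess_weierstrass !eval_cubic vec3_neq0.
move: (v o0 0) (v o1 0) (v o2 0) => X Y Z v0 Wv Hv.
have [Z0|Z0] := eqVneq Z 0.
  have X0 : X = 0.
    apply/eqP; rewrite -[X == 0]/((0 < 3)%N && (X == 0)) -expf_eq0 -oppr_eq0 -[Y in _ == Y]Wv Z0.
    by apply/eqP; ring.
  exists (vec3 0 1 0); first by rewrite mem_head.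
  exists Y; first by move: v0; rewrite X0 Z0 eqxx orbF.
  by apply/colP => i; rewrite !mxE; case: (ord3_cases i) => -> /=; rewrite ?X0 ?Z0 ?mulr0 ?mulr1.
have [x XE] : exists x, X = x * Z by exists (X / Z); rewrite divfK.
have [y YE] : exists y, Y = y * Z by exists (Y / Z); rewrite divfK.
have Z3 : Z ^+ 3 != 0 by rewrite expf_neq0.
have Wxy : y ^+ 2 = x ^+ 3 + a * x + b.
  apply: (mulfI Z3); apply/eqP; rewrite -subr_eq0 -[X in _ == X]Wv XE YE.
  by apply/eqP; ring.
exists (vec3 x y 1).
  rewrite inE; apply/orP; right; apply/allpairsPdep; exists x, y; split=> //.
    apply: hL => /=; rewrite /p !hornerE /=.
    apply: (mulfI (mulf_neq0 (_ : 8 != 0) Z3)); first by rewrite pnatr_eq0.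
    rewrite mulr0 -[RHS]Hv XE YE.
    transitivity (8 * Z ^+ 3 * (3 * x * (x ^+ 3 + a * x + b) + 3 * a * x ^+ 2
       + 9 * b * x - a ^+ 2)); first by ring.
    by rewrite -Wxy; ring.
  by apply: hM; rewrite /q !hornerE /= Wxy subrr.
exists Z => //; apply/colP => i; rewrite !mxE.
by case: (ord3_cases i) => -> /=; rewrite ?XE ?YE ?mulr1 // mulrC.
Qed.

(** The image of the flex [(0 : 1 : 0)] is one of finitely many flexes, and two
    elements of the stabilizer with the same image of it differ by an element
    that fixes it, to which [stabilizer_flex_entries] applies. *)
Lemma listed_stabilizer_weierstrass (a b : K) : 4 * a ^+ 3 + 27 * b ^+ 2 != 0 ->
  listed (stabilizer (weierstrass a b)).
Proof.
move=> disc; set W := weierstrass a b; pose ey : 'cV[K]_3 := vec3 0 1 0.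
have [s0 hs0] : listed [set h | stabilizer W h /\ exists c, h *m ey = c *: ey].
  have pX : 'X * ('X^12 - 1) != 0 :> {poly K}.
    by rewrite mulf_neq0 ?polyX_eq0 // -polyC1 monic_neq0 ?monicXnsubC.
  have [s hs] := @listed_matrices 3 _ (listed_roots pX).
  exists s => h [[uh hW] [c hc]]; apply: hs => /= i j.
  rewrite hornerM hornerX hornerD hornerN hornerXn -polyC1 hornerC.
  apply: (stabilizer_flex_entries disc hW).
    have := congr1 (fun v : 'cV[K]_3 => v o0 0) hc.
    by rewrite !mxE !big_ord_recl big_ord0 !mxE /= !mulr0 mulr1 !add0r !addr0.
  have := congr1 (fun v : 'cV[K]_3 => v o2 0) hc.
  by rewrite !mxE !big_ord_recl big_ord0 !mxE /= !mulr0 mulr1 !add0r !addr0.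
have [F hF] := listed_flexes a b.
pose P (h : 'M[K]_3) f := exists2 c, c != 0 & h *m ey = c *: f.
have /choice [rep hrep] f : exists r, (exists2 h, stabilizer W h & P h f) ->
    stabilizer W r /\ P r f.
  have [[h Hh Phf]|h] := pselect (exists2 h, stabilizer W h & P h f); first by exists h.
  by exists 0.
exists [seq rep f *m k | f <- F, k <- s0] => h Hh; have [uh' hW] := Hh.
have {uh'} uh : h \in unitmx := uh'.
have [] := hF (h *m ey).
- by apply: unitmx_mul_neq0 => //; rewrite vec3_neq0 oner_neq0 orbT.
- by rewrite -eval_at_precomp hW eval_at_vec3 eval_cubic; ring.
- have : eval_at (hess (precomp h W)) ey = 0.
    by rewrite hW hess_weierstrass eval_at_vec3 eval_cubic; ring.
  rewrite eval_at_hess_precomp => /eqP; rewrite mulf_eq0 expf_eq0 /=.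
  by move: uh; rewrite unitmxE unitfE => /negbTE -> /eqP.
move=> f fF Pf; have [[ur' rW] [d d0 rf]] := hrep f (ex_intro2 _ _ _ Hh Pf).
have {ur'} ur : rep f \in unitmx := ur'.
have [c c0 hf] := Pf.
apply/allpairsP; exists (f, invmx (rep f) *m h); split=> //=; last by rewrite mulKVmx.
apply: hs0; split; [split|].
- by change (invmx (rep f) *m h \in unitmx); rewrite unitmx_mul unitmx_inv ur.
- by rewrite precompM (precompV_eq ur rW).
exists (c / d); rewrite -mulmxA hf -scalemxAr.
have -> : invmx (rep f) *m f = d^-1 *: ey; last by rewrite scalerA.
by rewrite -[RHS](mulKmx ur) -scalemxAr rf scalerA mulVf // scale1r.
Qed.

Lemma listed_stabilizer (Q : form 3) : nonsingular Q -> listed (stabilizer Q).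
Proof.
move=> /weierstrass_form [[a b] /= disc [k uk kQ]].
have [s hs] := listed_stabilizer_weierstrass disc.
exists [seq k *m h *m invmx k | h <- s] => g [ug gQ].
apply/mapP; exists (invmx k *m g *m k); last by rewrite !mulmxA mulmxV // mul1mx mulmxK.
apply: hs; split.
  by change (invmx k *m g *m k \in unitmx); rewrite !unitmx_mul unitmx_inv uk ug.
by rewrite !precompM (precompV_eq uk kQ) gQ.
Qed.

Section Maschke.
Variables (n : nat) (H : set 'M[K]_n) (s : seq 'M[K]_n).
Hypothesis HGL : H `<=` @GL K n.
Hypothesis H1 : H 1%:M.
Hypothesis HM : forall g h, H g -> H h -> H (g *m h).
Hypothesis HV : forall g, H g -> H (invmx g).
Hypothesis us : uniq s.
Hypothesis sH : forall h, (h \in s) <-> H h.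

(** Maschke's argument: the average over the group of a projection onto [U] is
    an equivariant projection onto [U], and its kernel is a stable complement. *)
Lemma completely_reducible_finite d (rho : 'M[K]_n -> 'M[K]_d) :
  rational_rep H rho -> completely_reducible H rho.
Proof.
move=> [rho1 rhoM _] U Ust.
have rhoV g : H g -> rho g *m rho (invmx g) = 1%:M.
  by move=> Hg; rewrite -rhoM ?mulmxV //; [exact: HGL|exact: HV].
have rhoV' g : H g -> rho (invmx g) *m rho g = 1%:M.
  by move=> Hg; rewrite -rhoM ?mulVmx //; [exact: HGL|exact: HV].
have N0 : (size s)%:R != 0 :> K.
  by rewrite pnatr_eq0 size_eq0; apply: contraTneq isT => s0; have /sH := H1; rewrite s0.
pose pi (v : 'cV[K]_d) : 'cV[K]_d :=
  (size s)%:R^-1 *: \sum_(h <- s) rho h *m projv U (rho (invmx h) *m v).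
have pi_lin : linear pi.
  move=> a u v; rewrite /pi scalerA mulrC -scalerA -scalerDr; congr (_ *: _).
  rewrite scaler_sumr -big_split; apply: eq_bigr => h _ /=.
  by rewrite mulmxDr -scalemxAr linearP mulmxDr -scalemxAr.
have pi_U v : pi v \in U.
  rewrite /pi memvZ // big_seq memv_suml // => h /sH Hh.
  by apply: Ust => //; exact: memv_proj.
have pi_id v : v \in U -> pi v = v.
  move=> vU; rewrite /pi big_seq (eq_bigr (fun=> v)); last first.
    move=> h /sH Hh; rewrite projv_id; last by apply: Ust => //; exact: HV.
    by rewrite mulmxA rhoV // mul1mx.
  by rewrite -big_seq big_const_seq count_predT iter_addr_0 -scaler_nat scalerA mulVf // scale1r.
have pi_eq g v : H g -> pi (rho g *m v) = rho g *m pi v.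
  move=> Hg; rewrite /pi -scalemxAr; congr (_ *: _); rewrite mulmx_sumr.
  have perm : perm_eq s [seq g *m h | h <- s].
    apply: uniq_perm => //.
      rewrite map_inj_uniq // => h k /(congr1 (mulmx (invmx g))).
      by rewrite !mulKmx //; exact: HGL.
    move=> h; apply/idP/mapP => [/sH Hh|[k /sH Hk ->]]; last by apply/sH; exact: HM.
    exists (invmx g *m h); last by rewrite mulKVmx //; exact: HGL.
    by apply/sH; apply: HM => //; exact: HV.
  rewrite (perm_big _ perm) big_map; rewrite big_seq [RHS]big_seq.
  apply: eq_bigr => h /sH Hh; rewrite rhoM // -mulmxA; congr (_ *m (_ *m projv U _)).
  have -> : invmx (g *m h) = invmx h *m invmx g.
    apply: (can_inj (mulKmx (_ : g *m h \in unitmx))).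
      by rewrite unitmx_mul; apply/andP; split; exact: HGL.
    rewrite mulmxV; last by rewrite unitmx_mul; apply/andP; split; exact: HGL.
    by rewrite -mulmxA mulKVmx ?mulmxV //; exact: HGL.
  rewrite rhoM; [|exact: HV|exact: HV].
  by rewrite -mulmxA [rho (invmx g) *m _]mulmxA rhoV' // mul1mx.
pose piL : {linear 'cV[K]_d -> 'cV[K]_d} := HB.pack pi (GRing.isLinear.Build _ _ _ _ pi pi_lin).
pose f := linfun piL; have fE v : f v = pi v by rewrite lfunE.
exists (lker f); split.
- by move=> g v Hg; rewrite !memv_ker !fE pi_eq // => /eqP ->; rewrite mulmx0.
- apply/eqP; rewrite eqEsubv subvf; apply/subvP => v _.
  rewrite -[v](subrK (pi v)) addrC memv_add // memv_ker fE.
  by rewrite -[pi _]/(piL _) linearB /= [pi (pi v)]pi_id // subrr.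
- apply/eqP; rewrite -subv0; apply/subvP => v; rewrite memv_cap memv0 memv_ker fE.
  by move=> /andP [vU /eqP]; rewrite pi_id // => ->.
Qed.
End Maschke.

Lemma reductive_listed n (H : set 'M[K]_n) : H `<=` @GL K n -> H 1%:M ->
  (forall g h, H g -> H h -> H (g *m h)) -> (forall g, H g -> H (invmx g)) ->
  listed H -> reductive H.
Proof.
move=> HGL H1 HM HV [s0 hs0].
pose s := undup [seq h <- s0 | `[< H h >]].
have sH h : h \in s <-> H h.
  rewrite mem_undup mem_filter; split=> [/andP [/asboolP]//|Hh].
  by apply/andP; split; [exact/asboolP|exact: hs0].
split; last by move=> d rho; apply: (@completely_reducible_finite _ _ s) => //; exact: undup_uniq.
split=> //; exists [set x | x \in s]; first exact: zclosed_seq.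
apply/seteqP; split=> h; last by case=> /sH.
by move=> Hh; split; [exact/sH|exact: HGL].
Qed.

Lemma reductive_stabilizer (Q : form 3) : nonsingular Q -> reductive (stabilizer Q).
Proof.
move=> nQ; apply: reductive_listed (listed_stabilizer nQ).
- by move=> g [].
- by split; [exact: unitmx1|exact: precomp1].
- move=> g h [ug gQ] [uh hQ]; split; last by rewrite precompM gQ.
  by change (g *m h \in unitmx); rewrite unitmx_mul; apply/andP.
- move=> g [ug gQ]; split; last exact: precompV_eq.
  by change (invmx g \in unitmx); rewrite unitmx_inv.
Qed.
End FiniteStabilizer.

(** * The boundary is the sweep of a linear space *)

Section SweptSets.
Variables (K : closedFieldType) (n d : nat).
Local Notation V := (dhomog n.+1 K d).

Lemma polycurve_precomp (A B : 'M[K]_n.+1) (c0 c1 : V) :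
  polycurve (fun t => precomp (A + t *: B) (c0 + t *: c1)).
Proof.
have line Q : polycurve (fun t => precomp (A + t *: B) Q : V).
  move=> f [p hp]; have [r hr] := evalp_precomp_line Q A B p.
  by exists r => t; rewrite hp hr.
have := polycurveD (line c0) (polycurveZ 'X (line c1)); congr polycurve.
by apply/funext => t; rewrite hornerX raddfD /= linearZ.
Qed.

(** Two elements [Q o A] and [R o B] of the sweep lie on the curve obtained by
    letting the line of matrices through [A] and [B] act on the line through
    [Q] and [R]; almost all of this curve is in the sweep.  If one polynomial is
    nonzero at one end and another at the other end, both are nonzero at some
    point of the curve in the sweep. *)
Lemma irreducible_sweep (L : set V) : L !=set0 ->
  (forall Q R t, L Q -> L R -> L (Q + t *: (R - Q))) ->
  irreducible [set Q | exists2 N, L N & exists2 g, g \in unitmx & precomp g N = Q].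
Proof.
move=> [N0 LN0] lineL; split.
  by exists N0, N0 => //; exists 1%:M; [exact: unitmx1|exact: precomp1].
move=> Z1 Z2 c1 c2 s12; apply: contrapT => /not_orP [].
move=> /existsNP [_ /not_implyP [[Q LQ [A uA <-]] nZ1]].
move=> /existsNP [_ /not_implyP [[R LR [B uB <-]] nZ2]].
have [r3 h3] := det_line A (B - A).
have [F1 E1] := c1; have [F2 E2] := c2.
move: nZ1; rewrite {1}E1 => /existsNP [p1 /not_implyP [Fp1 /eqP n1]].
move: nZ2; rewrite {1}E2 => /existsNP [p2 /not_implyP [Fp2 /eqP n2]].
have cur := polycurve_precomp A (B - A) Q (R - Q).
have [r1 h1] := cur _ (ex_intro _ p1 (fun=> erefl)).
have [r2 h2] := cur _ (ex_intro _ p2 (fun=> erefl)).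
have neq0 (r : {poly K}) t : r.[t] != 0 -> r != 0.
  by apply: contraNneq => ->; rewrite horner0.
have : r1 * r2 * r3 != 0.
  rewrite !mulf_neq0 //.
  - by apply: (neq0 _ 0); rewrite -h1 !scale0r !addr0.
  - by apply: (neq0 _ 1); rewrite -h2 !scale1r !(addrC _ (_ - _)) !subrK.
  - by apply: (neq0 _ 0); rewrite -h3 scale0r addr0 -unitfE.
move=> /closed_field_nonroot [t]; rewrite !hornerM !mulf_eq0 !negb_or -andbA -h1 -h2 -h3.
move=> /and3P [/eqP m1 /eqP m2 m3].
have [] := s12 (precomp (A + t *: (B - A)) (Q + t *: (R - Q))).
- exists (Q + t *: (R - Q)); first exact: lineL.
  by exists (A + t *: (B - A)) => //; rewrite unitmxE unitfE.
- by rewrite E1 => /(_ _ Fp1).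
- by rewrite E2 => /(_ _ Fp2).
Qed.
End SweptSets.

Section Nullforms.
Variable K : numClosedFieldType.
Local Notation form := (dhomog 3 K).

(** Cubics singular at [(0 : 0 : 1)] whose tangent cone there is a multiple of
    [y^2]. *)
Definition cuspidal_space : set (form 3) :=
  [set Q | exists a b d f g, Q = nodal a b 0 d 0 f g].

(** The forms at which every invariant of positive degree vanishes; they are
    described here in the way that makes their irreducibility visible. *)
Definition nullforms : set (form 3) :=
  [set Q | exists2 N, cuspidal_space N & equivalent N Q].

Lemma nodal_line a b c d e f g a' b' c' d' e' f' g' (t : K) :
  nodal a b c d e f g + t *: (nodal a' b' c' d' e' f' g' - nodal a b c d e f g) =
  nodal (a + t * (a' - a)) (b + t * (b' - b)) (c + t * (c' - c)) (d + t * (d' - d))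
    (e + t * (e' - e)) (f + t * (f' - f)) (g + t * (g' - g)).
Proof.
apply: cubic_ext => x y z; rewrite [LHS]mevalD mevalZ mevalB.
by rewrite -!/(eval_xyz _ _ _ _) !eval_cubic; ring.
Qed.

Lemma irreducible_nullforms : irreducible nullforms.
Proof.
apply: irreducible_sweep; first by exists (nodal 0 0 0 0 0 0 0); exists 0, 0, 0, 0, 0.
move=> _ _ t [a [b [d [f [g ->]]]]] [a' [b' [d' [f' [g' ->]]]]].
rewrite nodal_line !subr0 !mulr0 !addr0.
by do 5 eexists.
Qed.

Lemma nullforms_equivalent Q R : nullforms Q -> equivalent Q R -> nullforms R.
Proof. by move=> [N LN NQ] QR; exists N => //; exact: equivalent_trans NQ QR. Qed.

Lemma nullforms_singular Q : nullforms Q -> ~ nonsingular Q.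
Proof.
move=> [_ [a [b [d [f [g ->]]]]] /equivalent_sym simQ] /(equivalent_nonsingular simQ).
apply: (@not_nonsingular _ _ 0 0 1).
- by rewrite oner_neq0 !orbT.
- by rewrite eval_cubic; ring.
- by rewrite gradientE !coef_cubic; congr vec3; ring.
Qed.

Lemma orbit_closure_equivalent (P Q R : form 3) :
  orbit_closure P Q -> equivalent Q R -> orbit_closure P R.
Proof.
move=> PQ [g ug <-]; have Gg : @GL K 3 g by [].
exact: (orbit_closure_precomp (SigSub (mem_set Gg)) PQ).
Qed.

Lemma equivalent_weierstrass_scale (a b u : K) : u != 0 ->
  equivalent (weierstrass a b) (weierstrass (u ^+ 4 * a) (u ^+ 6 * b)).
Proof.
move=> u0; apply: (@equivalent_mx3 _ _ _ 1 0 0 0 u^-1 0 0 0 (u ^+ 2)).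
  by rewrite (_ : _ - _ + _ = u) //; field.
by move=> x y z; rewrite !eval_cubic; field.
Qed.

Lemma weierstrass_line (a b s t : K) : weierstrass (s * a) (t * b) =
  weierstrass 0 0 + s *: cubic 0 0 0 0 0 (- a) 0 0 0 0 + t *: cubic 0 0 0 0 0 0 0 0 0 (- b).
Proof.
apply: cubic_ext => x y z; rewrite [RHS]mevalD [in RHS]mevalD !mevalZ.
by rewrite -!/(eval_xyz _ _ _ _) !eval_cubic; ring.
Qed.

Lemma polycurve_weierstrass (a b : K) :
  polycurve (fun t => weierstrass (t ^+ 4 * a) (t ^+ 6 * b)).
Proof.
pose c1 : form 3 := cubic 0 0 0 0 0 (- a) 0 0 0 0.
pose c2 : form 3 := cubic 0 0 0 0 0 0 0 0 0 (- b).
have := polycurveD (polycurveD (@polycurve_cst _ _ (weierstrass 0 0))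
   (polycurveZ 'X^4 (@polycurve_cst _ _ c1))) (polycurveZ 'X^6 (@polycurve_cst _ _ c2)).
by congr polycurve; apply/funext => t; rewrite !hornerXn weierstrass_line.
Qed.

(** The curve [weierstrass (t^4 a) (t^6 b)] lies in the orbit for [t != 0]. *)
Lemma orbit_closure_cusp (a b : K) : orbit_closure (weierstrass a b) (weierstrass 0 0).
Proof.
have cur := polycurve_weierstrass a b.
have := @zclosed_curve _ _ _ _ 'X cur (@zclosed_zclosure _ _ (Defs.orbit (weierstrass a b))).
rewrite polyX_eq0 => /(_ isT) H; have := H _ 0.
rewrite !expr0n /= !mul0r; apply => t; rewrite hornerX => t0.
apply: zclosure_sub; exact: equivalent_weierstrass_scale.
Qed.

Lemma equivalent_cusp (a b d f g : K) : a != 0 -> g != 0 ->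
  equivalent (weierstrass 0 0) (nodal a b 0 d 0 f g).
Proof.
move=> a0 g0; pose u := 3.-root (- a); have u3 : u ^+ 3 = - a by rewrite rootCK.
have u0 : u != 0.
  by apply: contraNneq a0 => h; rewrite -oppr_eq0 -u3 h expr0n.
apply: (@equivalent_mx3 _ _ _ u (u * (b / (3 * a))) 0 0 1 0
   (d - b ^+ 2 / (3 * a)) (f - b ^+ 3 / (27 * a ^+ 2)) g).
  by rewrite (_ : _ - _ + _ = u * g) ?mulf_neq0 //; ring.
move=> x y z; rewrite !eval_cubic.
have -> : -1 * (u * x + u * (b / (3 * a)) * y + 0 * z) ^+ 3 =
  - u ^+ 3 * (x + b / (3 * a) * y) ^+ 3 by ring.
by rewrite u3; field.
Qed.

(** Members of [cuspidal_space] with nonzero coefficients at [x^3] and [y^2 z]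
    are equivalent to the cusp ([equivalent_cusp]); the others are limits of these along
    a line. *)
Lemma nullforms_orbit_closure (a b : K) :
  nullforms `<=` orbit_closure (weierstrass a b).
Proof.
move=> Q [_ [a' [b' [d [f [g ->]]]]] simQ]; apply: orbit_closure_equivalent simQ.
have cur := polycurve_line (nodal a' b' 0 d 0 f g)
  (nodal (a' + 1) b' 0 d 0 f (g + 1) - nodal a' b' 0 d 0 f g).
have q0 : ('X + a'%:P) * ('X + g%:P) != 0.
  by rewrite mulf_neq0 // monic_neq0 // monicXaddC.
have cZ : zclosed (orbit_closure (weierstrass a b)) := zclosed_zclosure _.
have H := zclosed_curve cur cZ q0.
have := H _ 0; rewrite scale0r addr0; apply => t.
rewrite !hornerE mulf_eq0 negb_or => /andP [ta tg].
rewrite nodal_line; apply: (orbit_closure_equivalent (@orbit_closure_cusp a b)).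
rewrite !subrr !mulr0 !addr0 ![_ + 1 - _]addrAC !subrr !add0r !mulr1.
by apply: equivalent_cusp; rewrite addrC.
Qed.

Lemma polyfun_coef i j k : polyfun (fun Q : form 3 => coef Q i j k).
Proof.
exists (\sum_(l < \dim {:form 3}) coef (vbasis {:form 3})`_l i j k *: 'X_l) => Q.
rewrite /evalp raddf_sum /= {1}(coord_vbasis (memvf Q)) /coef.
rewrite (raddf_sum (@mpoly_of_dhomog 3 K 3)) raddf_sum /=.
by apply: eq_bigr => l _; rewrite mevalZ mevalXU mcoeffZ mulrC.
Qed.

End Nullforms.

Ltac polyfun := repeat first
  [ exact: polyfun_coef | exact: polyfun_cst | apply: polyfunX
  | apply: polyfunM | apply: polyfunB | apply: polyfunD | apply: polyfunN ].

Section OrbitClosureBoundary.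
Variable K : numClosedFieldType.
Local Notation form := (dhomog 3 K).

Lemma polyfun_aronhold : polyfun (@aronhold K).
Proof. by rewrite /aronhold /aronhold_poly; polyfun. Qed.

Lemma polyfun_coef_hess i j k : (i + j + k = 3)%N ->
  polyfun (fun Q : form 3 => coef (hess Q) i j k).
Proof.
have pe x y z : polyfun (fun Q : form 3 => eval_xyz (hess Q) x y z).
  by apply: polyfun_ext => [Q|]; [rewrite eval_hess /=; reflexivity|polyfun].
move: i j k => [|[|[|[|i]]]] [|[|[|[|j]]]] [|[|[|[|k]]]] // _;
by apply: polyfun_ext => [Q|]; [rewrite coef_values; reflexivity|polyfun; exact: pe].
Qed.

Lemma polyfun_aronhold_hess : polyfun (@aronhold_hess K).
Proof.
by rewrite /aronhold_hess /aronhold /aronhold_poly; polyfun; exact: polyfun_coef_hess.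
Qed.

(** Both sides have weight [det^12] as functions of [Q], so the equation holds on
    the orbit and extends to its closure. *)
Lemma orbit_closure_invariants (P Q : form 3) : orbit_closure P Q ->
  aronhold_hess P * aronhold Q ^+ 3 = aronhold P ^+ 3 * aronhold_hess Q.
Proof.
apply: (@zclosure_min _ _ _
  [set R | aronhold_hess P * aronhold R ^+ 3 = aronhold P ^+ 3 * aronhold_hess R]).
  apply: zclosed_eq; apply: polyfunM; try exact: polyfun_cst.
    exact: polyfunX polyfun_aronhold.
  exact: polyfun_aronhold_hess.
move=> _ [g ug <-] /=; rewrite aronhold_precomp // aronhold_hess_precomp //.
by rewrite exprMn -exprM mulrCA [in RHS]mulrCA [aronhold P ^+ 3 * _]mulrC.
Qed.

(** The tangent cone is a double line, which is moved to [y = 0]. *)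
Lemma equivalent_cuspidal (a b c d e f g : K) : e ^+ 2 = 4 * c * g ->
  nullforms (nodal a b c d e f g).
Proof.
move=> disc; have [c0|c0] := eqVneq c 0.
  have e0 : e = 0 by apply/eqP; rewrite -sqrf_eq0 disc c0 mulr0 mul0r.
  by rewrite c0 e0; eexists; [do 5 eexists|exact: equivalent_refl].
pose k := e / (2 * c).
have eE : e = 2 * c * k by rewrite /k; field.
have gE : g = c * k ^+ 2.
  apply: (mulfI (mulf_neq0 (_ : 4 != 0) c0)); first by rewrite pnatr_eq0.
  by rewrite -disc eE; ring.
clearbody k; exists (nodal (f - d * k + b * k ^+ 2 - a * k ^+ 3)
    (d - 2 * b * k + 3 * a * k ^+ 2) 0 (b - 3 * a * k) 0 a c); first by do 5 eexists.
apply: equivalent_sym; apply: (@equivalent_mx3 _ _ _ (- k) 1 0 1 0 0 0 0 1).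
  by rewrite (_ : _ - _ + _ = - 1) ?oppr_eq0 ?oner_neq0 //; ring.
by move=> x y z; rewrite !eval_cubic eE gE; ring.
Qed.

(** The equation says that the j-invariants agree.  A rescaling by [u] transforms
    one form into the other if [u^4 = a' / a] and [u^6 = b' / b].  If [a] and
    [b] are nonzero, this determines [u^2] as the quotient of the two ratios, and
    the equation makes both conditions hold. *)
Lemma same_invariants_equivalent (a b a' b' : K) :
  4 * a ^+ 3 + 27 * b ^+ 2 != 0 -> 4 * a' ^+ 3 + 27 * b' ^+ 2 != 0 ->
  b ^+ 2 * a' ^+ 3 = a ^+ 3 * b' ^+ 2 -> equivalent (weierstrass a b) (weierstrass a' b').
Proof.
move=> disc disc' E.
suff [u [u0 -> ->]] : exists u, [/\ u != 0, a' = u ^+ 4 * a & b' = u ^+ 6 * b].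
  exact: equivalent_weierstrass_scale.
have root_neq0 k (x y : K) : (0 < k)%N -> x != 0 -> y != 0 -> k.-root (y / x) != 0.
  by move=> k0 x0 y0; rewrite rootC_eq0 // mulf_neq0 ?invr_eq0.
have nz (x y : K) : 4 * x ^+ 3 + 27 * y ^+ 2 != 0 -> x = 0 -> y != 0.
  by move=> + x0; apply: contraNneq => ->; rewrite x0 !expr0n !mulr0 addr0.
have [a0|a0] := eqVneq a 0.
  have b0 := nz _ _ disc a0.
  have a'0 : a' = 0.
    apply/eqP; have : b ^+ 2 * a' ^+ 3 == 0 by rewrite E a0 expr0n mul0r.
    by rewrite mulf_eq0 !expf_eq0 (negbTE b0).
  have b'0 := nz _ _ disc' a'0.
  exists (6.-root (b' / b)); rewrite rootCK // divfK // a0 a'0 mulr0.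
  by split=> //; exact: root_neq0.
have [b0|b0] := eqVneq b 0.
  have b'0 : b' = 0.
    apply/eqP; have : a ^+ 3 * b' ^+ 2 == 0 by rewrite -E b0 expr0n mul0r.
    by rewrite mulf_eq0 !expf_eq0 (negbTE a0).
  have a'0 : a' != 0.
    by apply: contraTneq isT => /(nz _ _ disc'); rewrite b'0 eqxx.
  exists (4.-root (a' / a)); rewrite rootCK // divfK // b0 b'0 mulr0.
  by split=> //; exact: root_neq0.
have a'0 : a' != 0.
  apply/eqP => a'0; have := nz _ _ disc' a'0; rewrite -sqrf_eq0.
  rewrite -(mulrI_eq0 _ (mulfI (expf_neq0 3 a0))) -E a'0.
  by rewrite expr0n mulr0 eqxx.
have b'0 : b' != 0.
  apply/eqP => b'0; move/eqP: E; rewrite b'0 expr0n mulr0 mulf_eq0 !expf_eq0 /=.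
  by rewrite (negbTE b0) (negbTE a'0).
pose w := (b' / b) / (a' / a); pose u := 2.-root w.
have w0 : w != 0 by rewrite !mulf_neq0 ?invr_eq0 ?mulf_neq0 ?invr_eq0.
have u2 : u ^+ 2 = w by rewrite rootCK.
have u4 : u ^+ 4 = a' / a.
  rewrite (exprM u 2 2) u2 /w; apply/eqP; rewrite -subr_eq0; apply/eqP.
  rewrite [LHS](_ : _ = (a ^+ 3 * b' ^+ 2 - b ^+ 2 * a' ^+ 3) / (a' ^+ 2 * b ^+ 2 * a)).
    by rewrite E subrr mul0r.
  by field; rewrite a0 b0 a'0.
exists u; split; first by rewrite rootC_eq0.
  by rewrite u4 divfK.
by rewrite (exprD u 4 2) u4 u2 /w; field; rewrite a0 b0 a'0.
Qed.

(** A nonsingular form in the closure has the j-invariant of the orbit, so it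
    belongs to the orbit.  For a singular form, the equation of the closure
    reads [(4 a^3 + 27 b^2) d^6 = 0] up to a nonzero factor, where [d] is the
    discriminant of the tangent cone at the singular point. *)
Lemma boundary_weierstrass (a b : K) : 4 * a ^+ 3 + 27 * b ^+ 2 != 0 ->
  nonsingular (weierstrass a b) -> boundary (weierstrass a b) = @nullforms K.
Proof.
move=> disc nW; set W := weierstrass a b.
apply/seteqP; split=> Q; last first.
  move=> nQ; split; first exact: nullforms_orbit_closure.
  by move=> /equivalent_nonsingular/(_ nW); exact: nullforms_singular.
move=> [clQ norbQ]; have [nQ|sQ] := pselect (nonsingular Q).
  case: norbQ; have [[a' b'] /= disc' simQ] := weierstrass_form nQ.
  apply: equivalent_trans (equivalent_sym simQ); apply: same_invariants_equivalent => //.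
  have := orbit_closure_invariants (orbit_closure_equivalent clQ simQ).
  rewrite !aronhold_weierstrass !aronhold_hess_weierstrass => E.
  have k0 : 9 * 48 ^+ 3 * (3 ^+ 4 * 2 ^+ 16) != 0 :> K.
    by rewrite !mulf_neq0 ?expf_neq0 ?pnatr_eq0.
  apply: (mulfI k0); apply/eqP; rewrite -subr_eq0; apply/eqP.
  apply: oppr_inj; rewrite oppr0; move/eqP: E; rewrite -subr_eq0 => /eqP <-; ring.
have [v [v0 Qv dQ]] : exists v, [/\ v != 0, eval_at Q v = 0 & gradient Q v = 0].
  apply: contrapT => h; apply: sQ; apply/nonsingularP => v v0 Qv.
  by apply/eqP => dQ; apply: h; exists v.
have [g ug gv] := exists_frame v0.
have simR : equivalent Q (precomp g Q) by exists g.
apply: nullforms_equivalent (equivalent_sym simR).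
have := orbit_closure_invariants (orbit_closure_equivalent clQ simR).
have : gradient (precomp g Q) (vec3 0 0 1) = 0.
  by rewrite gradient_precomp gv dQ mulmx0.
have : eval_at (precomp g Q) (vec3 0 0 1) = 0 by rewrite eval_at_precomp gv.
move: (precomp g Q) => R {simR}.
have := cubicE R; gen_coef R => c0 c1 c2 c3 c4 c5 c6 c7 c8 c9 ->.
rewrite eval_at_vec3 eval_cubic !(expr0n, expr1n, mulr0, mul0r, mulr1, add0r, addr0) /= => c90.
rewrite gradientE !coef_cubic => dR.
have e (i : 'I_3) := congr1 (fun w : 'cV_3 => w i 0) dR.
have := (e ord0, e (lift ord0 ord0)); rewrite !mxE /=.
rewrite !(expr0n, expr1n, mulr0, mul0r, mulr1, add0r, addr0) /= => -[-> ->].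
rewrite {}c90 -/(nodal c0 c1 c2 c3 c4 c6 c7) aronhold_nodal aronhold_hess_nodal.
rewrite !aronhold_weierstrass !aronhold_hess_weierstrass => E.
apply: equivalent_cuspidal; apply/eqP; rewrite -subr_eq0.
suff : 16 * 48 ^+ 3 * (4 * a ^+ 3 + 27 * b ^+ 2) * (c4 ^+ 2 - 4 * c2 * c7) ^+ 6 == 0.
  have k0 : 16 * 48 ^+ 3 * (4 * a ^+ 3 + 27 * b ^+ 2) != 0.
    by apply: mulf_neq0 => //; rewrite mulf_neq0 ?expf_neq0 ?pnatr_eq0.
  by rewrite mulf_eq0 (negbTE k0) /= expf_eq0.
by move/eqP: E; rewrite -subr_eq0; congr (_ == _); ring.
Qed.

Lemma equivalent_orbit (P Q : form 3) : equivalent P Q -> Defs.orbit P = Defs.orbit Q.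
Proof.
move=> PQ; apply/seteqP; split=> R; last exact: equivalent_trans.
exact: equivalent_trans (equivalent_sym PQ).
Qed.

Lemma irreducible_boundary (P : form 3) : nonsingular P -> irreducible (boundary P).
Proof.
move=> nP; have [[a b] /= disc simP] := weierstrass_form nP.
have nW := equivalent_nonsingular simP nP.
rewrite /boundary /orbit_closure (equivalent_orbit simP).
rewrite -/(orbit_closure _) -/(boundary _) boundary_weierstrass //.
exact: irreducible_nullforms.
Qed.
End OrbitClosureBoundary.

(** * Polynomial representations on duals of spaces of forms *)

Section PolynomialFamilies.
Variables (K : closedFieldType) (V : vectType K) (n : nat).

Definition polyfamily (F : V -> {mpoly K[n]}) :=
  forall m, polyfun (fun v => (F v)@_m).

Lemma polyfamily_cst p : polyfamily (fun=> p).
Proof. by move=> m; apply: polyfun_cst. Qed.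

Lemma polyfamilyZ (f : V -> K) p : polyfun f -> polyfamily (fun v => f v *: p).
Proof.
move=> hf m; apply: (@polyfun_ext _ _ (fun v => f v * p@_m)).
  by move=> v; rewrite mcoeffZ.
by apply: polyfunM => //; apply: polyfun_cst.
Qed.

Lemma polyfamily_sum I (r : seq I) (F : I -> V -> {mpoly K[n]}) :
  (forall i, polyfamily (F i)) -> polyfamily (fun v => \sum_(i <- r) F i v).
Proof.
move=> hF m; apply: (@polyfun_ext _ _ (fun v => \sum_(i <- r) (F i v)@_m)).
  by move=> v; rewrite raddf_sum.
by apply: polyfun_sum => i; apply: hF.
Qed.

Lemma polyfamilyM F G : polyfamily F -> polyfamily G -> polyfamily (fun v => F v * G v).
Proof.
move=> hF hG m.
pose T := ('X_{1..n < (mdeg m).+1, (mdeg m).+1})%type.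
apply: (@polyfun_ext _ _ (fun v => \sum_(k <- index_enum T)
   if m == (k.1 + k.2)%MM then (F v)@_k.1 * (G v)@_k.2 else 0)).
  by move=> v; rewrite mcoeffM [RHS]big_mkcond.
apply: polyfun_sum => k; case: eqP => _; last exact: polyfun_cst.
by apply: polyfunM.
Qed.

Lemma polyfamily_prod I (r : seq I) (F : I -> V -> {mpoly K[n]}) (e : I -> nat) :
  (forall i, polyfamily (F i)) -> polyfamily (fun v => \prod_(i <- r) F i v ^+ e i).
Proof.
move=> hF.
have hX i k : polyfamily (fun v => F i v ^+ k).
  elim: k => [|k IH]; first exact: polyfamily_cst.
  have := polyfamilyM (hF i) IH; congr polyfamily; apply/funext => v.
  by rewrite exprS.
elim: r => [|i r IH].
  have := polyfamily_cst 1; congr polyfamily; apply/funext => v.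
  by rewrite big_nil.
have := polyfamilyM (hX i (e i)) IH; congr polyfamily; apply/funext => v.
by rewrite big_cons.
Qed.
End PolynomialFamilies.

Section FormComponents.
Variables (K : closedFieldType) (n d : nat).
Local Notation V := (dhomog n.+1 K d).

Definition to_form (p : {mpoly K[n.+1]}) : V := DHomog (pihomogP mdeg d p).

Lemma to_form_is_linear : linear to_form.
Proof. by move=> a p q; apply: val_inj; exact: linearP. Qed.
HB.instance Definition _ :=
  GRing.isLinear.Build K {mpoly K[n.+1]} V _ to_form to_form_is_linear.

Lemma to_formK (Q : V) : to_form (mpoly_of_dhomog Q) = Q.
Proof. by apply: val_inj; rewrite /= pihomog_dE // dhomog_is_dhomog. Qed.

Lemma polyfun_coord_family (W : vectType K) (F : W -> V) i :
  polyfamily (fun v => mpoly_of_dhomog (F v)) ->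
  polyfun (fun v => coord (vbasis {:V}) i (F v)).
Proof.
move=> hF; pose T := 'X_{1..n.+1 < d.+1}.
apply: (@polyfun_ext _ _ (fun v => \sum_(m <- index_enum T)
  (mpoly_of_dhomog (F v))@_m * coord (vbasis {:V}) i (to_form 'X_[m]))).
  move=> v; rewrite -[in RHS](to_formK (F v)).
  rewrite {2}[mpoly_of_dhomog (F v)](@mpolywE _ _ d.+1) //; last first.
    rewrite msizeE; apply/bigmax_leqP_seq => m mF _.
    by have /= -> := dhomog_mf (dhomog_is_dhomog (F v)) mF.
  by rewrite !linear_sum; apply: eq_bigr => m _; rewrite !linearZ.
by apply: polyfun_sum => m; apply: polyfunM; [exact: hF|exact: polyfun_cst].
Qed.

Lemma polyfun_entry (i j : 'I_n.+1) : polyfun (fun g : 'M[K]_n.+1 => g i j).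
Proof.
exists (\sum_(l < \dim {:'M[K]_n.+1}) (vbasis {:'M[K]_n.+1})`_l i j *: 'X_l) => g.
rewrite /evalp raddf_sum /= {1}(coord_vbasis (memvf g)) summxE.
by apply: eq_bigr => l _; rewrite !mxE mevalZ mevalXU mulrC.
Qed.

Lemma polyfun_coord_precomp (Q : V) i :
  polyfun (fun g : 'M[K]_n.+1 => coord (vbasis {:V}) i (precomp g Q)).
Proof.
apply: polyfun_coord_family => /=.
have -> : (fun g : 'M[K]_n.+1 => mpoly_of_dhomog Q \mPo linear_subst g) =
  (fun g => \sum_(m <- msupp (mpoly_of_dhomog Q)) ((mpoly_of_dhomog Q)@_m)%:MP *
     \prod_(i <- index_enum 'I_n.+1)
       (\sum_(j <- index_enum 'I_n.+1) g i j *: 'X_j) ^+ m i).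
  apply/funext => g; rewrite comp_mpolyEX; apply: eq_bigr => m _.
  rewrite mul_mpolyC comp_mpolyX; congr (_ *: _); apply: eq_bigr => k _.
  by rewrite tnth_map tnth_ord_tuple.
apply: polyfamily_sum => m; apply: polyfamilyM; first exact: polyfamily_cst.
apply: polyfamily_prod => k; apply: polyfamily_sum => j.
by apply: polyfamilyZ; apply: polyfun_entry.
Qed.
End FormComponents.

Section Dual.
Variables (K : closedFieldType) (n d : nat).
Local Notation V := (dhomog n.+1 K d).
Local Notation N := (\dim {:V}).
Local Notation e := (vbasis {:V}).

(** A functional on the space of forms is identified with the column of its
    values at the basis [e]. *)
Definition dual_rep (g : 'M[K]_n.+1) : 'M[K]_N :=
  \matrix_(i, j) coord e j (precomp g e`_i).

Definition pairing (Q : V) (v : 'cV[K]_N) : K := \sum_i coord e i Q * v i 0.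

Lemma pairing_basis (i : 'I_N) v : pairing e`_i v = v i 0.
Proof.
rewrite /pairing (bigD1 i) //= coord_free ?eqxx ?mul1r; last first.
  exact: basis_free (vbasisP _).
rewrite big1 ?addr0 // => j ji; rewrite coord_free; last first.
  exact: basis_free (vbasisP _).
by rewrite (negbTE (_ : i != j)) ?mul0r // eq_sym.
Qed.

Lemma pairing_linearl v : linear (fun Q => pairing Q v : K^o).
Proof.
move=> a Q R; rewrite /pairing /= scaler_sumr -big_split; apply: eq_bigr => i _.
by rewrite linearP /= mulrDl -mulrA.
Qed.

Lemma pairing_linearr Q : linear (fun v => pairing Q v : K^o).
Proof.
move=> a u v; rewrite /pairing /= scaler_sumr -big_split; apply: eq_bigr => i _.
by rewrite !mxE mulrDr mulrCA.
Qed.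

Lemma pairing_ext u v : (forall Q, pairing Q u = pairing Q v) -> u = v.
Proof. by move=> uv; apply/colP => i; rewrite -!pairing_basis uv. Qed.

Lemma pairing_precomp g Q v : pairing (precomp g Q) v = pairing Q (dual_rep g *m v).
Proof.
rewrite /pairing {1}(coord_vbasis (memvf Q)) linear_sum.
under eq_bigr => i _ do rewrite linear_sum /= mulr_suml.
rewrite exchange_big; apply: eq_bigr => j _; rewrite mxE mulr_sumr.
by apply: eq_bigr => i _; rewrite mxE !linearZ /= mulrA.
Qed.

Lemma dual_rep1 : dual_rep 1%:M = 1%:M.
Proof.
apply/matrixP => i j; rewrite !mxE precomp1 coord_free // .
exact: basis_free (vbasisP _).
Qed.

Lemma mulmx_inj (A B : 'M[K]_N) : (forall v : 'cV[K]_N, A *m v = B *m v) -> A = B.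
Proof.
move=> AB; apply/matrixP => i j.
by have := AB (delta_mx j 0); rewrite -!colE => /colP/(_ i); rewrite !mxE.
Qed.

Lemma dual_repM g h : dual_rep (g *m h) = dual_rep g *m dual_rep h.
Proof.
apply: mulmx_inj => v; apply: pairing_ext => Q.
by rewrite -pairing_precomp precompM !pairing_precomp mulmxA.
Qed.

Lemma rational_dual_rep : rational_rep (@GL K n.+1) dual_rep.
Proof.
split; [exact: dual_rep1|by move=> g h _ _; exact: dual_repM|move=> i j].
have := @regular_polyfun _ _ (@GL K n.+1) _ (polyfun_coord_precomp e`_i j).
by congr regular_fun; apply/funext => g; rewrite mxE.
Qed.
End Dual.

Section Irreducibility.
Variables (K : numClosedFieldType) (d : nat).
Local Notation V := (dhomog 3 K d).
Local Notation N := (\dim {:V}).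

(** Kronecker's substitution [(t, t^b, t^(b^2))], with [b > d], maps distinct
    monomials of degree [d] to distinct powers of [t]. *)
Lemma form_nonroot (Q : V) : Q != 0 -> exists v : 'cV[K]_3, eval_at Q v != 0.
Proof.
move=> Q0; pose b := d.+1.
pose r : {poly K} := \sum_(m <- msupp (mpoly_of_dhomog Q))
  (mpoly_of_dhomog Q)@_m *: 'X^(m o0 + b * (m o1 + b * m o2)).
have rE t : r.[t] = eval_at Q (vec3 t (t ^+ b) (t ^+ (b * b))).
  rewrite /r eval_at_meval mevalE horner_sum; apply: eq_bigr => m _.
  rewrite hornerZ hornerXn !big_ord_recl big_ord0 !mxE /= mulr1; congr (_ * _).
  by rewrite -!exprM -!exprD; congr (_ ^+ _); rewrite mulnDr mulnA.
have Q0' : mpoly_of_dhomog Q != 0 by apply: contra_neq Q0 => h; apply: val_inj.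
pose m0 := mlead (mpoly_of_dhomog Q).
have m0Q : m0 \in msupp (mpoly_of_dhomog Q) by apply: mlead_supp.
have lt_b m (i : 'I_3) : m \in msupp (mpoly_of_dhomog Q) -> (m i < b)%N.
  move=> mQ; rewrite ltnS -(dhomog_mf (dhomog_is_dhomog Q) mQ) /= mdegE.
  by rewrite (bigD1 i) //= leq_addr.
have r0 : r != 0.
  apply: contraTneq m0Q => rz; rewrite mcoeff_msupp negbK.
  have := congr1 (fun p : {poly K} => p`_(m0 o0 + b * (m0 o1 + b * m0 o2))) rz.
  rewrite /r coef_sum (bigD1_seq m0) ?msupp_uniq //=; last exact: mlead_supp.
  rewrite coefZ coefXn eqxx mulr1 coef0 big1_seq ?addr0 => [->//|m /andP [mm0 mQ]].
  rewrite coefZ coefXn; case: eqP => [E|_]; last by rewrite mulr0.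
  case/eqP: mm0; have m0Q' := mlead_supp Q0'.
  have E0 : m0 o0 = m o0.
    have := congr1 (modn^~ b) E; rewrite ![(_ + b * _)%N]addnC ![(b * _)%N]mulnC.
    by rewrite !modnMDl !modn_small ?lt_b.
  move: E; rewrite E0 => /addnI/eqP; rewrite eqn_pmul2l // => /eqP E.
  have E1 : m0 o1 = m o1.
    have := congr1 (modn^~ b) E; rewrite ![(_ + b * _)%N]addnC ![(b * _)%N]mulnC.
    by rewrite !modnMDl !modn_small ?lt_b.
  move: E; rewrite E1 => /addnI/eqP; rewrite eqn_pmul2l // => /eqP E2.
  by apply/mnmP => i; case: (ord3_cases i) => ->.
have [t] := closed_field_nonroot r0; rewrite rE => Qt.
by exists (vec3 t (t ^+ b) (t ^+ (b * b))).
Qed.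

(** The coefficients of a polynomial in [t] that vanishes identically are zero,
    and binomial coefficients are invertible in characteristic 0. *)
Lemma linear_binomial (l : {linear {mpoly K[3]} -> K^o}) (A B D : {mpoly K[3]}) p :
  (forall t, l ((A + t *: B) ^+ p * D) = 0) ->
  forall k, (k <= p)%N -> l (A ^+ (p - k) * B ^+ k * D) = 0.
Proof.
move=> h k kp.
pose r : {poly K} := \poly_(i < p.+1) (l (A ^+ (p - i) * B ^+ i * D) *+ 'C(p, i)).
have : r = 0.
  apply/eqP; apply: contraT => /closed_field_nonroot [t]; case/eqP.
  rewrite -[RHS](h t) exprDn mulr_suml linear_sum horner_poly.
  apply: eq_bigr => i _; rewrite exprZn.
  have -> : A ^+ (p - i) * (t ^+ i *: B ^+ i) *+ 'C(p, i) * D =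
      (t ^+ i *: (A ^+ (p - i) * B ^+ i * D)) *+ 'C(p, i).
    by rewrite mulrnAl -scalerAr -scalerAl.
  by rewrite linearMn linearZ /= mulrnAl; congr (_ *+ _); exact: mulrC.
move/(congr1 (fun q : {poly K} => q`_k)); rewrite coef_poly ltnS kp coef0 => /eqP.
by rewrite mulrn_eq0 -leqn0 leqNgt bin_gt0 kp => /eqP.
Qed.

(** Powers of linear forms span the space of forms: [linear_binomial], applied
    first to the third variable and then to the second one, extracts every
    monomial from the powers of [x + t y + s z]. *)
Lemma power_span (l : {linear V -> K^o}) :
  (forall a b c, l (@to_form K 2 d ((a *: 'X_o0 + b *: 'X_o1 + c *: 'X_o2) ^+ d)) = 0) ->
  forall Q, l Q = 0.
Proof.
move=> h.
pose l' : {linear {mpoly K[3]} -> K^o} := l \o @to_form K 2 d.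
have mon i j k : (i + j + k = d)%N -> l' ('X_o0 ^+ i * 'X_o1 ^+ j * 'X_o2 ^+ k) = 0.
  move=> ijk.
  have step1 t s : l' (('X_o0 + t *: 'X_o1 + s *: 'X_o2) ^+ d * 1) = 0.
    by rewrite mulr1 /=; have := h 1 t s; rewrite scale1r.
  have step2 t : l' (('X_o0 + t *: 'X_o1) ^+ (i + j) * 'X_o2 ^+ k) = 0.
    have kd : (k <= d)%N by rewrite -ijk leq_addl.
    have := linear_binomial (step1 t) kd.
    by rewrite mulr1 -ijk addnK.
  have := linear_binomial step2 (leq_addl i j).
  by rewrite addnK.
move=> Q; rewrite -(to_formK Q) -[l _]/(l' _) [mpoly_of_dhomog Q]mpolyE big_seq linear_sum.
rewrite big1 // => m mQ; rewrite linearZ /= mpolyXE_id !big_ord_recl big_ord0 mulr1.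
have := mon (m o0) (m o1) (m o2); rewrite /= mulrA => ->; first by rewrite scaler0.
have /= <- := dhomog_mf (dhomog_is_dhomog Q) mQ.
by rewrite mdegE !big_ord_recl big_ord0 addn0 addnA.
Qed.

(** The matrix [w *m xi] maps a vector [x] to [(xi x) w], so the value of [Q]
    there is the value at [x] of a power of the linear form [xi], up to a constant
    factor. *)
Lemma precomp_rank1 (Q : V) (w : 'cV[K]_3) (xi : 'rV[K]_3) :
  precomp (w *m xi) Q = eval_at Q w *: @to_form K 2 d ((\sum_j xi 0 j *: 'X_j) ^+ d).
Proof.
set L := \sum_j _; have LH : L ^+ d \is d.-homog.
  rewrite -[X in X.-homog]mul1n; apply: dhomogMn; apply: rpred_sum => j _.
  by rewrite dhomogZ // dhomogX /= mdeg1.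
apply: val_inj; rewrite /= (pihomog_dE LH) comp_mpolyEX eval_at_meval mevalE scaler_suml.
rewrite big_seq [RHS]big_seq; apply: eq_bigr => m mQ.
rewrite -scalerA comp_mpolyX; congr (_ *: _).
rewrite -(dhomog_mf (dhomog_is_dhomog Q) mQ) /= mdegE -prodrXr -scaler_prod.
apply: eq_bigr => i _; rewrite tnth_map tnth_ord_tuple -exprZn; congr (_ ^+ _).
rewrite scaler_sumr; apply: eq_bigr => j _.
by rewrite !mxE big_ord_recl big_ord0 addr0 scalerA.
Qed.

Lemma polyfun_pairing_precomp (Q : V) v :
  polyfun (fun g : 'M[K]_3 => pairing (precomp g Q) v).
Proof.
apply: polyfun_sum => i; apply: polyfunM; last exact: polyfun_cst.
exact: polyfun_coord_precomp.
Qed.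

(** Invertible matrices are dense, so [v] also annihilates the forms obtained
    from [Q] by substituting a matrix of rank one, and these span the space of
    forms. *)
Lemma dual_rep_cyclic (Q : V) v : Q != 0 ->
  (forall g, g \in unitmx -> pairing (precomp g Q) v = 0) -> v = 0.
Proof.
move=> Q0 hGL; have hM g : pairing (precomp g Q) v = 0.
  have [r hr] := det_line g (1%:M - g).
  have r0 : r != 0.
    apply/eqP => rz; have := hr 1; rewrite scale1r addrC subrK rz horner0 det1.
    by move/eqP; rewrite oner_eq0.
  have cZ := zclosed_eq (polyfun_pairing_precomp Q v) (polyfun_cst _ 0).
  have := @zclosed_curve _ _ _ _ _ (polycurve_line g (1%:M - g)) cZ r0.
  move=> H; have := H _ 0; rewrite /= scale0r addr0; apply => t.
  by rewrite -hr => rt; apply: hGL; rewrite unitmxE unitfE.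
have [w Qw] := form_nonroot Q0.
pose l : V -> K^o := fun R => pairing R v.
have lin : linear l := @pairing_linearl _ _ _ v.
pose lL : {linear V -> K^o} := HB.pack l (GRing.isLinear.Build _ _ _ _ l lin).
suff l0 : forall R, lL R = 0.
  by apply: pairing_ext => R; rewrite -[LHS]/(lL R) l0 /pairing big1 // => i _; rewrite mxE mulr0.
apply: power_span => a b c.
pose xi : 'rV[K]_3 := \row_j nth 0 [:: a; b; c] j.
have := hM (w *m xi); rewrite precomp_rank1 -[pairing _ _]/(lL _) linearZ /=.
move/eqP; rewrite mulf_eq0 (negbTE Qw) /= => /eqP <-; congr (l (to_form _ (_ ^+ _))).
by rewrite !big_ord_recl big_ord0 !mxE /= addr0 addrA.
Qed.

(** A proper stable subspace is annihilated by a nonzero form, hence by all its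
    translates, and is zero by [dual_rep_cyclic]. *)
Lemma irreducible_dual_rep : irreducible_rep (@GL K 3) (@dual_rep K 2 d).
Proof.
pose X : V := @to_form K 2 d ('X_o0 ^+ d).
have evX : eval_at X (vec3 1 0 0) = 1.
  rewrite eval_at_meval /= pihomog_dE; last first.
    by rewrite -[X in X.-homog]mul1n; apply: dhomogMn; rewrite dhomogX /= mdeg1.
  by rewrite rmorphXn /= mevalXU mxE expr1n.
split.
  rewrite lt0n dimv_eq0; apply/eqP => V0.
  have : X \in {:V}%VS by rewrite memvf.
  rewrite V0 memv0 => /eqP X0; move/eqP: evX; rewrite X0 eval_at_meval /= meval0.
  by rewrite eq_sym oner_eq0.
move=> U Ust; have [->|Un] := eqVneq U fullv; [by right|left].
have [u0 u0U] : exists u0, u0 \notin U.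
  apply: contrapT => h; case/eqP: Un; apply/eqP; rewrite eqEsubv subvf.
  by apply/subvP => u _; apply/negPn/negP => uU; apply: h; exists u.
pose f u := u - projv U u.
have [i fi] : exists i, f u0 i 0 != 0.
  apply: contrapT => h; case/negP: u0U; rewrite -[u0](subrK (projv U u0)).
  rewrite (_ : u0 - _ = 0) ?add0r ?memv_proj //; apply/colP => i; rewrite [RHS]mxE.
  by apply/eqP/negPn/negP => hi; apply: h; exists i.
(* The form representing the functional [u |-> f u i 0], which kills [U]. *)
pose Q : V := \sum_j f (delta_mx j 0) i 0 *: (vbasis {:V})`_j.
have pQ u : pairing Q u = f u i 0.
  rewrite -[LHS]/((fun R => pairing R u : K^o) Q).
  have lin := @pairing_linearl K 2 d u.
  pose lL : {linear V -> K^o} := HB.pack (fun R : V => pairing R u : K^o)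
    (GRing.isLinear.Build _ _ _ _ _ lin).
  rewrite -[LHS]/(lL Q) linear_sum.
  transitivity (\sum_j (u j 0 *: f (delta_mx j 0)) i 0).
    by apply: eq_bigr => j _; rewrite linearZ /= pairing_basis [RHS]mxE mulrC.
  rewrite -summxE; congr (fun_of_matrix _ i 0); rewrite /f.
  have uE : u = \sum_j u j 0 *: delta_mx j 0.
    rewrite {1}[u]matrix_sum_delta; apply: eq_bigr => j _.
    by rewrite big_ord_recl big_ord0 addr0 ord1.
  rewrite [in RHS]uE linear_sum -sumrB; apply: eq_bigr => j _.
  by rewrite linearZ scalerBr.
have Q0 : Q != 0.
  by apply: contraNneq fi => Q0; rewrite -pQ Q0 /pairing big1 // => j _; rewrite linear0 mul0r.
apply/eqP; rewrite -subv0; apply/subvP => u uU; rewrite memv0; apply/eqP.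
apply: (dual_rep_cyclic Q0) => g ug.
by rewrite pairing_precomp pQ /f projv_id ?subrr ?mxE //; exact: Ust.
Qed.

(** The highest weight of the symmetric power of degree [d] of the standard
    representation, which is dual to the space of forms. *)
Definition row_weight (i : 'I_3) : int := if i == o0 then d%:Z else 0.

Lemma row_weight_dominant : dominant row_weight /\ forall i, 0 <= row_weight i.
Proof.
split=> [i j ij|i]; rewrite /row_weight; last by case: ifP.
by case: (ord3_cases i) ij => ->; case: (ord3_cases j) => ->.
Qed.

(** In terms of the symmetric power dual to the forms, the power [w^d]. *)
Definition eval_vec (w : 'cV[K]_3) : 'cV[K]_N := \col_i eval_at ((vbasis {:V})`_i : V) w.

Lemma pairing_eval_vec (Q : V) w : pairing Q (eval_vec w) = eval_at Q w.
Proof.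
rewrite /pairing {2}(coord_vbasis (memvf Q)) eval_at_meval.
rewrite (raddf_sum (@mpoly_of_dhomog 3 K d)) raddf_sum /=.
by apply: eq_bigr => i _; rewrite mxE mevalZ eval_at_meval.
Qed.

Lemma dual_rep_eval_vec g w : dual_rep d g *m eval_vec w = eval_vec (g *m w).
Proof.
apply: pairing_ext => Q.
by rewrite -pairing_precomp !pairing_eval_vec eval_at_precomp.
Qed.

Lemma eval_atZ (Q : V) (a : K) w : eval_at Q (a *: w) = a ^+ d * eval_at Q w.
Proof.
rewrite !eval_at_meval !mevalE mulr_sumr big_seq [RHS]big_seq; apply: eq_bigr => m mQ.
have -> : a ^+ d = \prod_i a ^+ m i.
  by rewrite prodrXr -mdegE; have /= -> := dhomog_mf (dhomog_is_dhomog Q) mQ.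
rewrite mulrCA -big_split.
by congr (_ * _); apply: eq_bigr => i _; rewrite mxE exprMn.
Qed.

(** Evaluation at the first basis vector is a highest weight vector: an upper
    triangular matrix multiplies that basis vector by its first diagonal entry. *)
Lemma dual_rep_Vlambda : is_Vlambda row_weight (@dual_rep K 2 d).
Proof.
split; [exact: rational_dual_rep|exact: irreducible_dual_rep|].
exists (eval_vec (vec3 1 0 0)).
  apply/eqP => e0; pose X : V := @to_form K 2 d ('X_o0 ^+ d).
  have : pairing X (eval_vec (vec3 1 0 0)) = 1.
    rewrite pairing_eval_vec eval_at_meval /= pihomog_dE; last first.
      by rewrite -[X in X.-homog]mul1n; apply: dhomogMn; rewrite dhomogX /= mdeg1.
    by rewrite rmorphXn /= mevalXU mxE expr1n.
  rewrite e0 /pairing big1 => [/eqP|i _]; last by rewrite mxE mulr0.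
  by rewrite eq_sym oner_eq0.
move=> b _ /is_trig_mxP hb; rewrite dual_rep_eval_vec.
have -> : b *m vec3 1 0 0 = b o0 o0 *: vec3 1 0 0.
  apply/colP => i; rewrite !mxE !big_ord_recl big_ord0 !mxE /= !mulr0 !mulr1 !addr0.
  have b10 : b o1 o0 = 0 by have := hb o0 o1 isT; rewrite mxE.
  have b20 : b o2 o0 = 0 by have := hb o0 o2 isT; rewrite mxE.
  by case: (ord3_cases i) => ->; rewrite /= ?b10 ?b20 ?mulr1 ?mulr0.
apply: pairing_ext => Q.
have lin := @pairing_linearr K 2 d Q.
pose lL : {linear 'cV[K]_N -> K^o} := HB.pack
  (fun v => pairing Q v : K^o) (GRing.isLinear.Build _ _ _ _ _ lin).
rewrite -[RHS]/(lL _) linearZ /= !pairing_eval_vec eval_atZ; congr (_ * _).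
by rewrite !big_ord_recl big_ord0 /row_weight /= !mulr1.
Qed.
End Irreducibility.

(** * Values of regular functions *)

Section Values.
Variables (K : closedFieldType) (V : vectType K).
Implicit Types (S U : set V) (F : V -> K).

Definition pt S (v : V) (h : S v) : S := SigSub (mem_set h).

(** The extension by zero allows computations at points without proofs of
    membership. *)
Definition value S (f : regfun S) (v : V) : K :=
  if pselect (S v) is left h then f (pt h) else 0.

Lemma value_val S (f : regfun S) (x : S) : value f (val x) = f x.
Proof.
rewrite /value; case: pselect => [h|]; last by case; exact: set_valP.
by congr (regfun_val f _); apply: val_inj.
Qed.

Lemma value_ext S (f g : regfun S) : (forall v, S v -> value f v = value g v) -> f = g.
Proof.
move=> fg; apply: val_inj; apply/funext => x /=.
by rewrite -!value_val fg //; exact: set_valP.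
Qed.

Definition regular_on S F := forall x, S x -> exists U p q,
  [/\ zopen U, U x &
      forall y, S y -> U y -> evalp q y != 0 /\ F y = evalp p y / evalp q y].

Lemma regular_value S (f : regfun S) : regular_on S (value f).
Proof.
move=> x Sx; have /asboolP/(_ (pt Sx)) [U [p [q [oU Ux H]]]] := valP f.
exists U, p, q; split=> // y Sy Uy.
have [q0 e] := H (pt Sy) Uy; split=> //.
by rewrite -[RHS]e; exact: (value_val f (pt Sy)).
Qed.

Lemma regular_on_subproof S F : regular_on S F ->
  ((fun x : S => F (val x)) : S -> K^o) \in @regular_pred K V S.
Proof.
move=> rF; apply/asboolP => x; have [U [p [q [oU Ux H]]]] := rF _ (set_valP x).
by exists U, p, q; split=> // y; apply: H; exact: set_valP.
Qed.

Definition mkreg S F (rF : regular_on S F) : regfun S := Regfun (regular_on_subproof rF).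

Lemma value_mkreg S F (rF : regular_on S F) v : S v -> value (mkreg rF) v = F v.
Proof. by rewrite /value; case: pselect. Qed.

Lemma value0 S v : value (0 : regfun S) v = 0.
Proof. by rewrite /value; case: pselect. Qed.

Lemma valueD S (f g : regfun S) v : value (f + g) v = value f v + value g v.
Proof. by rewrite /value; case: pselect => //; rewrite addr0. Qed.

Lemma valueM S (f g : regfun S) v : value (f * g) v = value f v * value g v.
Proof. by rewrite /value; case: pselect => //; rewrite mulr0. Qed.

Lemma valueZ S a (f : regfun S) v : value (a *: f) v = a * value f v.
Proof. by rewrite /value; case: pselect => //; rewrite mulr0. Qed.

Lemma valueN S (f : regfun S) v : value (- f) v = - value f v.
Proof. by rewrite -scaleN1r valueZ mulN1r. Qed.

Lemma value1 S v : S v -> value (1 : regfun S) v = 1.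
Proof. by rewrite /value; case: pselect. Qed.

Lemma value_sum S I (r : seq I) (f : I -> regfun S) v :
  value (\sum_(i <- r) f i) v = \sum_(i <- r) value (f i) v.
Proof.
elim: r => [|i r IH]; first by rewrite !big_nil value0.
by rewrite !big_cons valueD IH.
Qed.

Lemma valueX S (f : regfun S) k v : S v -> value (f ^+ k) v = value f v ^+ k.
Proof.
move=> Sv; elim: k => [|k IH]; first by rewrite !expr0 value1.
by rewrite !exprS valueM IH.
Qed.

Lemma value_pullback S (phi : {linear V -> V}) (phiS : forall x, S x -> S (phi x))
  (f : regfun S) v : S v -> value (pullback phiS f) v = value f (phi v).
Proof.
move=> Sv; rewrite -[v in LHS]/(val (pt Sv)) value_val /= -value_val.
by [].
Qed.

Lemma regular_on_polyfun S F G : polyfun F -> polyfun G ->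
  (forall v, S v -> G v != 0) -> regular_on S (fun v => F v / G v).
Proof.
move=> [p hp] [q hq] G0 x Sx; exists setT, p, q; split=> //; first exact: zopenT.
by move=> y Sy _; rewrite -hp -hq; split=> //; exact: G0.
Qed.

(** Around a point of the closure, [f] is a quotient whose numerator vanishes at
    the points of [S] nearby, hence at this point. *)
Lemma regfun_dense_eq0 S (f : regfun (zclosure S)) :
  (forall v, S v -> value f v = 0) -> f = 0.
Proof.
move=> f0; apply: value_ext => x Sx; rewrite value0.
have [U [p [q [oU Ux H]]]] := regular_value f Sx.
have [_ ->] := H x Sx Ux; suff -> : evalp p x = 0 by rewrite mul0r.
have cZ : zclosed ([set v | evalp p v = 0] `|` ~` U).
  apply: zclosedU => //; apply: zclosed_eq; last exact: polyfun_cst.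
  by exists p.
suff SZ : S `<=` [set v | evalp p v = 0] `|` ~` U.
  by have [|nU] := zclosure_min cZ SZ Sx; last by case: nU.
move=> v Sv; have [Uv|] := pselect (U v); [left|by right].
have [q0] := H v (zclosure_sub Sv) Uv; rewrite f0 // => /esym/eqP.
by rewrite mulf_eq0 invr_eq0 (negbTE q0) orbF => /eqP.
Qed.

(** Around [c t0], the function is a quotient of polynomials on a basic open set,
    and these polynomials are polynomial in [t] along the curve. *)
Lemma regular_curve S F (c : K -> V) t0 : regular_on S F -> polycurve c ->
  (forall t, S (c t)) -> exists r s : {poly K}, s.[t0] != 0 /\
    forall t, s.[t] != 0 -> F (c t) * s.[t] = r.[t].
Proof.
move=> rF hc Sc; have [U [p [q [[G GE] Ux H]]]] := rF _ (Sc t0).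
have : ~ (~` U) (c t0) by apply.
rewrite GE => /existsNP [u /not_implyP [Gu /eqP nu]].
have [r1 h1] := hc _ (ex_intro _ u (fun=> erefl)).
have [r2 h2] := hc _ (ex_intro _ p (fun=> erefl)).
have [r3 h3] := hc _ (ex_intro _ q (fun=> erefl)).
exists (r1 * r2), (r1 * r3); rewrite hornerM mulf_neq0 -?h1 -?h3 //; last first.
  by have [] := H _ (Sc t0) Ux.
split=> // t; rewrite !hornerM mulf_eq0 negb_or -h1 -h2 -h3 => /andP [ut _].
have Ut : U (c t).
  apply: contrapT => nU; have : (~` U) (c t) by [].
  by rewrite GE => /(_ u Gu) /eqP; rewrite (negbTE ut).
have [q0 ->] := H _ (Sc t) Ut.
by rewrite mulrCA divfK.
Qed.
End Values.

(** * Equivariant rational functions are regular on the orbit *)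

Section FunctionFieldMaps.
Variables (K : closedFieldType) (V : vectType K) (X : irred_set V).
Local Notation inF := (@tofrac (regfun X)).

Lemma ff_scaleE (c : K) (z : function_field X) : c *: z = inF (c *: 1) * z.
Proof. by []. Qed.

Lemma tofracZ (c : K) (f : regfun X) : inF (c *: f) = c *: (inF f : function_field X).
Proof. by rewrite ff_scaleE -tofracM -scalerAl mul1r. Qed.

Lemma ff_fraction (z : function_field X) : exists a b : regfun X,
  b != 0 /\ z = inF a / inF b.
Proof.
exists (frac (repr z)).1, (frac (repr z)).2; have b0 := denom_ratioP (repr z).
by split=> //; rewrite -tofrac_repr mulfK // tofrac_eq0.
Qed.

(** The denominators of the images of a basis suffice. *)
Lemma common_denominator N (h : 'cV[K]_N -> function_field X) : linear h ->
  exists b : regfun X, exists a : 'cV[K]_N -> regfun X,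
    [/\ b != 0, linear a & forall v, h v = inF (a v) / inF b].
Proof.
move=> hlin.
have /choice [num /choice [den hnd]] : forall i : 'I_N, exists a : regfun X, exists b : regfun X,
    b != 0 /\ h (delta_mx i 0) = inF a / inF b.
  by move=> i; exact: ff_fraction.
pose b := \prod_i den i; pose e i := num i * \prod_(j | j != i) den j.
have b0 : b != 0 by apply/prodf_neq0 => i _; have [] := hnd i.
have he i : h (delta_mx i 0) = inF (e i) / inF b.
  have [di0 ->] := hnd i; apply/eqP; rewrite eqr_div ?tofrac_eq0 //.
  by rewrite -!tofracM /b (bigD1 i) //= /e mulrA mulrAC [_ * den i]mulrAC.
exists b, (fun v : 'cV[K]_N => \sum_i v i 0 *: e i); split=> //.
  move=> c u v; rewrite scaler_sumr -big_split; apply: eq_bigr => i _.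
  by rewrite !mxE scalerDl scalerA.
move=> v; pose hL : {linear 'cV[K]_N -> function_field X} :=
  HB.pack h (GRing.isLinear.Build _ _ _ _ h hlin).
have vE : v = \sum_j v j 0 *: delta_mx j 0.
  rewrite {1}[v]matrix_sum_delta; apply: eq_bigr => j _.
  by rewrite big_ord_recl big_ord0 addr0 ord1.
rewrite {1}vE -[LHS]/(hL _) linear_sum raddf_sum mulr_suml; apply: eq_bigr => i _.
rewrite linearZ /= he; rewrite !ff_scaleE mulrA -tofracM.
by rewrite -scalerAl mul1r.
Qed.

(** A rational function on [X] and a function on [S] have different domains, so
    they are compared through their values, multiplied by the denominator. *)
Definition agree (S : set V) (z : function_field X) (f : regfun S) :=
  exists a b : regfun X, [/\ b != 0, z = inF a / inF b &
    forall x, S x -> value f x * value b x = value a x].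

End FunctionFieldMaps.

Section OrbitFunctions.
Variables (K : closedFieldType) (n d : nat) (P : dhomog n.+1 K d).
Local Notation V := (dhomog n.+1 K d).
Local Notation GLn := (@GL K n.+1).
Local Notation Om := (Defs.orbit P).
Local Notation X := (orbit_closure_irred P).
Local Notation inF := (@tofrac (regfun X)).

Lemma orbit_sub_closure : Om `<=` orbit_closure P.
Proof. exact: zclosure_sub. Qed.

Definition GL_pt (g : 'M[K]_n.+1) (ug : g \in unitmx) : GLn := SigSub (mem_set (ug : GLn g)).

Lemma glP (g : GLn) : val g \in unitmx.
Proof. exact: set_valP g. Qed.

Lemma value_closure_act (g : GLn) (f : regfun X) v : orbit_closure P v ->
  value (orbit_closure_act g f) v = value f (precomp (val g) v).
Proof. exact: value_pullback. Qed.

Lemma value_orbit_act (g : GLn) (f : regfun Om) v : Om v ->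
  value (orbit_act P g f) v = value f (precomp (val g) v).
Proof. exact: value_pullback. Qed.

Lemma restrict_subproof (f : regfun X) : regular_on Om (value f).
Proof.
move=> x Ox; have [U [p [q [oU Ux H]]]] := regular_value f (orbit_sub_closure Ox).
by exists U, p, q; split=> // y /orbit_sub_closure; exact: H.
Qed.

Definition restrict (f : regfun X) : regfun Om := mkreg (restrict_subproof f).

Lemma value_restrict f v : Om v -> value (restrict f) v = value f v.
Proof. exact: value_mkreg. Qed.

Lemma regfun_closure_eq0 (f : regfun X) : (forall v, Om v -> value f v = 0) -> f = 0.
Proof. exact: (@regfun_dense_eq0 _ _ Om). Qed.

(** The orbit is irreducible, so its regular functions form a domain. *)
Lemma orbit_cancel (f : regfun Om) (b : regfun X) : b != 0 ->
  (forall x, Om x -> value f x * value b x = 0) -> f = 0.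
Proof.
move=> b0 fb; pose Y : irred_set V := IrredSet (orbit_irreducible P).
have : (f : regfun Y) * (restrict b : regfun Y) = 0.
  by apply: value_ext => v Ov; rewrite valueM value0 -(fb v Ov) value_restrict.
move/eqP; rewrite mulf_eq0 => /orP [/eqP //|/eqP rb0].
case/eqP: b0; apply: regfun_closure_eq0 => v Ov.
by rewrite -value_restrict // rb0 value0.
Qed.

Local Notation agree := (@agree _ _ X Om).

Lemma agree_lin c z z' f f' : agree z f -> agree z' f' -> agree (c *: z + z') (c *: f + f').
Proof.
move=> [a [b [b0 -> H]]] [a' [b' [b'0 -> H']]].
exists (c *: a * b' + a' * b), (b * b'); split; first by rewrite mulf_neq0.
  rewrite tofracD !tofracM tofracZ -addf_div ?tofrac_eq0 //.
  by rewrite !ff_scaleE mulrA.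
move=> x Ox; rewrite !valueD !valueM !valueZ -H // -H' //.
by move: (value f x) (value f' x) (value b x) (value b' x) => t u v w; ring.
Qed.

(** The comparison does not depend on the fraction that represents [z]. *)
Lemma agree_value z f a b : agree z f -> b != 0 -> z = inF a / inF b ->
  forall x, Om x -> value f x * value b x = value a x.
Proof.
move=> [a' [b' [b'0 -> H]]] b0 /eqP.
rewrite eqr_div ?tofrac_eq0 // -!tofracM tofrac_eq => /eqP E.
have : f * restrict b - restrict a = 0.
  apply: (orbit_cancel b'0) => x Ox.
  have := congr1 (fun h => value h x) E; rewrite !valueM => {}E.
  rewrite valueD valueN valueM !value_restrict // mulrBl -E -H //.
  by apply/eqP; rewrite subr_eq0 mulrAC.
move/eqP; rewrite subr_eq0 => /eqP E' x Ox.
by rewrite -[value b x]value_restrict // -valueM E' value_restrict.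
Qed.

Lemma agree_0r z : agree z 0 -> z = 0.
Proof.
move=> [a [b [b0 -> H]]]; rewrite (_ : a = 0) ?tofrac0 ?mul0r //.
by apply: regfun_closure_eq0 => x Ox; rewrite -H // value0 mul0r.
Qed.

Lemma agree_uniq z f f' : agree z f -> agree z f' -> f = f'.
Proof.
move=> [a [b [b0 zE H]]] zf'; have H' := agree_value zf' b0 zE.
apply/eqP; rewrite -subr_eq0; apply/eqP; apply: (orbit_cancel b0) => x Ox.
by rewrite valueD valueN mulrBl H // H' // subrr.
Qed.

Section Extension.
Variables (N : nat) (rho : 'M[K]_n.+1 -> 'M[K]_N).
Hypothesis rho1 : rho 1%:M = 1%:M.
Hypothesis rhoM : forall g h, GLn g -> GLn h -> rho (g *m h) = rho g *m rho h.

Definition equivariant (M : lmodType K) (act : GLn -> M -> M) (h : 'cV[K]_N -> M) :=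
  linear h /\ forall (g : GLn) v, h (rho (val g) *m v) = act g (h v).

(** The orbit contains a point [x1] where the common denominator of the values
    of [h] does not vanish.  Equivariance prescribes the value of [k v] at the
    translate of [x1] by [g]: it is the value at [x1] of [h (rho g *m v)]. *)
Lemma equivariant_extension (h : 'cV[K]_N -> function_field X) :
  equivariant (normalization_act P) h ->
  exists2 k : 'cV[K]_N -> regfun Om, equivariant (orbit_act P) k &
    forall v, agree (h v) (k v).
Proof.
move=> [hlin heq]; have [b [a [b0 alin hab]]] := common_denominator hlin.
(* Equivariance of [h], cleared of denominators. *)
have star (g : GLn) v x : orbit_closure P x ->
    value (a (rho (val g) *m v)) x * value b (precomp (val g) x) =
    value (a v) (precomp (val g) x) * value b x.
  move=> Xx; have gb0 : orbit_closure_act g b != 0.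
    by apply: contra_neq b0 => gb; apply: (@orbit_closure_act_inj _ _ _ P g);
       rewrite gb /orbit_closure_act raddf0.
  have /eqP := heq g v; rewrite !hab normalization_actE // eqr_div ?tofrac_eq0 //.
  rewrite -!tofracM tofrac_eq => /eqP /(congr1 (fun f => value f x)).
  by rewrite !valueM !value_closure_act.
have [x1 [k1 uk1 x1E] bx1] : exists2 x1, Om x1 & value b x1 != 0.
  apply: contrapT => nb; case/eqP: b0; apply: regfun_closure_eq0 => v Ov.
  by apply/eqP/negPn/negP => bv; apply: nb; exists v.
have Ox1 : Om x1 by exists k1.
have Xx1 := orbit_sub_closure Ox1.
have Og g : g \in unitmx -> Om (precomp g x1).
  by move=> ug; exact: (orbit_precomp (GL_pt ug)).
have /choice [G hG] x : exists g, Om x -> g \in unitmx /\ precomp g x1 = x.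
  have [[k uk <-]|nOx] := pselect (Om x); last by exists 0.
  exists (invmx k1 *m k) => _; split; first by rewrite unitmx_mul unitmx_inv uk1.
  by rewrite -x1E -precompM mulKVmx.
have key g g0 v : g \in unitmx -> g0 \in unitmx ->
    value (a (rho g *m v)) x1 * value b (precomp (invmx g0) (precomp g x1)) =
    value (a (rho g0 *m v)) (precomp (invmx g0) (precomp g x1)) * value b x1.
  move=> ug ug0; have ugg : g *m invmx g0 \in unitmx by rewrite unitmx_mul ug unitmx_inv.
  have := star (GL_pt ugg) (rho g0 *m v) x1 Xx1.
  by rewrite /= mulmxA -rhoM // mulmxKV // precompM.
pose F v x := value (a (rho (G x) *m v)) x1 / value b x1.
have Fdef g v : g \in unitmx -> F v (precomp g x1) = value (a (rho g *m v)) x1 / value b x1.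
  move=> ug; have [uG GE] := hG _ (Og _ ug); congr (_ / _).
  have := key _ _ v uG ug; rewrite GE -precompM mulmxV // precomp1.
  by move/(mulIf bx1).
have Fb v x : Om x -> F v x * value b x = value (a v) x.
  move=> Ox; have [uG GE] := hG x Ox; have := key (G x) 1%:M v uG (unitmx1 _ _).
  rewrite invmx1 precomp1 GE rho1 mul1mx => E.
  by rewrite /F mulrAC E mulfK.
(* Around [x0], a fixed translation that maps [x0] to [x1] presents [F v] as a
   quotient of polynomial functions. *)
have Freg v : regular_on Om (F v).
  move=> x0 Ox0; have [ug0 g0E] := hG x0 Ox0; set g0 := G x0 in ug0 g0E.
  pose phi : {linear V -> V} := precomp (invmx g0).
  have phix0 : phi x0 = x1 by rewrite /phi /= -g0E -precompM mulmxV // precomp1.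
  have [U1 [pa [qa [oU1 U1x H1]]]] := regular_value (a (rho g0 *m v)) Xx1.
  have [U2 [pb [qb [oU2 U2x H2]]]] := regular_value b Xx1.
  have [pa' hpa] := evalp_comp phi pa; have [qa' hqa] := evalp_comp phi qa.
  have [pb' hpb] := evalp_comp phi pb; have [qb' hqb] := evalp_comp phi qb.
  exists ([set y | (U1 `&` U2) (phi y)] `&` [set y | evalp pb' y != 0]), (pa' * qb'), (qa' * pb').
  split.
  - by apply: zopenI; [apply: zopen_preim; exact: zopenI|exact: zopen_neq0].
  - split; rewrite /= ?hpb phix0 //.
    by have [q0 E] := H2 _ Xx1 U2x; apply: contraNneq bx1 => p0; rewrite E p0 mul0r.
  move=> y Oy [[U1y U2y] /= pby]; have [uG GE] := hG y Oy.
  have Xphi : orbit_closure P (phi y).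
    have ug0V : invmx g0 \in unitmx by rewrite unitmx_inv.
    exact: (orbit_closure_precomp (GL_pt ug0V) (orbit_sub_closure Oy)).
  have [qa0 Ea] := H1 _ Xphi U1y; have [qb0 Eb] := H2 _ Xphi U2y.
  rewrite /evalp !mevalM -!/(evalp _ _) hpa hqa hqb hpb in pby *.
  split; first by rewrite mulf_neq0.
  have bphi : value b (phi y) != 0 by rewrite Eb mulf_neq0 ?invr_eq0.
  apply: (mulIf bx1); rewrite /F divfK //; apply: (mulIf bphi).
  have := key (G y) g0 v uG ug0; rewrite GE => ->.
  rewrite Ea Eb; move: (evalp pa _) (evalp qa _) qa0 (evalp pb _) pby (evalp qb _) qb0.
  by move: (value b x1) => e u w w0 s s0 t t0; field; rewrite w0 s0 t0.
exists (fun v => mkreg (Freg v)).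
  split=> [c u v|g v]; apply: value_ext => x Ox.
    rewrite valueD valueZ !value_mkreg //; apply: (mulIf bx1).
    rewrite mulrDl -[c * _ * _]mulrA /F !divfK // mulmxDr -scalemxAr alin.
    by rewrite valueD valueZ.
  have [uG GE] := hG x Ox; rewrite (value_orbit_act g) // !value_mkreg //;
    last exact: (orbit_precomp g).
  rewrite -{2}GE -precompM Fdef ?unitmx_mul ?uG ?glP //.
  by rewrite /F rhoM ?mulmxA //; exact: glP.
move=> v; exists (a v), b; split=> // x Ox.
by rewrite value_mkreg // Fb.
Qed.

End Extension.
End OrbitFunctions.

(** * Injective endomorphisms in finite dimension *)

Section FiniteDimensionalSurjectivity.
Variables (K : fieldType) (M : lmodType K) (S : set M) (N : nat).
Variables (coords : {linear M -> 'rV[K]_N}) (T : M -> M).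
Hypothesis S0 : S 0.
Hypothesis Slin : forall c x y, S x -> S y -> S (c *: x + y).
Hypothesis coords_inj : forall x, S x -> coords x = 0 -> x = 0.
Hypothesis TS : forall x, S x -> S (T x).
Hypothesis Tlin : forall c x y, S x -> S y -> T (c *: x + y) = c *: T x + T y.
Hypothesis T_inj : forall x, S x -> T x = 0 -> x = 0.

(** The polynomial in [T] with coefficients [c], applied to [y].  Horner's scheme
    suits a map [T] that is linear on [S] only. *)
Let horner_op (c : seq K) (y : M) : M := foldr (fun a acc => a *: y + T acc) 0 c.

Let horner_op_cons a c y : horner_op (a :: c) y = a *: y + T (horner_op c y).
Proof. by []. Qed.

Let horner_op_S c y : S y -> S (horner_op c y).
Proof. by move=> Sy; elim: c => //= a c IH; apply: Slin => //; exact: TS. Qed.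

Let T0 : T 0 = 0.
Proof.
have := Tlin 1 S0 S0; rewrite !scale1r addr0 => /eqP.
by rewrite -subr_eq0 opprD addrA subrr add0r oppr_eq0 => /eqP.
Qed.

Let T_horner_op c y : S y -> T (horner_op c y) = horner_op c (T y).
Proof.
move=> Sy; elim: c => [|a c IH]; first exact: T0.
by rewrite !horner_op_cons Tlin ?IH //; rewrite -IH; apply: TS; exact: horner_op_S.
Qed.

Let coords_horner_op c y : S y ->
  coords (horner_op c y) = \sum_(i < size c) c`_i *: coords (iter i T y).
Proof.
elim: c y => [|a c IH] y Sy; first by rewrite big_ord0 linear0.
rewrite horner_op_cons linearP T_horner_op // IH; last exact: TS.
rewrite big_ord_recl /=; congr (_ + _); apply: eq_bigr => i _.
by rewrite -iterSr.
Qed.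

Let horner_op_eq0 c y : S y -> horner_op c y = 0 -> has (fun a => a != 0) c ->
  exists2 x, S x & T x = y.
Proof.
move=> Sy; elim: c => // a c IH; rewrite horner_op_cons.
have Sc := horner_op_S c Sy.
have [->|a0 E _] := eqVneq a 0.
  by rewrite scale0r add0r => /(T_inj Sc)/IH h; rewrite /= eqxx => /h.
exists (- a^-1 *: horner_op c y + 0); first exact: Slin.
rewrite Tlin // T0 addr0; apply: (scalerI a0); rewrite scalerA mulrN divff //.
by rewrite scaleN1r; apply/eqP; rewrite eq_sym -subr_eq0 opprK E.
Qed.

(** In a space that embeds in a finite-dimensional one, the vectors [y], [T y],
    [T (T y)], and so on satisfy a linear relation.  Injectivity allows powers of
    [T] to be cancelled until [y] has a nonzero coefficient, and then [y] is a
    value of [T]. *)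
Lemma injective_onto y : S y -> exists2 x, S x & T x = y.
Proof.
move=> Sy; pose A : 'M[K]_(N.+1, N) := \matrix_i coords (iter i T y).
have : kermx A != 0.
  rewrite kermx_eq0 /row_free; apply/eqP => rA.
  by have := rank_leq_col A; rewrite rA ltnn.
move=> /rowV0Pn [u /sub_kermxP uA u0].
pose c := [seq u 0 i | i <- enum 'I_N.+1].
have sc : size c = N.+1 by rewrite size_map size_enum_ord.
apply: (horner_op_eq0 (c := c) Sy).
  apply: coords_inj; first exact: horner_op_S.
  rewrite coords_horner_op // -[RHS]uA mulmx_sum_row sc; apply: eq_bigr => i _.
  by rewrite rowK (nth_map i) ?size_enum_ord // nth_ord_enum.
apply/hasP; have /rV0Pn [i ui] := u0.
by exists (u 0 i) => //; apply: map_f; rewrite mem_enum.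
Qed.
End FiniteDimensionalSurjectivity.

(** * Integral elements of the function field *)

Lemma horner_fraction (R : idomainType) (p : {poly R}) (a b : R) n :
  (size p <= n.+1)%N -> b != 0 ->
  (map_poly (@tofrac R) p).[tofrac a / tofrac b] * tofrac b ^+ n =
  tofrac (\sum_(i < n.+1) p`_i * a ^+ i * b ^+ (n - i)).
Proof.
move=> sp b0; rewrite (@horner_coef_wide _ n.+1); last first.
  exact: leq_trans (size_poly _ _) sp.
rewrite raddf_sum mulr_suml; apply: eq_bigr => i _.
rewrite coef_map /= !tofracM !tofracXn -!mulrA; congr (_ * _).
have -> : tofrac b ^+ n = tofrac b ^+ i * tofrac b ^+ (n - i).
  by rewrite -exprD subnKC // -ltnS.
by rewrite exprMn mulrA exprVn mulfVK // expf_neq0 // tofrac_eq0.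
Qed.

Lemma integral_tofracD (R : idomainType) (z w : {fraction R}) :
  integralOver (@tofrac R) z -> integralOver (@tofrac R) w ->
  integralOver (@tofrac R) (z + w).
Proof. by move=> iz iw; exact: (@integral_add R {fraction R} (@tofrac R) z w iz iw). Qed.

Lemma integral_tofracM (R : idomainType) (z w : {fraction R}) :
  integralOver (@tofrac R) z -> integralOver (@tofrac R) w ->
  integralOver (@tofrac R) (z * w).
Proof. by move=> iz iw; exact: (@integral_mul R {fraction R} (@tofrac R) z w iz iw). Qed.

Section Integral.
Variables (K : closedFieldType) (V : vectType K) (X : irred_set V).
Local Notation inF := (@tofrac (regfun X)).

Lemma integral_linear c (z w : function_field X) :
  integralOver inF z -> integralOver inF w -> integralOver inF (c *: z + w).
Proof.
move=> iz iw; rewrite ff_scaleE; refine (integral_tofracD _ iw).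
by refine (integral_tofracM _ iz); exact: integral_id.
Qed.

Lemma integral_fractionP (a b : regfun X) : b != 0 ->
  integralOver inF (inF a / inF b) <->
  exists2 p : {poly regfun X}, p \is monic &
    \sum_(i < size p) p`_i * a ^+ i * b ^+ ((size p).-1 - i) = 0.
Proof.
move=> b0; have H (p : {poly regfun X}) : p \is monic ->
    root (map_poly inF p) (inF a / inF b) <->
    \sum_(i < size p) p`_i * a ^+ i * b ^+ ((size p).-1 - i) = 0.
  move=> mp; have [n sp] : exists n, size p = n.+1.
    by exists (size p).-1; rewrite prednK // lt0n size_poly_eq0 monic_neq0.
  have := @horner_fraction _ p a b n; rewrite sp => /(_ (leqnn _) b0) /= E.
  rewrite rootE; split=> [/eqP r0|s0].
    apply/eqP; rewrite -(@tofrac_eq0 (regfun X)); apply/eqP.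
    by rewrite -E r0 mul0r.
  have bn0 : inF b ^+ n != 0 by rewrite expf_neq0 // tofrac_eq0.
  by rewrite -(mulIr_eq0 _ (mulIf bn0)) E s0 tofrac0.
by split=> [[p mp /(H p mp)]|[p mp /(H p mp)]]; exists p.
Qed.

End Integral.

Section IntegralCurves.
Variables (K : closedFieldType) (V : vectType K) (X : irred_set V).

(** Along the curve, [a / b] is [C / t^k].  An integral equation of degree [n],
    multiplied by [t^(k n)], becomes [C^n = 0] at [t = 0], because its
    coefficients are regular functions on [X] and the curve stays in [X]. *)
Lemma integral_no_pole (a b : regfun X) (c : K -> V) (t1 C : K) k :
  b != 0 -> integralOver (@tofrac (regfun X)) (tofrac a / tofrac b) ->
  polycurve c -> (forall t, (X : set V) (c t)) -> value b (c t1) != 0 -> (0 < k)%N ->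
  (forall t, t != 0 -> value a (c t) * t ^+ k = C * value b (c t)) -> C = 0.
Proof.
move=> b0 /(integral_fractionP a b0) [p mp p0] hc Xc b1 k0 pole.
have [n sp] : exists n, size p = n.+1.
  by exists (size p).-1; rewrite prednK // lt0n size_poly_eq0 monic_neq0.
apply/eqP; apply: contraT => C0.
pose E t := \sum_(i < n.+1) value p`_i (c t) * C ^+ i * t ^+ (k * (n - i)).
have E0 t : t != 0 -> value b (c t) != 0 -> E t = 0.
  move=> t0 bt0; apply: (mulIf (expf_neq0 n bt0)); rewrite mul0r.
  have := congr1 (fun f => value f (c t) * t ^+ (k * n)) p0.
  rewrite value0 mul0r => <-; rewrite value_sum sp /= !mulr_suml; apply: eq_bigr => i _.
  rewrite !valueM !valueX //.
  have iN : (i <= n)%N by rewrite -ltnS.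
  have -> : t ^+ (k * n) = (t ^+ k) ^+ i * t ^+ (k * (n - i)).
    by rewrite -exprM -exprD -mulnDr subnKC.
  have -> : value b (c t) ^+ n = value b (c t) ^+ i * value b (c t) ^+ (n - i).
    by rewrite -exprD subnKC.
  transitivity (value p`_i (c t) * (C * value b (c t)) ^+ i
    * value b (c t) ^+ (n - i) * t ^+ (k * (n - i))); first by rewrite exprMn; ring.
  by rewrite -pole // exprMn; ring.
have /choice [r /choice [s rsP]] : forall i : 'I_n.+1, exists r s : {poly K},
    s.[0] != 0 /\ forall t, s.[t] != 0 -> value p`_i (c t) * s.[t] = r.[t].
  by move=> i; exact: (regular_curve 0 (regular_value p`_i) hc Xc).
have [rb [sb [sb1 rbP]]] := regular_curve t1 (regular_value b) hc Xc.
(* [G] is [E] cleared of the denominators of its coefficients. *)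
pose S := \prod_i s i.
pose G := \sum_(i < n.+1) C ^+ i *: ('X^(k * (n - i)) * (r i * \prod_(j | j != i) s j)).
have GE t : S.[t] != 0 -> G.[t] = E t * S.[t].
  move=> St; rewrite horner_sum mulr_suml; apply: eq_bigr => i _.
  have Si : S = s i * \prod_(j | j != i) s j by rewrite /S (bigD1 i).
  have si0 : (s i).[t] != 0 by apply: contraNneq St => si; rewrite Si hornerM si mul0r.
  rewrite hornerZ !hornerM hornerXn Si hornerM -(proj2 (rsP i) t si0).
  by move: (value _ _) (_.[t]) (_.[t]) (C ^+ i) (t ^+ _) => x1 x2 x3 x4 x5; ring.
have S0 : S.[0] != 0 by rewrite horner_prod; apply/prodf_neq0 => i _; exact: (proj1 (rsP i)).
(* At [t = 0] only the leading term survives, and [p] is monic. *)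
have G0 : G.[0] != 0.
  rewrite GE // mulf_neq0 // /E big_ord_recr big1 /= => [|i _].
    have -> : p`_n = 1 by have := monicP mp; rewrite lead_coefE sp.
    by rewrite value1 ?subnn ?muln0 ?expr0 ?mulr1 ?mul1r ?add0r ?expf_neq0 //.
  rewrite expr0n muln_eq0 subn_eq0 leqNgt ltn_ord orbF.
  by move: k0; rewrite lt0n => /negbTE ->; rewrite mulr0.
have rb1 : rb.[t1] != 0 by rewrite -rbP // mulf_neq0.
have nz (q : {poly K}) t : q.[t] != 0 -> q != 0 by apply: contraNneq => ->; rewrite horner0.
have : G * 'X * S * rb * sb != 0.
  by rewrite !mulf_neq0 ?polyX_eq0 ?(nz _ _ G0) ?(nz _ _ S0) ?(nz _ _ rb1) ?(nz _ _ sb1).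
move=> /closed_field_nonroot [t]; rewrite !hornerM hornerX !mulf_eq0 !negb_or.
move=> /andP [/andP [/andP [/andP [Gt t0] St] rbt] sbt].
case/eqP: Gt; rewrite GE // E0 ?mul0r //.
by apply: contraNneq rbt => bt; rewrite -rbP // bt mul0r.
Qed.
End IntegralCurves.

Section IntegralAction.
Variables (K : closedFieldType) (n d : nat) (P : dhomog n.+1 K d).
Local Notation X := (orbit_closure_irred P).

(** Automorphisms transform integral equations into integral equations. *)
Lemma integral_act (g : @GL K n.+1) z :
  normalization_ring X z -> normalization_ring X (normalization_act P g z).
Proof.
have [a [b [b0 ->]]] := ff_fraction z.
have gb0 : orbit_closure_act g b != 0.
  apply: contra_neq b0 => gb; apply: (@orbit_closure_act_inj _ _ _ P g).
  by rewrite gb /orbit_closure_act raddf0.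
rewrite (normalization_actE g a b0) => iz.
have [p mp p0] := (integral_fractionP a b0).1 iz.
apply: (integral_fractionP (orbit_closure_act g a) gb0).2.
pose f : {rmorphism regfun X -> regfun X} := orbit_closure_act g.
have finj : injective f := @orbit_closure_act_inj _ _ _ P g.
exists (map_poly f p); first exact: monic_map.
rewrite size_map_inj_poly ?rmorph0 //.
transitivity (f 0); last by rewrite rmorph0.
rewrite -[X in _ = f X]p0 rmorph_sum; apply: eq_bigr => i _.
by rewrite coef_map !rmorphM !rmorphXn.
Qed.
End IntegralAction.

(** * Consequences of an isomorphism *)

(** A subspace of maximal dimension among those contained in [W] is [W]. *)
Lemma vspace_of_set (K : fieldType) (V : vectType K) (W : set V) : W 0 ->
  (forall c u v, W u -> W v -> W (c *: u + v)) ->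
  exists U : {vspace V}, forall v, (v \in U) <-> W v.
Proof.
move=> W0 Wlin; pose Q k := `[< exists U : {vspace V}, \dim U = k /\ forall v, v \in U -> W v >].
have Q0 : exists k, Q k.
  by exists 0%N; apply/asboolP; exists 0%VS; rewrite dimv0; split=> // v; rewrite memv0 => /eqP ->.
have Qb k : Q k -> (k <= \dim {:V})%N.
  by move=> /asboolP [U [<- _]]; rewrite dimvS ?subvf.
have [k /asboolP [U [dU UW]] kmax] := ex_maxnP Q0 Qb.
exists U => v; split=> [/UW //|Wv].
have : Q (\dim (U + <[v]>)%VS).
  apply/asboolP; exists (U + <[v]>)%VS; split=> // w /memv_addP [u /UW Wu [_ /vlineP [c ->] ->]].
  by rewrite addrC; apply: Wlin.
move=> /kmax; rewrite -dU => le.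
have : (U == U + <[v]>)%VS by rewrite eqEdim addvSl.
by move/eqP => ->; rewrite memvE addvSr.
Qed.

Section Isomorphism.
Variables (K : closedFieldType) (n d : nat) (P : dhomog n.+1 K d).
Local Notation GLn := (@GL K n.+1).
Local Notation Om := (Defs.orbit P).
Local Notation X := (orbit_closure_irred P).
Variables (N : nat) (rho : 'M[K]_n.+1 -> 'M[K]_N) (lambda : 'I_n.+1 -> int).
Hypothesis dom : dominant lambda /\ forall i, 0 <= lambda i.
Hypothesis rhoV : is_Vlambda lambda rho.

(** The kernel is a stable subspace of an irreducible representation. *)
Lemma equivariant_injective (M : lmodType K) (act : GLn -> M -> M)
    (h : 'cV[K]_N -> M) : (forall g, act g 0 = 0) ->
  equivariant rho act h -> (exists v, h v != 0) -> injective h.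
Proof.
move=> act0 [hlin heq] [v0 hv0]; have [_ [_ irr] _] := rhoV.
pose hL : {linear 'cV[K]_N -> M} := HB.pack h (GRing.isLinear.Build _ _ _ _ h hlin).
have [] := @vspace_of_set _ _ [set v | h v = 0].
- exact: (linear0 hL).
- by move=> c u v /= hu hv; rewrite hlin hu hv scaler0 addr0.
move=> U hU; have [|U0|Uf] := irr U.
- move=> g v Gg /hU hv; apply/hU => /=.
  by have := heq (SigSub (mem_set Gg)) v; rewrite /= => ->; rewrite hv act0.
- move=> u v uv; apply/eqP; rewrite -subr_eq0 -memv0 -U0; apply/hU => /=.
  by rewrite -[LHS]/(hL _) linearB; change (h u - h v = 0); rewrite uv subrr.
- by case/eqP: hv0; apply/hU; rewrite Uf memvf.
Qed.

Lemma orbit_act0 (g : GLn) : orbit_act P g 0 = 0.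
Proof. by rewrite /orbit_act raddf0. Qed.

(** A nonzero equivariant map is injective, so that its image is a submodule
    isomorphic to [V(lambda)]. *)
Lemma equivariant_polynomial_part h v : equivariant rho (orbit_act P) h ->
  polynomial_part (orbit_act P) (h v).
Proof.
move=> heqv; have [hlin heq] := heqv.
have [hv0|hv0] := pselect (h v = 0).
  by exists [::] => //; rewrite hv0 big_nil.
exists [:: h v]; first by rewrite big_seq1.
move=> y; rewrite inE => /eqP ->.
pose hL : {linear 'cV[K]_N -> regfun Om} := HB.pack h (GRing.isLinear.Build _ _ _ _ h hlin).
have ex : exists v, h v != 0 by exists v; apply: contra_notN hv0 => /eqP.
have hinj := equivariant_injective orbit_act0 heqv ex.
by exists lambda, N, rho, hL; split=> //; exists v.
Qed.

(** The inverse [psi] of the isomorphism, followed by the extension of rational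
    functions to the orbit, defines an injective endomorphism [T] of the space [S] of
    equivariant maps to the functions on the orbit.  As the orbit is homogeneous,
    such a map is determined by its values at [P], so [injective_onto] applies:
    [h] is [T k] for some [k], and the values of [psi \o k] are integral. *)
Lemma isomorphic_integral h :
  GL_isomorphic (normalization_act P) (normalization_ring X)
    (orbit_act P) (polynomial_part (orbit_act P)) ->
  equivariant rho (orbit_act P) h ->
  exists z : 'cV[K]_N -> function_field X,
    [/\ linear z, forall v, normalization_ring X (z v)
      & forall v, @agree _ _ X Om (z v) (h v)].
Proof.
move=> [phi [[phiB phi_inj phi_surj] phi_lin phi_eq]] hh.
set A := normalization_ring X in phiB phi_inj phi_surj phi_lin phi_eq *.
set B := polynomial_part (orbit_act P) in phiB phi_surj.
have Alin c x y : A x -> A y -> A (c *: x + y) by exact: integral_linear.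
have A0 : A 0.
  by have := integral_id (@tofrac (regfun X)) 0; rewrite /A /normalization_ring /= rmorph0.
have phi_injA x y : A x -> A y -> phi x = phi y -> x = y.
  by move=> Ax Ay; apply: phi_inj; rewrite inE.
have phi0 : phi 0 = 0.
  have := phi_lin 1 0 0 A0 A0; rewrite !scale1r addr0 => /eqP.
  by rewrite -subr_eq0 opprD addrA subrr add0r oppr_eq0 => /eqP.
have /choice [psi psiP] y : exists x, B y -> A x /\ phi x = y.
  have [By|nB] := pselect (B y); last by exists 0.
  by have [x Ax <-] := phi_surj y By; exists x.
pose M := 'cV[K]_N -> regfun Om.
pose S : set M := [set k | equivariant rho (orbit_act P) k].
have SB (k : M) v : S k -> B (k v) by exact: equivariant_polynomial_part.
have S0 : S 0.
  split=> [c u v|g v]; first by rewrite /= /cst /= scaler0 addr0.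
  by rewrite [RHS]orbit_act0.
have Slin c (k k' : M) : S k -> S k' -> S (c *: k + k').
  move=> [l e] [l' e']; split=> [b u v|g v].
    rewrite -[LHS]/(c *: k (b *: u + v) + k' (b *: u + v)).
    rewrite -[RHS]/(b *: (c *: k u + k' u) + (c *: k v + k' v)) l l'.
    by rewrite !scalerDr !scalerA [b * c]mulrC -!addrA; congr (_ + _); rewrite addrCA.
  rewrite -[LHS]/(c *: k (rho (val g) *m v) + k' (rho (val g) *m v)) e e'.
  apply: value_ext => x Ox; rewrite valueD valueZ !(value_orbit_act g) //.
  by rewrite -valueZ -valueD.
pose psi' (k : M) := fun v => psi (k v).
have psi_lin c (k k' : M) v : S k -> S k' ->
    psi (c *: k v + k' v) = c *: psi (k v) + psi (k' v).
  move=> Sk Sk'; have Skk : B (c *: k v + k' v) := SB _ v (Slin c _ _ Sk Sk').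
  have [Ak Ek] := psiP _ (SB _ v Sk); have [Ak' Ek'] := psiP _ (SB _ v Sk').
  have [Akk Ekk] := psiP _ Skk; apply: (phi_injA _ _ Akk (Alin c _ _ Ak Ak')).
  by rewrite Ekk (phi_lin c _ _ Ak Ak') Ek Ek'.
have psi_eq k : S k -> equivariant rho (normalization_act P) (psi' k).
  move=> Sk; have [l e] := Sk; split=> [c u v|g v]; rewrite /psi'.
    have [Au Eu] := psiP _ (SB _ u Sk); have [Av Ev] := psiP _ (SB _ v Sk).
    have [Aw Ew] := psiP _ (SB _ (c *: u + v) Sk).
    apply: (phi_injA _ _ Aw (Alin c _ _ Au Av)).
    by rewrite Ew (phi_lin c _ _ Au Av) Eu Ev l.
  have [Av Ev] := psiP _ (SB _ v Sk).
  have [Aw Ew] := psiP _ (SB _ (rho (val g) *m v) Sk).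
  apply: (phi_injA _ _ Aw (integral_act g Av)).
  by rewrite Ew (phi_eq g _ Av) Ev e.
have [[rho1 rhoM _] _ _] := rhoV.
have /choice [T hT] k : exists k' : M, S k ->
    S k' /\ forall v, @agree _ _ X Om (psi (k v)) (k' v).
  have [Sk|nS] := pselect (S k); last by exists 0.
  by have [k' Sk' hk'] := equivariant_extension rho1 rhoM (psi_eq k Sk); exists k'.
(* The embedding of [S] in a finite-dimensional space. *)
pose coords (k : M) : 'rV[K]_N := \row_j value (k (delta_mx j 0)) P.
have coords_lin : linear coords.
  by move=> c k k'; apply/rowP => j; rewrite !mxE -valueZ -valueD.
pose coordsL : {linear M -> 'rV[K]_N} :=
  HB.pack coords (GRing.isLinear.Build _ _ _ _ coords coords_lin).
have OmP : Om P by exists 1%:M; [exact: unitmx1|exact: precomp1].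
have coords_inj k : S k -> coordsL k = 0 -> k = 0.
  move=> [l e] k0; apply/funext => v; apply: value_ext => _ [g Gg <-].
  have kP w : value (k w) P = 0.
    pose kL : {linear 'cV[K]_N -> regfun Om} := HB.pack k (GRing.isLinear.Build _ _ _ _ k l).
    rewrite [w]matrix_sum_delta -[k _]/(kL _) linear_sum value_sum big1 // => j _.
    rewrite big_ord_recl big_ord0 addr0 linearZ valueZ ord1.
    by have /rowP/(_ j) := k0; rewrite !mxE => ->; rewrite mulr0.
  have := value_orbit_act (SigSub (mem_set Gg)) (k v) OmP; rewrite /= => <-.
  by rewrite -e kP value0.
have [k Sk Tk] : exists2 k, S k & T k = h.
  apply: (injective_onto (coords := coordsL) S0 Slin coords_inj _ _ _ hh).
  - by move=> k /hT [].
  - move=> c k k' Sk Sk'; apply/funext => v.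
    have [_ a1] := hT _ (Slin c _ _ Sk Sk').
    have [_ a2] := hT _ Sk; have [_ a3] := hT _ Sk'.
    apply: (agree_uniq (a1 v)).
    by have := agree_lin c (a2 v) (a3 v); rewrite -psi_lin.
  - move=> k Sk Tk; apply/funext => v; have [_ a1] := hT _ Sk.
    have := a1 v; rewrite Tk => /agree_0r p0.
    by have [_ <-] := psiP _ (SB _ v Sk); rewrite p0 phi0.
exists (psi' k); split; first exact: (psi_eq _ Sk).1.
  by move=> v; exact: (psiP _ (SB _ v Sk)).1.
by move=> v; rewrite -Tk; exact: (hT _ Sk).2.
Qed.
End Isomorphism.

(** * A covariant with a pole on the boundary *)

Section HessianCovariant.
Variable K : numClosedFieldType.
Local Notation form := (dhomog 3 K).

(** The exponent is chosen so that the weight is [det^12], the weight of the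
    semi-invariants by which this form is divided. *)
Definition hess6 (Q : form 3) : form (3 * 6)%N :=
  DHomog (dhomogMn 6 (dhomog_is_dhomog (hess Q))).

Lemma hess6_precomp g Q : hess6 (precomp g Q) = \det g ^+ 12 *: precomp g (hess6 Q).
Proof.
apply: val_inj; rewrite /= rmorphXn /=.
have /(congr1 (@mpoly_of_dhomog _ _ _)) /= -> := hess_precomp g Q.
by rewrite exprZn -exprM.
Qed.

Lemma eval_at_hess6 Q v : eval_at (hess6 Q) v = eval_at (hess Q) v ^+ 6.
Proof. by rewrite !eval_at_meval /= rmorphXn. Qed.

Lemma polyfun_pairing_hess6 (v : 'cV[K]_(\dim {:form (3 * 6)%N})) :
  polyfun (fun Q : form 3 => pairing (hess6 Q) v).
Proof.
apply: polyfun_sum => i; apply: polyfunM; last exact: polyfun_cst.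
apply: polyfun_coord_family.
have hH : polyfamily (fun Q : form 3 => mpoly_of_dhomog (hess Q)).
  move=> m.
  apply: (@polyfun_ext _ _ (fun Q : form 3 =>
    coef (hess Q) 3 0 0 * ('X_[mono 3 0 0] : {mpoly K[3]})@_m
    + coef (hess Q) 2 1 0 * ('X_[mono 2 1 0] : {mpoly K[3]})@_m
    + coef (hess Q) 2 0 1 * ('X_[mono 2 0 1] : {mpoly K[3]})@_m
    + coef (hess Q) 1 2 0 * ('X_[mono 1 2 0] : {mpoly K[3]})@_m
    + coef (hess Q) 1 1 1 * ('X_[mono 1 1 1] : {mpoly K[3]})@_m
    + coef (hess Q) 1 0 2 * ('X_[mono 1 0 2] : {mpoly K[3]})@_m
    + coef (hess Q) 0 3 0 * ('X_[mono 0 3 0] : {mpoly K[3]})@_m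
    + coef (hess Q) 0 2 1 * ('X_[mono 0 2 1] : {mpoly K[3]})@_m
    + coef (hess Q) 0 1 2 * ('X_[mono 0 1 2] : {mpoly K[3]})@_m
    + coef (hess Q) 0 0 3 * ('X_[mono 0 0 3] : {mpoly K[3]})@_m)).
    by move=> Q; rewrite [in RHS](cubicE (hess Q)) /= !mcoeffD !mcoeffZ.
  by do !apply: polyfunD; apply: polyfunM;
    (exact: polyfun_cst || exact: polyfun_coef_hess).
have := @polyfamily_prod _ _ _ unit [:: tt] (fun=> _) (fun=> 6%N) (fun=> hH).
by congr polyfamily; apply/funext => Q; rewrite big_seq1.
Qed.

(** The cube of the Aronhold invariant if [a != 0], and the invariant of the
    Hessian if [a = 0]: on Weierstrass forms these are multiples of [a^3] and of
    [a^3 + 9 b^2]. *)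
Lemma semi_invariant (a b : K) : 4 * a ^+ 3 + 27 * b ^+ 2 != 0 ->
  exists D : form 3 -> K, [/\ polyfun D,
    forall g Q, g \in unitmx -> D (precomp g Q) = \det g ^+ 12 * D Q,
    forall t, D (weierstrass (t ^+ 4 * a) (t ^+ 6 * b)) = t ^+ 12 * D (weierstrass a b)
    & D (weierstrass a b) != 0].
Proof.
move=> disc; have [a0|a0] := eqVneq a 0.
  have b0 : b != 0.
    by apply: contraNneq disc => ->; rewrite a0 !expr0n !mulr0 addr0.
  exists (@aronhold_hess K); split.
  - exact: polyfun_aronhold_hess.
  - by move=> g Q; exact: aronhold_hess_precomp.
  - by move=> t; rewrite !aronhold_hess_weierstrass a0; ring.
  - rewrite aronhold_hess_weierstrass a0 expr0n add0r.
    by rewrite !mulf_neq0 ?oppr_eq0 ?mulf_neq0 ?expf_neq0 ?pnatr_eq0.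
exists (fun Q => aronhold Q ^+ 3); split.
- exact: polyfunX (@polyfun_aronhold K).
- by move=> g Q ug; rewrite aronhold_precomp // exprMn -exprM.
- by move=> t; rewrite !aronhold_weierstrass; ring.
- by rewrite aronhold_weierstrass expf_neq0 // mulf_neq0 // pnatr_eq0.
Qed.

(** On the line [z = 0], the Hessian of a Weierstrass form is [24 x y^2] for all
    [a] and [b]. *)
Lemma weierstrass_curve_hess6 (a b t : K) :
  eval_at (hess6 (weierstrass (t ^+ 4 * a) (t ^+ 6 * b))) (vec3 1 1 0) = 24 ^+ 6.
Proof.
rewrite eval_at_hess6 hess_weierstrass eval_at_vec3 eval_cubic; congr (_ ^+ 6); ring.
Qed.

(** The functions [h v] depend equivariantly on [v], so by [isomorphic_integral]
    they would all be integral over the coordinate ring of the orbit closure.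
    Up to a translation, the value of one of them along the curve
    [weierstrass (t^4 a) (t^6 b)] is a nonzero multiple of [t^-12], because the numerator
    is constant by [weierstrass_curve_hess6], and the denominator is a multiple of
    [t^12]; this contradicts [integral_no_pole]. *)
Theorem normalization_not_isomorphic (P : form 3) : nonsingular P ->
  ~ GL_isomorphic (normalization_act P) (normalization_ring (orbit_closure_irred P))
      (orbit_act P) (polynomial_part (orbit_act P)).
Proof.
move=> nP iso; have [[a b] /= disc [kP ukP kPE]] := weierstrass_form nP.
set W := weierstrass a b in kPE.
have simPW : equivalent P W by exists kP.
have [D [pD Dprecomp DW DW0]] := semi_invariant disc.
pose N := \dim {:form (3 * 6)%N}.
have D0 Q : Defs.orbit P Q -> D Q != 0.
  rewrite (equivalent_orbit simPW) => -[g ug <-]; rewrite Dprecomp // mulf_neq0 // expf_neq0 //.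
  by rewrite -unitfE -unitmxE.
pose h (v : 'cV[K]_N) := mkreg (regular_on_polyfun (polyfun_pairing_hess6 v) pD D0).
have hE v Q : Defs.orbit P Q -> value (h v) Q = pairing (hess6 Q) v / D Q.
  by move=> OQ; rewrite value_mkreg.
have heq : equivariant (@dual_rep K 2 (3 * 6)) (orbit_act P) h.
  split=> [c u v|g v]; apply: value_ext => Q OQ.
    rewrite valueD valueZ !hE //.
    pose l (v : 'cV[K]_N) : K^o := pairing (hess6 Q) v.
    have lin : linear l := @pairing_linearr K 2 (3 * 6) (hess6 Q).
    rewrite -[pairing (hess6 Q) _]/(l (c *: u + v)) lin mulrDl.
    by rewrite -[c *: l u]/(c * l u) mulrA.
  have ug := glP g; have OgQ := orbit_precomp g OQ.
  rewrite (value_orbit_act g) // !hE // hess6_precomp Dprecomp // -pairing_precomp.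
  have -> : pairing (\det (val g) ^+ 12 *: precomp (val g) (hess6 Q)) v =
      \det (val g) ^+ 12 * pairing (precomp (val g) (hess6 Q)) v.
    have lin := @pairing_linearl K 2 (3 * 6) v.
    have := lin (\det (val g) ^+ 12) (precomp (val g) (hess6 Q)) 0.
    rewrite addr0 => ->; rewrite /pairing [X in _ + X]big1 ?addr0 // => i _.
    by rewrite linear0 mul0r.
  have g0 : \det (val g) ^+ 12 != 0 by rewrite expf_neq0 // -unitfE -unitmxE.
  by rewrite -mulf_div divff // mul1r.
have dom := row_weight_dominant (3 * 6).
have [z [zlin zint zh]] := isomorphic_integral dom (dual_rep_Vlambda K (3 * 6)) iso heq.
have [bb [aa [bb0 alin zE]]] := common_denominator zlin.
have [x1 [k1 uk1 x1E] bx1] : exists2 x1, Defs.orbit P x1 & value bb x1 != 0.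
  apply: contrapT => nb; case/eqP: bb0; apply: regfun_closure_eq0 => v Ov.
  by apply/eqP/negPn/negP => bv; apply: nb; exists v.
(* Translated by [c], the curve passes at [t = 1] through the point [x1], where
   the denominator [bb] does not vanish. *)
pose c := invmx kP *m k1.
have uc : c \in unitmx by rewrite unitmx_mul unitmx_inv ukP.
have x1c : precomp c W = x1 by rewrite precompM (precompV_eq ukP kPE).
pose Wt t := weierstrass (t ^+ 4 * a) (t ^+ 6 * b).
pose gam t : form 3 := precomp c (Wt t).
have gam1 : gam 1 = x1 by rewrite /gam /Wt !expr1n !mul1r.
have curve : polycurve gam.
  exact: (polycurve_linear (precomp c) (polycurve_weierstrass a b)).
have gamX t : orbit_closure P (gam t).
  have simW : equivalent (Wt t) (gam t) by exists c.
  apply: orbit_closure_equivalent simW; rewrite /orbit_closure (equivalent_orbit simPW).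
  have [->|t0] := eqVneq t 0.
    by rewrite /Wt !expr0n !mul0r; exact: orbit_closure_cusp.
  apply: zclosure_sub; exact: equivalent_weierstrass_scale.
have gamO t : t != 0 -> Defs.orbit P (gam t).
  move=> t0; rewrite (equivalent_orbit simPW).
  by apply: (equivalent_trans (equivalent_weierstrass_scale a b t0)); exists c.
pose v := eval_vec (3 * 6) (invmx c *m vec3 1 1 0).
pose C := 24 ^+ 6 / D W.
have C0 : C != 0 by rewrite mulf_neq0 ?invr_eq0 // expf_neq0 // pnatr_eq0.
have fE t : t != 0 -> value (h v) (gam t) = C / t ^+ 12.
  move=> t0; rewrite (hE _ _ (gamO t t0)) /v.
  rewrite pairing_eval_vec /gam hess6_precomp Dprecomp // DW.
  have -> : eval_at (\det c ^+ 12 *: precomp c (hess6 (Wt t))) (invmx c *m vec3 1 1 0) =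
     \det c ^+ 12 * 24 ^+ 6.
    rewrite eval_at_meval /= mevalZ; congr (_ * _).
    have := eval_at_precomp (hess6 (Wt t)) c (invmx c *m vec3 1 1 0).
    by rewrite mulKVmx // weierstrass_curve_hess6 eval_at_meval.
  have g0 : \det c != 0 by rewrite -unitfE -unitmxE.
  by rewrite /C; field; rewrite t0 DW0 g0.
have hv x : Defs.orbit P x -> value (h v) x * value bb x = value (aa v) x.
  exact: (agree_value (zh v) bb0 (zE v)).
have iz : integralOver (@tofrac (regfun (orbit_closure_irred P))) (tofrac (aa v) / tofrac bb).
  by have := zint v; rewrite zE.
case/eqP: C0; apply: (integral_no_pole (t1 := 1) bb0 iz curve gamX _ (isT : (0 < 12)%N)).
  by rewrite gam1.
move=> t t0; rewrite -(hv _ (gamO t t0)) fE //; have t12 : t ^+ 12 != 0 by rewrite expf_neq0.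
by rewrite mulrAC divfK.
Qed.
End HessianCovariant.

Theorem theorem2 (R : realType) (P : dhomog 3 R[i] 3) (hP : nonsingular P) :
  [/\ reductive (stabilizer P),
      irreducible (boundary P) &
      ~ GL_isomorphic
          (normalization_act P)
          (normalization_ring (orbit_closure_irred P))
          (orbit_act P)
          (polynomial_part (orbit_act P))].
Proof.
split.
- exact: reductive_stabilizer.
- exact: irreducible_boundary.
- exact: normalization_not_isomorphic.
Qed.
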